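(* Let $k$ be a commutative ring with identity and let $R$ be an associative $k$-algebra with identity which is finitely generated as a left $k$-module, equipped with a $k$-linear involution, and let $(R,\Lambda)$ be a form ring. Let $\mathrm{G}(2n,\cdot,\cdot)$ and $\mathrm{E}(2n,\cdot,\cdot)$ denote either the general quadratic group $\mathrm{GQ}$ and its elementary subgroup $\mathrm{EQ}$ (with $2n\ge 6$), or the general Hermitian group $\mathrm{GH}$ and its elementary subgroup $\mathrm{EH}$ of the elements $a_1,\dots,a_r$ (with $2n\ge 6$ and $n>r$). If $\alpha(X)\in \mathrm{G}(2n,R[X],\Lambda[X])$ satisfies $\alpha(0)=\mathrm{I}_{2n}$ and $$\alpha_{\mathfrak m}(X)\in \mathrm{E}(2n,R_{\mathfrak m}[X],\Lambda_{\mathfrak m}[X])$$ for every maximal ideal $\mathfrak m$ of $k$, then $$\alpha(X)\in \mathrm{E}(2n,R[X],\Lambda[X]).$$ Here $R_{\mathfrak m}=S^{-1}R$ with $S=k\setminus\mathfrak m$, and $\alpha_{\mathfrak m}(X)$ is the image of $\alpha(X)$ over $R_{\mathfrak m}[X]$.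
   Context: **Form rings.** $R$ is an associative ring with identity with an involution $a\mapsto\bar a$ (additive, $\overline{ab}=\bar b\,\bar a$, $\bar{\bar a}=a$), and $\lambda$ is a fixed element of the center $C(R)$ with $\lambda\bar\lambda=1$. Put $\Lambda_{\max}=\{a\in R: a=-\lambda\bar a\}$ and $\Lambda_{\min}=\{a-\lambda\bar a: a\in R\}$. A ($\lambda$-)form parameter is an additive subgroup $\Lambda$ of $R$ with $\Lambda_{\min}\subseteq\Lambda\subseteq\Lambda_{\max}$ and $\bar x\Lambda x\subseteq\Lambda$ for all $x\in R$; $(R,\Lambda)$ is then called a form ring. The involution extends to $R[X]$ by $\bar X=X$ and to localizations at central multiplicative sets fixed elementwise by the involution. $\Lambda[X]$ is the smallest form parameter on $R[X]$ containing $\Lambda$; $\Lambda_{\mathfrak m}$ is the form parameter on $R_{\mathfrak m}$ induced by $\Lambda$ (the smallest one containing the image of $\Lambda$). **Notation.** For a matrix $M=(m_{ij})$, $\bar M=(\bar m_{ij})^t$ (conjugate transpose). $\rho(i)=n+i$ for $1\le i\le n$; $e_{ij}$ is the matrix unit. **Quadratic case.** $\psi_n=\begin{pmatrix}0&\lambda \mathrm{I}_n\\ \mathrm{I}_n&0\end{pmatrix}$. $\mathrm{GQ}(2n,R,\Lambda)$ is the group of all $\sigma=\begin{pmatrix}\alpha&\beta\\ \gamma&\delta\end{pmatrix}\in \mathrm{GL}_{2n}(R)$ ($n\times n$ blocks) with $\bar\sigma\psi_n\sigma=\psi_n$ and with all diagonal entries of $\bar\gamma\alpha$ and $\bar\delta\beta$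 in $\Lambda$ (i.e. $\sigma$ preserves the Hermitian form and the associated $\Lambda$-quadratic form). $\mathrm{EQ}(2n,R,\Lambda)$ is the subgroup generated by, for $1\le i,j\le n$: - $q\varepsilon_{ij}(a)=\mathrm{I}_{2n}+ae_{ij}-\bar a e_{\rho(j)\rho(i)}$ ($i\ne j$, $a\in R$); - $qr_{ij}(a)=\mathrm{I}_{2n}+ae_{i\rho(j)}-\lambda\bar a e_{j\rho(i)}$ ($i\neq j$, $a\in R$), $qr_{ii}(a)=\mathrm{I}_{2n}+ae_{i\rho(i)}$ ($a\in\Lambda$); - $ql_{ij}(a)=\mathrm{I}_{2n}+ae_{\rho(i)j}-\bar\lambda\bar a e_{\rho(j)i}$ ($i\ne j$, $a\in R$), $ql_{ii}(a)=\mathrm{I}_{2n}+ae_{\rho(i)i}$ ($\bar a\in\Lambda$). **Hermitian case.** Let $r\ge1$, $n>r$, and let $a_1,\dots,a_r\in\{c+\lambda\bar c: c\in R\}$ with $a_1=0$; let $A_1=\mathrm{diag}(a_1,\dots,a_r)$ and $A=A_1\perp 0_{n-r}$ ($n\times n$). $\psi^h_n=\begin{pmatrix}A&\lambda \mathrm{I}_n\\ \mathrm{I}_n&0\end{pmatrix}$ and $\mathrm{GH}(2n,R,a_1,\dots,a_r,\Lambda)=\{\sigma\in\mathrm{GL}_{2n}(R):\bar\sigma\psi^h_n\sigma=\psi^h_n\}$. Let $C=\{(x_1,\dots,x_r)^t\in R^r:\sum_i\bar x_ia_ix_i\in\{c+\lambda\bar c:c\in R\}\}$ (under the assumption on the $a_i$,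 $C=R^r$). For $\zeta=(x_1,\dots,x_r)^t\in C$, $\zeta_f\in R$ denotes any element with $\zeta_f+\lambda\bar\zeta_f=\sum_i\bar x_ia_ix_i$. $\mathrm{EH}(2n,R,a_1,\dots,a_r,\Lambda)$ is the subgroup generated by: - $h\varepsilon_{ij}(a)=\mathrm{I}_{2n}+ae_{ij}-\bar ae_{\rho(j)\rho(i)}$ ($r+1\le i\le n$, $1\le j\le n$, $i\ne j$, $a\in R$); - $hr_{ij}(a)=\mathrm{I}_{2n}+ae_{i\rho(j)}-\lambda\bar ae_{j\rho(i)}$ ($r+1\le i\neq j\le n$, $a\in R$), $hr_{ii}(a)=\mathrm{I}_{2n}+ae_{i\rho(i)}$ ($r+1\le i\le n$, $a\in\Lambda_{\max}$); - $hl_{ij}(a)=\mathrm{I}_{2n}+ae_{\rho(i)j}-\bar\lambda\bar ae_{\rho(j)i}$ ($1\le i\ne j\le n$, $a\in R$), $hl_{ii}(a)=\mathrm{I}_{2n}+ae_{\rho(i)i}$ ($1\le i\le n$, $\bar a\in\Lambda_{\max}$); - for $\zeta\in C$, $r+1\le i\le n$, in block sizes $r,n-r,r,n-r$: $$hm_i(\zeta)=\begin{pmatrix}\mathrm I_r&\alpha_{12}&0&0\\0&\mathrm I_{n-r}&0&0\\0&-\bar A_1\alpha_{12}&\mathrm I_r&0\\0&\gamma_{22}&-\bar\alpha_{12}&\mathrm I_{n-r}\end{pmatrix},\qquad hr_i(\zeta)=\begin{pmatrix}\mathrm I_r&0&0&\beta_{12}\\0&\mathrm I_{n-r}&-\lambda\bar\beta_{12}&\beta_{22}\\0&0&\mathrm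 I_r&-\bar A_1\beta_{12}\\0&0&0&\mathrm I_{n-r}\end{pmatrix},$$ where $\alpha_{12}$ (resp. $\beta_{12}$) is the $r\times(n-r)$ matrix with $(i-r)$-th column $\zeta$ and other columns $0$, $\gamma_{22}$ (resp. $\beta_{22}$) has $(i-r,i-r)$ entry $\bar\zeta_f$ (resp. $\lambda\bar\zeta_f$) and zeros elsewhere. Over $R[X]$ and $R_{\mathfrak m}[X]$ the Hermitian groups are taken with respect to (the images of) the same $a_1,\dots,a_r\in R$. *)

(* Defs.v *)
From HB Require Import structures.
From mathcomp Require Import all_boot all_order all_algebra.
From mathcomp Require Import generic_quotient ring_quotient.
From mathcomp Require Import boolp.
From mathcomp Require Import ring.

Set Implicit Arguments.
Unset Strict Implicit.
Unset Printing Implicit Defensive.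

Import GRing.Theory.

Local Open Scope ring_scope.
Local Open Scope quotient_scope.

(* The predicates are boolean, at no cost in generality: membership in any
   subset is decided by excluded middle in informative form (boolp). *)
Definition maximal_ideal (k : comNzRingType) (m : {pred k}) : Prop :=
  idealr_closed m /\
  (forall I : {pred k}, idealr_closed I -> {subset m <= I} -> {subset I <= m}).

Record maxideal (k : comNzRingType) := MaxIdeal {
  maxideal_pred :> {pred k};
  maxidealP : maximal_ideal maxideal_pred }.

Definition compl_maxideal (k : comNzRingType) (m : maxideal k) : {pred k} :=
  [pred s | s \notin maxideal_pred m].

Lemma compl_maxideal_mulr_closed (k : comNzRingType) (m : maxideal k) :
  mulr_closed (compl_maxideal m).
Proof.
have [[m0 m1 mD] mmax] := maxidealP m.
have mM a u : u \in maxideal_pred m -> a * u \in maxideal_pred m.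
  by move=> mu; rewrite -[a * u]addr0; apply: mD.
have mA u v : u \in maxideal_pred m -> v \in maxideal_pred m ->
    u + v \in maxideal_pred m by move=> mu mv; rewrite -[u]mul1r; apply: mD.
split=> // s t; rewrite !inE => ms mt; apply/negP => mst.
pose I : {pred k} :=
  [pred z | `[< exists x, x \in maxideal_pred m /\ exists a, z = x + a * s >]].
have IE z : (z \in I) =
  `[< exists x, x \in maxideal_pred m /\ exists a, z = x + a * s >] by [].
have mI : {subset maxideal_pred m <= I}.
  by move=> x mx; rewrite IE; apply/asboolP; exists x; split=> //; exists 0;
     rewrite mul0r addr0.
have [I1|I1] := boolP (1 \in I).
  move: I1; rewrite IE => /asboolP[x [mx [a e]]]; move/negP: mt; apply.
  by rewrite -[t]mulr1 e mulrDr; apply: mA; [exact: mM | rewrite mulrCA [t * s]mulrC; apply: mM].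
have Ii : idealr_closed I.
  split=> //; first exact: mI.
  move=> b u v; rewrite !IE => /asboolP[x [mx [a ->]]] /asboolP[y [my [c ->]]].
  apply/asboolP; exists (b * x + y); split; first exact: mD.
  by exists (b * a + c); rewrite mulrDr mulrDl addrACA mulrA.
move/negP: ms; apply; apply: (mmax I) => //; rewrite IE; apply/asboolP.
by exists 0; split=> //; exists 1; rewrite mul1r add0r.
Qed.

HB.instance Definition _ (k : comNzRingType) (m : maxideal k) :=
  GRing.isMulClosed.Build k (compl_maxideal m) (compl_maxideal_mulr_closed m).

Section Localization.

Variables (k : comNzRingType) (R : algType k) (S : mulrClosed k).

Definition lfrac := (R * {s : k | s \in S})%type.

Implicit Types x y z : lfrac.

Definition lfrac_eqv : rel lfrac := fun x y =>
  `[< exists2 u, u \in S & u *: (sval y.2 *: x.1) = u *: (sval x.2 *: y.1) >].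

Lemma lfrac_eqvP x y :
  reflect (exists2 u, u \in S & u *: (sval y.2 *: x.1) = u *: (sval x.2 *: y.1))
          (lfrac_eqv x y).
Proof. exact: asboolP. Qed.

Lemma lfrac_eqv_refl : reflexive lfrac_eqv.
Proof. by move=> x; apply/lfrac_eqvP; exists 1; rewrite ?rpred1. Qed.

Lemma lfrac_eqv_sym : symmetric lfrac_eqv.
Proof.
by move=> x y; apply/lfrac_eqvP/lfrac_eqvP => -[u Su e]; exists u.
Qed.

Lemma lfrac_eqv_trans : transitive lfrac_eqv.
Proof.
move=> [a s] [b t] [c w] /lfrac_eqvP[u Su /= e] /lfrac_eqvP[v Sv /= f].
apply/lfrac_eqvP => /=; exists (u * v * sval s).
  by rewrite !rpredM // (valP s).
transitivity ((v * sval w) *: (u *: (sval s *: b))).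
  by rewrite !scalerA; congr (_ *: _); ring.
transitivity ((u * sval t) *: (v *: (sval s *: c))); last first.
  by rewrite !scalerA; congr (_ *: _); ring.
by rewrite e -f !scalerA; congr (_ *: _); ring.
Qed.

Canonical lfrac_equiv :=
  EquivRel lfrac_eqv lfrac_eqv_refl lfrac_eqv_sym lfrac_eqv_trans.

(* S^-1 R: the fractions a / s with a in R and s in the multiplicative set S
   of k. The set S acts on R by scalars, so its image in R is central. R may be
   killed by an element of S, and then loc is the zero ring. *)
Definition loc := {eq_quot lfrac_eqv}.

HB.instance Definition _ : EqQuotient _ lfrac_eqv loc := EqQuotient.on loc.
HB.instance Definition _ := Choice.on loc.

Definition den_one : {s : k | s \in S} := exist _ 1 (rpred1 S).
Definition den_mul (s t : {s : k | s \in S}) : {s : k | s \in S} :=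
  exist _ (sval s * sval t) (rpredM (valP s) (valP t)).

Lemma loc_eqP x y :
  reflect (exists2 u, u \in S & u *: (sval y.2 *: x.1) = u *: (sval x.2 *: y.1))
          (\pi_loc x == \pi_loc y).
Proof. by rewrite eqmodE; exact: lfrac_eqvP. Qed.

Definition lfrac_add x y : lfrac :=
  (sval y.2 *: x.1 + sval x.2 *: y.1, den_mul x.2 y.2).
Definition lfrac_opp x : lfrac := (- x.1, x.2).
Definition lfrac_mul x y : lfrac := (x.1 * y.1, den_mul x.2 y.2).

Definition loc_zero : loc := \pi_loc (0, den_one).
Definition loc_one : loc := \pi_loc (1, den_one).
Definition loc_add := lift_op2 loc lfrac_add.
Definition loc_opp := lift_op1 loc lfrac_opp.
Definition loc_mul := lift_op2 loc lfrac_mul.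

Lemma repr_eqv x : lfrac_eqv (repr (\pi_loc x)) x.
Proof. by apply/lfrac_eqvP; apply/loc_eqP; rewrite reprK. Qed.

Lemma loc_add_pi x y : loc_add (\pi_loc x) (\pi_loc y) = \pi_loc (lfrac_add x y).
Proof.
unlock loc_add.
apply/eqP/loc_eqP => /=.
have /lfrac_eqvP[u Su e] := repr_eqv x.
have /lfrac_eqvP[v Sv f] := repr_eqv y.
move: (repr (\pi_loc x)) (repr (\pi_loc y)) e f => [a s] [b t]; case: x y => [a' s'] [b' t'] /= e f.
exists (u * v); first by rewrite rpredM.
rewrite !scalerDr; congr (_ + _).
  transitivity ((v * sval t * sval t') *: (u *: (sval s' *: a))).
    by rewrite !scalerA; congr (_ *: _); ring.
  by rewrite e !scalerA; congr (_ *: _); ring.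
transitivity ((u * sval s * sval s') *: (v *: (sval t' *: b))).
  by rewrite !scalerA; congr (_ *: _); ring.
by rewrite f !scalerA; congr (_ *: _); ring.
Qed.

Lemma loc_opp_pi x : loc_opp (\pi_loc x) = \pi_loc (lfrac_opp x).
Proof.
unlock loc_opp.
apply/eqP/loc_eqP => /=; have /lfrac_eqvP[u Su e] := repr_eqv x.
by exists u; rewrite // !scalerN e.
Qed.

Lemma loc_mul_pi x y : loc_mul (\pi_loc x) (\pi_loc y) = \pi_loc (lfrac_mul x y).
Proof.
unlock loc_mul.
apply/eqP/loc_eqP => /=.
have /lfrac_eqvP[u Su e] := repr_eqv x.
have /lfrac_eqvP[v Sv f] := repr_eqv y.
move: (repr (\pi_loc x)) (repr (\pi_loc y)) e f => [a s] [b t]; case: x y => [a' s'] [b' t'] /= e f.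
exists (u * v); first by rewrite rpredM.
have E (c d c' d' : k) : (c * c') *: (a * b) = (c *: a) * (c' *: b).
  by rewrite -scalerAl -scalerAr scalerA.
transitivity ((u *: (sval s' *: a)) * (v *: (sval t' *: b))).
  by rewrite -!scalerAl -!scalerAr !scalerA; congr (_ *: _); ring.
rewrite e f -!scalerAl -!scalerAr !scalerA; congr (_ *: _); ring.
Qed.

Let loc_ext (a b : R) (s t : {s : k | s \in S}) :
  sval t *: a = sval s *: b -> \pi_loc (a, s) = \pi_loc (b, t).
Proof. by move=> e; apply/eqP/loc_eqP; exists 1; rewrite ?rpred1 //= e. Qed.

Let loc_addA : associative loc_add.
Proof.
elim/quotW => -[a s]; elim/quotW => -[b t]; elim/quotW => -[c u].
rewrite !loc_add_pi; apply: loc_ext => /=.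
by rewrite !scalerDr !scalerA addrA; congr (_ *: _ + _ *: _ + _ *: _); ring.
Qed.

Let loc_addC : commutative loc_add.
Proof.
elim/quotW => -[a s]; elim/quotW => -[b t].
rewrite !loc_add_pi; apply: loc_ext => /=.
by rewrite addrC; congr (_ *: _); ring.
Qed.

Let loc_add0 : left_id loc_zero loc_add.
Proof.
elim/quotW => -[a s]; rewrite loc_add_pi; apply: loc_ext => /=.
by rewrite scaler0 add0r scale1r mul1r.
Qed.

Let loc_addN : left_inverse loc_zero loc_opp loc_add.
Proof.
elim/quotW => -[a s]; rewrite loc_opp_pi loc_add_pi; apply: loc_ext => /=.
by rewrite scalerN addNr !scaler0.
Qed.

HB.instance Definition _ :=
  GRing.isZmodule.Build loc loc_addA loc_addC loc_add0 loc_addN.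

Let loc_mulA : associative loc_mul.
Proof.
elim/quotW => -[a s]; elim/quotW => -[b t]; elim/quotW => -[c u].
rewrite !loc_mul_pi; apply: loc_ext => /=.
by rewrite mulrA; congr (_ *: _); ring.
Qed.

Let loc_mul1 : left_id loc_one loc_mul.
Proof.
elim/quotW => -[a s]; rewrite loc_mul_pi; apply: loc_ext => /=.
by rewrite !mul1r.
Qed.

Let loc_mulr1 : right_id loc_one loc_mul.
Proof.
elim/quotW => -[a s]; rewrite loc_mul_pi; apply: loc_ext => /=.
by rewrite !mulr1.
Qed.

Let loc_mulDl : left_distributive loc_mul loc_add.
Proof.
elim/quotW => -[a s]; elim/quotW => -[b t]; elim/quotW => -[c u].
rewrite !(loc_add_pi, loc_mul_pi); apply: loc_ext => /=.
rewrite mulrDl -!scalerAl !scalerDr !scalerA.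
by congr (_ *: _ + _ *: _); ring.
Qed.

Let loc_mulDr : right_distributive loc_mul loc_add.
Proof.
elim/quotW => -[a s]; elim/quotW => -[b t]; elim/quotW => -[c u].
rewrite !(loc_add_pi, loc_mul_pi); apply: loc_ext => /=.
rewrite mulrDr -!scalerAr !scalerDr !scalerA.
by congr (_ *: _ + _ *: _); ring.
Qed.

HB.instance Definition _ := GRing.Zmodule_isPzRing.Build loc
  loc_mulA loc_mul1 loc_mulr1 loc_mulDl loc_mulDr.

Definition loc_map (a : R) : loc := \pi_loc (a, den_one).

Definition loc_bar (bar : R -> R) : loc -> loc :=
  lift_op1 loc (fun x => (bar x.1, x.2)).

Lemma loc_bar_pi (bar : R -> R) (barZ : forall c a, bar (c *: a) = c *: bar a) x :
  loc_bar bar (\pi_loc x) = \pi_loc (bar x.1, x.2).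
Proof.
unlock loc_bar; apply/eqP/loc_eqP => /=; have /lfrac_eqvP[u Su e] := repr_eqv x.
by exists u; rewrite // -!barZ e.
Qed.

(* {poly _} is only available over nonzero rings. Nothing is lost when loc is
   zero: over the zero ring all matrices are equal, so that every condition of
   membership in an elementary group holds. *)
Definition nzloc (nz : (1 : loc) != 0) := loc.

HB.instance Definition _ (nz : (1 : loc) != 0) := GRing.PzRing.on (nzloc nz).
HB.instance Definition _ (nz : (1 : loc) != 0) :=
  GRing.PzSemiRing_isNonZero.Build (nzloc nz) nz.

End Localization.

Notation loc_at R m := (loc R (compl_maxideal m)).

Definition fin_gen_module (k : comNzRingType) (R : lmodType k) : Prop :=
  exists s : seq R, forall x : R, exists c : 'I_(size s) -> k,
    x = \sum_(i < size s) c i *: s`_i.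

Record formData (P : pzRingType) := FormData {
  bar : P -> P;
  lam : P;
  Lam : P -> Prop }.

Section FormRing.

Variables (P : pzRingType) (D : formData P).
Local Notation bar := (bar D).
Local Notation lam := (lam D).

Definition involution : Prop :=
  [/\ {morph bar : a b / a + b}, (forall a b, bar (a * b) = bar b * bar a)
    & involutive bar].

Definition Lam_max (a : P) : Prop := a = - (lam * bar a).
Definition Lam_min (a : P) : Prop := exists c, a = c - lam * bar c.
Definition trace_elt (a : P) : Prop := exists c, a = c + lam * bar c.

Definition form_parameter (L : P -> Prop) : Prop :=
  [/\ forall a b, L a -> L b -> L (a - b),
      forall a, Lam_min a -> L a,
      forall a, L a -> Lam_max a
    & forall x a, L a -> L (bar x * a * x)].

Definition form_ring : Prop :=
  [/\ involution, forall a, lam * a = a * lam, lam * bar lam = 1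
    & form_parameter (Lam D)].

Definition form_parameter_gen (B : P -> Prop) (a : P) : Prop :=
  forall L, form_parameter L -> (forall b, B b -> L b) -> L a.

End FormRing.

(* form_parameter_gen D' reads only the involution and lam of D'; the predicate
   fun=> False is a placeholder. *)
Definition poly_form (P : nzRingType) (D : formData P) : formData {poly P} :=
  let D' := FormData (map_poly (bar D)) (lam D)%:P (fun=> False) in
  FormData (bar D') (lam D')
    (form_parameter_gen D' (fun p => exists2 a, Lam D a & p = a%:P)).

Definition loc_form (k : comNzRingType) (R : algType k) (S : mulrClosed k)
    (nz : (1 : loc R S) != 0) (D : formData R) : formData (nzloc nz) :=
  let D' := FormData (loc_bar (bar D) : nzloc nz -> nzloc nz)
                     (loc_map S (lam D) : nzloc nz) (fun=> False) in
  FormData (bar D') (lam D')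
    (form_parameter_gen D' (fun x => exists2 a, Lam D a & x = loc_map S a)).

Definition poly_loc (k : comNzRingType) (R : algType k) (S : mulrClosed k)
    (nz : (1 : loc R S) != 0) : {poly R} -> {poly nzloc nz} :=
  map_poly (loc_map S : R -> nzloc nz).

Section Groups.

Variables (P : pzRingType) (D : formData P).
Local Notation bar := (bar D).
Local Notation lam := (lam D).
Local Notation Lam := (Lam D).

Definition conj_mx p q (M : 'M[P]_(p, q)) : 'M[P]_(q, p) := (map_mx bar M)^T.

(* unitmx requires a commutative ring *)
Definition is_GL N (M : 'M[P]_N) : Prop :=
  exists M' : 'M[P]_N, M *m M' = 1%:M /\ M' *m M = 1%:M.

Inductive subgroup_gen N (B : 'M[P]_N -> Prop) : 'M[P]_N -> Prop :=
| sg_in M : B M -> subgroup_gen B M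
| sg_one : subgroup_gen B 1%:M
| sg_mul M M' : subgroup_gen B M -> subgroup_gen B M' ->
    subgroup_gen B (M *m M')
| sg_inv M M' : subgroup_gen B M -> M *m M' = 1%:M -> M' *m M = 1%:M ->
    subgroup_gen B M'.

Definition psi_q n : 'M[P]_(n + n) := block_mx 0 lam%:M 1%:M 0.

Definition GQ n (sigma : 'M[P]_(n + n)) : Prop :=
  [/\ is_GL sigma,
      conj_mx sigma *m psi_q n *m sigma = psi_q n,
      forall i, Lam ((conj_mx (dlsubmx sigma) *m ulsubmx sigma) i i)
    & forall i, Lam ((conj_mx (drsubmx sigma) *m ursubmx sigma) i i)].

Local Notation "a '*e_(' i , j )" := (a *: delta_mx i j)
  (at level 40, i at level 99, j at level 99).

Local Notation io := (lshift _).
Local Notation rho := (rshift _).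

Inductive EQ_gen n : 'M[P]_(n + n) -> Prop :=
| q_eps (i j : 'I_n) a : i != j ->
    EQ_gen (1%:M + a *e_(io i, io j) - bar a *e_(rho j, rho i))
| q_r (i j : 'I_n) a : i != j ->
    EQ_gen (1%:M + a *e_(io i, rho j) - (lam * bar a) *e_(io j, rho i))
| q_r_diag (i : 'I_n) a : Lam a ->
    EQ_gen (1%:M + a *e_(io i, rho i))
| q_l (i j : 'I_n) a : i != j ->
    EQ_gen (1%:M + a *e_(rho i, io j) - (bar lam * bar a) *e_(rho j, io i))
| q_l_diag (i : 'I_n) a : Lam (bar a) ->
    EQ_gen (1%:M + a *e_(rho i, io i)).

Definition EQ n : 'M[P]_(n + n) -> Prop := subgroup_gen (@EQ_gen n).

(* In the Hermitian case n > r is written n = r + m with m > 0, so that the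
   indices i > r are the rshift r i with i : 'I_m. Neither GH nor EH involves
   Lam: the elementary generators range over Lam_max. *)
Section Hermitian.

Variables (r m : nat) (a_ : 'rV[P]_r).
Local Notation A1 := (diag_mx a_).
Local Notation n := (r + m)%N.
Local Notation up := (rshift r).

Definition psi_h : 'M[P]_(n + n) :=
  block_mx (block_mx A1 0 0 0) lam%:M 1%:M 0.

Definition GH (sigma : 'M[P]_(n + n)) : Prop :=
  is_GL sigma /\ conj_mx sigma *m psi_h *m sigma = psi_h.

(* zeta_f is a choice of half of the Hermitian value of zeta; the vectors zeta
   that have one are those of the set C. *)
Definition half_value (zeta : 'cV[P]_r) (zeta_f : P) : Prop :=
  zeta_f + lam * bar zeta_f =
    \sum_(i < r) bar (zeta i 0) * a_ 0 i * zeta i 0.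

Definition at_col (zeta : 'cV[P]_r) (i : 'I_m) : 'M[P]_(r, m) :=
  zeta *m delta_mx 0 i.

Definition hm_mx (i : 'I_m) (zeta : 'cV[P]_r) (zeta_f : P) : 'M[P]_(n + n) :=
  let alpha12 := at_col zeta i in
  let gamma22 := bar zeta_f *e_(i, i) in
  block_mx (block_mx 1%:M alpha12 0 1%:M)
           0
           (block_mx 0 (- (conj_mx A1 *m alpha12)) 0 gamma22)
           (block_mx 1%:M 0 (- conj_mx alpha12) 1%:M).

Definition hr_mx (i : 'I_m) (zeta : 'cV[P]_r) (zeta_f : P) : 'M[P]_(n + n) :=
  let beta12 := at_col zeta i in
  let beta22 := (lam * bar zeta_f) *e_(i, i) in
  block_mx 1%:M
           (block_mx 0 beta12 (- (lam *: conj_mx beta12)) beta22)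
           0
           (block_mx 1%:M (- (conj_mx A1 *m beta12)) 0 1%:M).

Inductive EH_gen : 'M[P]_(n + n) -> Prop :=
| h_eps (i : 'I_m) (j : 'I_n) a : up i != j ->
    EH_gen (1%:M + a *e_(io (up i), io j) - bar a *e_(rho j, rho (up i)))
| h_r (i j : 'I_m) a : i != j ->
    EH_gen (1%:M + a *e_(io (up i), rho (up j))
                 - (lam * bar a) *e_(io (up j), rho (up i)))
| h_r_diag (i : 'I_m) a : Lam_max D a ->
    EH_gen (1%:M + a *e_(io (up i), rho (up i)))
| h_l (i j : 'I_n) a : i != j ->
    EH_gen (1%:M + a *e_(rho i, io j) - (bar lam * bar a) *e_(rho j, io i))
| h_l_diag (i : 'I_n) a : Lam_max D (bar a) ->
    EH_gen (1%:M + a *e_(rho i, io i))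
| h_m (i : 'I_m) zeta zeta_f : half_value zeta zeta_f ->
    EH_gen (hm_mx i zeta zeta_f)
| h_rv (i : 'I_m) zeta zeta_f : half_value zeta zeta_f ->
    EH_gen (hr_mx i zeta zeta_f).

Definition EH : 'M[P]_(n + n) -> Prop := subgroup_gen EH_gen.

End Hermitian.

End Groups.

(* Main.v *)
(* In terms of the basis e_i, f_i, the elementary generators are
   Eichler-Siegel-Dickson transvections tau v w c, and an isometry g satisfies
   g (tau v w c) g^-1 = tau (g v) (g w) c. Let C be the localization of
   B = R[X][T] at S = k \ m and, for t in S, let E_t be the group generated by
   the generators over C with arguments in t B (in t^2 Lambda for the long
   ones). If n >= 3, conjugation by a fixed elementary matrix g over C is
   continuous: for each t there is u with g E_u g^-1 <= E_t. Indeed, either the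
   transvection g (tau v w c) g^-1 splits into generators, or tau v w c is a
   commutator through a third hyperbolic plane, which g fixes, and the two
   factors split after conjugation. Since alpha_m(X) is a product of
   generators, it follows that alpha_m(X + s^2 T) alpha_m(X)^-1 lies in E_1 for
   some s in S; this lifts to B after a substitution T := v T killing the
   S-torsion. So the elements s of k for which alpha(X + s T) alpha(X)^-1 is
   elementary over R[X][T], which form an ideal, lie in no maximal ideal;
   s = 1 is one of them, and X := 0 gives the theorem.

   In the Hermitian case a_i = c_i + lambda bar(c_i), and the change of basis
   e_i := e_i - f_i bar(c_i) turns the Hermitian form into the hyperbolic one
   and EH into EQ for the largest form parameter. Over R[X] the latter is the
   set of all polynomials with coefficients in Lambda_max, which may differ from
   Lambda_max[X], so the quadratic argument is carried out for a form parameter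
   on R[X] subject only to what it uses. *)

(* The squares have one origin: a form parameter is closed under c |-> bar x c x but is not an
   ideal, so an element s of k is only known to act on it through s^2. Hence the arguments of long
   generators are taken in t^2 Lambda, their denominators are squares, and X is translated by s^2 T,
   so that a long argument grows by s^2 times a long argument. On a parameter of R[X] this asks for
   three things: stability under substitutions, a Taylor formula with increment s^2 T, and square
   denominators over R_m. For a generated parameter they hold because the elements with the property
   in question make up a form parameter containing the generators. On R[X][T] no parameter is
   prescribed, and the one chosen makes substitution and specialization automatic. The map from B to
   C need not be injective, and T := v T kills torsion only in polynomials without constant term.
   The lifted word is therefore first corrected to be 1 at T = 0. *)
Require Import Defs.
From HB Require Import structures.
From mathcomp Require Import all_boot all_order all_algebra.
From mathcomp Require Import generic_quotient boolp classical_sets ring.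

Set Implicit Arguments.
Unset Strict Implicit.
Unset Printing Implicit Defensive.

Import GRing.Theory.

Local Open Scope ring_scope.

(* Reflection of equations in additive groups: [ring] does not apply to sums of
   noncommutative words. *)
Inductive zexp := ZVar of nat | ZZero | ZAdd of zexp & zexp | ZOpp of zexp.

Fixpoint zeval (V : zmodType) (env : seq V) (e : zexp) : V :=
  match e with
  | ZVar i => env`_i
  | ZZero => 0
  | ZAdd e1 e2 => zeval env e1 + zeval env e2
  | ZOpp e1 => - zeval env e1
  end.

Fixpoint zcoef (e : zexp) (i : nat) : int :=
  match e with
  | ZVar j => (i == j)%:Z
  | ZZero => 0
  | ZAdd e1 e2 => zcoef e1 i + zcoef e2 i
  | ZOpp e1 => - zcoef e1 i
  end.

Lemma zevalE (V : zmodType) (env : seq V) e :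
  zeval env e = \sum_(i < size env) env`_i *~ zcoef e i.
Proof.
elim: e => [j||e1 IH1 e2 IH2|e1 IH1] /=.
- have [lt_j|le_j] := ltnP j (size env).
    rewrite (bigD1 (Ordinal lt_j)) //= eqxx big1 ?addr0 ?mulr1z // => i.
    by rewrite -val_eqE /= => /negPf->; rewrite mulr0z.
  rewrite nth_default // big1 // => i _.
  by rewrite (ltn_eqF (leq_trans (ltn_ord i) le_j)) mulr0z.
- by rewrite big1 // => i _; rewrite mulr0z.
- by rewrite IH1 IH2 -big_split /=; apply: eq_bigr => i _; rewrite mulrzDr.
- by rewrite IH1 -sumrN; apply: eq_bigr => i _; rewrite mulrNz.
Qed.

Lemma zeval_eq (V : zmodType) (env : seq V) e1 e2 :
  all (fun i => zcoef e1 i == zcoef e2 i) (iota 0 (size env)) ->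
  zeval env e1 = zeval env e2.
Proof.
move=> /allP e12; rewrite !zevalE; apply: eq_bigr => i _.
by rewrite (eqP (e12 i _)) // mem_iota /= ltn_ord.
Qed.

(* Atoms are compared up to conversion, since the same operation may occur with
   several inference paths of its canonical structure. *)
Ltac zlookup x env :=
  lazymatch env with
  | ?y :: ?r =>
    match constr:(tt) with
    | _ => let _ := constr:(@erefl _ x : x = y) in constr:(Some 0%N)
    | _ => lazymatch zlookup x r with
           | Some ?i => constr:(Some i.+1) | None => constr:(@None nat) end
    end
  | _ => constr:(@None nat)
  end.
Ltac zatoms t env :=
  lazymatch t with
  | (?a + ?b)%R => let env1 := zatoms a env in zatoms b env1
  | (- ?a)%R => zatoms a env
  | 0%R => env
  | _ => lazymatch zlookup t env with
         | Some _ => env | None => constr:(t :: env) end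
  end.
Ltac zreify t env :=
  lazymatch t with
  | (?a + ?b)%R =>
      let x := zreify a env in let y := zreify b env in constr:(ZAdd x y)
  | (- ?a)%R => let x := zreify a env in constr:(ZOpp x)
  | 0%R => constr:(ZZero)
  | _ => lazymatch zlookup t env with Some ?i => constr:(ZVar i) end
  end.
Ltac zmod :=
  lazymatch goal with
  | |- @eq ?V ?l ?r =>
      let env1 := zatoms l (@nil V) in
      let env := zatoms r env1 in
      let x := zreify l env in let y := zreify r env in
      apply: (@zeval_eq _ env x y); vm_compute; reflexivity
  end.

(** * Transvections *)

Definition central (P : pzRingType) (z : P) := forall x, z * x = x * z.

(** The part of [form_ring] that does not involve [Lam]. It passes to polynomial rings and
    localizations whatever form parameter is put on them. *)
Record invol_form (P : pzRingType) (D : formData P) : Prop := InvolForm {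
  ifD : {morph bar D : a b / a + b};
  ifM : forall a b, bar D (a * b) = bar D b * bar D a;
  ifK : involutive (bar D);
  ifC : central (lam D);
  ifL : lam D * bar D (lam D) = 1 }.

Section Transvections.

Variables (P : pzRingType) (D : formData P).
Hypothesis HD : invol_form D.

Local Notation bar := (bar D).
Local Notation cj := (conj_mx D).
Local Notation l := (lam D).
Local Notation lb := (bar (lam D)).

Lemma bar0 : bar 0 = 0.
Proof. by apply: (addrI (bar 0)); rewrite -(ifD HD) !addr0. Qed.

Lemma barN x : bar (- x) = - bar x.
Proof. by apply/eqP; rewrite -addr_eq0 -(ifD HD) addNr bar0. Qed.

Lemma bar1 : bar 1 = 1.
Proof. by rewrite -{2}(ifK HD 1) -[in RHS](mulr1 (bar 1)) (ifM HD) (ifK HD) mulr1. Qed.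

Lemma central_lb : central lb.
Proof.
by move=> x; rewrite -[x](ifK HD) -!(ifM HD) (ifC HD).
Qed.

Lemma lb_l : lb * l = 1.
Proof. by rewrite -(ifC HD) (ifL HD). Qed.

Lemma conj_mxD p q (A B : 'M[P]_(p, q)) : cj (A + B) = cj A + cj B.
Proof. by apply/matrixP => i j; rewrite !mxE (ifD HD). Qed.

Lemma conj_mx0 p q : cj (0 : 'M[P]_(p, q)) = 0.
Proof. by apply/matrixP => i j; rewrite !mxE bar0. Qed.

Lemma conj_mxN p q (A : 'M[P]_(p, q)) : cj (- A) = - cj A.
Proof. by apply/matrixP => i j; rewrite !mxE barN. Qed.

Lemma bar_sum (I : Type) (s : seq I) (Q : pred I) (F : I -> P) :
  bar (\sum_(i <- s | Q i) F i) = \sum_(i <- s | Q i) bar (F i).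
Proof. exact: (big_morph _ (ifD HD) bar0). Qed.

Lemma conj_mxM p q r (A : 'M[P]_(p, q)) (B : 'M[P]_(q, r)) :
  cj (A *m B) = cj B *m cj A.
Proof.
apply/matrixP => i j; rewrite !mxE bar_sum; apply: eq_bigr => k _.
by rewrite !mxE (ifM HD).
Qed.

Lemma conj_mxK p q (A : 'M[P]_(p, q)) : cj (cj A) = A.
Proof. by apply/matrixP => i j; rewrite !mxE (ifK HD). Qed.

Lemma conj_scalar_mx p a : cj (a%:M : 'M[P]_p) = (bar a)%:M.
Proof.
apply/matrixP => i j; rewrite !mxE eq_sym.
by case: (i == j); rewrite ?mulr1n ?mulr0n ?bar0.
Qed.

Lemma conj_mx1 p : cj (1%:M : 'M[P]_p) = 1%:M.
Proof. by rewrite conj_scalar_mx bar1. Qed.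

Lemma conj_mxZ p q z (A : 'M[P]_(p, q)) : central z -> cj (z *: A) = bar z *: cj A.
Proof.
by move=> z_c; apply/matrixP => i j; rewrite !mxE z_c (ifM HD).
Qed.

Lemma scalemx_center p q r z (A : 'M[P]_(p, q)) (B : 'M[P]_(q, r)) :
  central z -> A *m (z *: B) = z *: (A *m B).
Proof.
move=> z_c; apply/matrixP => i j; rewrite !mxE mulr_sumr; apply: eq_bigr => k _.
by rewrite !mxE !mulrA z_c.
Qed.

Lemma scale_lb_l p q (A : 'M[P]_(p, q)) : lb *: (l *: A) = A.
Proof. by rewrite scalerA lb_l scale1r. Qed.

Lemma scale_l_lb p q (A : 'M[P]_(p, q)) : l *: (lb *: A) = A.
Proof. by rewrite scalerA (ifL HD) scale1r. Qed.

Lemma mulmx_lb p q r (A : 'M[P]_(p, q)) (B : 'M[P]_(q, r)) :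
  A *m (lb *: B) = lb *: (A *m B).
Proof. exact/scalemx_center/central_lb. Qed.

Lemma mulmx_l p q r (A : 'M[P]_(p, q)) (B : 'M[P]_(q, r)) :
  A *m (l *: B) = l *: (A *m B).
Proof. exact/scalemx_center/(ifC HD). Qed.

Lemma conj_mx_l p q (A : 'M[P]_(p, q)) : cj (l *: A) = lb *: cj A.
Proof. exact/conj_mxZ/(ifC HD). Qed.

Lemma conj_mx_lb p q (A : 'M[P]_(p, q)) : cj (lb *: A) = l *: cj A.
Proof. by rewrite conj_mxZ ?(ifK HD) //; exact: central_lb. Qed.

Variables (N : nat) (psi : 'M[P]_N).
Hypothesis psi_herm : cj psi = lb *: psi.

(* Locked, so that rewriting with [mulmxA] does not unfold it. *)
Fact sharp_key : unit. Proof. exact: tt. Qed.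
Definition sharp (v : 'cV[P]_N) : 'rV[P]_N := locked_with sharp_key (cj v *m psi).

Lemma sharpE v : sharp v = cj v *m psi.
Proof. by rewrite /sharp unlock. Qed.

(* The Eichler-Siegel-Dickson transvection of the lambda-Hermitian form psi. *)
Definition tau (v w : 'cV[P]_N) (c : 'M[P]_1) : 'M[P]_N :=
  locked_with sharp_key
    (1%:M + v *m sharp w - lb *: (w *m sharp v) + v *m c *m sharp v).

Lemma tauE v w c :
  tau v w c = 1%:M + v *m sharp w - lb *: (w *m sharp v) + v *m c *m sharp v.
Proof. by rewrite /tau unlock. Qed.

Definition isometry (g : 'M[P]_N) := cj g *m psi *m g = psi.

Lemma sharpD v w : sharp (v + w) = sharp v + sharp w.
Proof. by rewrite !sharpE conj_mxD mulmxDl. Qed.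

Lemma sharpN v : sharp (- v) = - sharp v.
Proof. by rewrite !sharpE conj_mxN mulNmx. Qed.

Lemma sharp0 : sharp 0 = 0.
Proof. by rewrite !sharpE conj_mx0 mul0mx. Qed.

Lemma sharpM v a : sharp (v *m a) = cj a *m sharp v.
Proof. by rewrite !sharpE conj_mxM mulmxA. Qed.

Lemma orth_mull (v w : 'cV[P]_N) (a : 'M[P]_1) : sharp v *m w = 0 -> sharp (v *m a) *m w = 0.
Proof. by move=> vw; rewrite sharpM -mulmxA vw mulmx0. Qed.

Lemma orth_mulr (v w : 'cV[P]_N) (a : 'M[P]_1) : sharp v *m w = 0 -> sharp v *m (w *m a) = 0.
Proof. by move=> vw; rewrite mulmxA vw mul0mx. Qed.

Lemma sharp_l v : sharp (l *: v) = lb *: sharp v.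
Proof. by rewrite !sharpE conj_mx_l scalemxAl. Qed.

Lemma sharp_herm v w : sharp w *m v = l *: cj (sharp v *m w).
Proof.
rewrite !sharpE !conj_mxM conj_mxK psi_herm -scalemxAl mulmx_lb scale_l_lb.
by rewrite mulmxA.
Qed.

Lemma sharp_orth v w : sharp v *m w = 0 -> sharp w *m v = 0.
Proof. by move=> vw; rewrite sharp_herm vw conj_mx0 scaler0. Qed.

Lemma conj_sharp v : cj (sharp v) = lb *: (psi *m v).
Proof. by rewrite !sharpE conj_mxM psi_herm -scalemxAl conj_mxK. Qed.

Lemma tau_vec q v w c (x : 'M[P]_(N, q)) : tau v w c *m x =
  x + v *m (sharp w *m x) - lb *: (w *m (sharp v *m x)) + v *m c *m (sharp v *m x).
Proof. by rewrite !tauE !(mulmxDl, mulNmx) mul1mx -scalemxAl !mulmxA. Qed.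

(** A Heisenberg group law along the isotropic [v]: the middle terms add up, and the last terms add
    up to a cocycle given by the form. *)
Lemma tauM v w1 w2 c1 c2 :
  sharp v *m v = 0 -> sharp v *m w1 = 0 -> sharp v *m w2 = 0 ->
  tau v w1 c1 *m tau v w2 c2 =
    tau v (w1 + w2) (c1 + c2 - lb *: (sharp w1 *m w2)).
Proof.
move=> vv vw1 vw2; have w1v := sharp_orth vw1.
rewrite [X in _ *m X]tauE !(mulmxDr, mulmxN) mulmx1 mulmx_lb !mulmxA.
rewrite !tau_vec vv vw2 w1v ?(mulmx0, scaler0, subr0, addr0).
rewrite !tauE sharpD !(mulmxDr, mulmxDl, mulNmx, mulmxN, scalerDr, scalerN).
rewrite !mulmx_lb -!scalemxAl !mulmxA.
zmod.
Qed.

Lemma tau1 v : tau v 0 0 = 1%:M.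
Proof. by rewrite !tauE sharp0 !(mulmx0, mul0mx) scaler0 subr0 !addr0. Qed.

(** Lets a short generator be read along either of its two vectors. *)
Lemma tau_skew v w : tau v w 0 = tau w (- (l *: v)) 0.
Proof.
rewrite !tauE sharpN sharp_l !(mulmxN, mulNmx, scalerN) -scalemxAl scale_lb_l.
by rewrite mulmx_lb !mulmx0 !mul0mx; zmod.
Qed.

(** Moves a coefficient off the first vector, which can then be taken in the basis. *)
Lemma tau_mulr v a w c :
  tau (v *m a) w c = tau v (w *m cj a) (a *m c *m cj a).
Proof. by rewrite !tauE !sharpM conj_mxK !mulmxA. Qed.

(** A long transvection is quadratic in its vector; the third factor, which is short, is the polar
    term. *)
Lemma tau_long_add v1 v2 c : sharp v1 *m v2 = 0 -> cj c = - (l *: c) ->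
  sharp v1 *m v1 = 0 -> sharp v2 *m v2 = 0 ->
  tau (v1 + v2) 0 c = tau v1 0 c *m tau v2 0 c *m tau v1 (v2 *m cj c) 0.
Proof.
move=> v12 polyCC v11 v22; have v21 := sharp_orth v12.
have E v (u : 'M_N) : tau v 0 c *m u = u + v *m (c *m (sharp v *m u)).
  by rewrite tau_vec sharp0 mul0mx mulmx0 mul0mx scaler0 subr0 addr0 -!mulmxA.
have X3 : tau v1 (v2 *m cj c) 0 =
    1%:M + v1 *m (c *m sharp v2) + v2 *m (c *m sharp v1).
  rewrite !tauE mulmx0 mul0mx addr0 sharpM conj_mxK polyCC mulmxN mulmx_l mulNmx.
  by rewrite -scalemxAl scalerN scale_lb_l opprK -!mulmxA.
have X2 : tau v2 0 c *m tau v1 (v2 *m cj c) 0 =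
    1%:M + v1 *m (c *m sharp v2) + v2 *m (c *m sharp v1) + v2 *m (c *m sharp v2).
  rewrite E X3 !mulmxDr mulmx1 !(mulmxA (sharp v2)) v21 v22 !mul0mx.
  by rewrite !mulmx0 !addr0.
rewrite -mulmxA X2 E !mulmxDr mulmx1 !(mulmxA (sharp v1)) v11 v12 !mul0mx.
rewrite !mulmx0 !addr0 !tauE sharp0 sharpD !(mulmx0, mulmxDl, mulmxDr, mul0mx).
by rewrite !addr0 scaler0 !subr0 -!mulmxA; zmod.
Qed.

(** After [tau_skew] this is the Heisenberg law along [w]; the long factor along [w] compensates the
    cocycle. *)
Lemma tau_split v1 v2 w :
  sharp w *m w = 0 -> sharp w *m v1 = 0 -> sharp w *m v2 = 0 ->
  tau (v1 + v2) w 0 =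
    tau v1 w 0 *m tau v2 w 0 *m tau w 0 (lb *: (sharp v1 *m v2)).
Proof.
move=> ww wv1 wv2; rewrite (tau_skew (v1 + v2)) (tau_skew v1 w) (tau_skew v2 w).
rewrite !tauM ?mulmxN ?mulmxDr ?mulmx_l ?wv1 ?wv2;
  rewrite ?(addr0, scaler0, oppr0, mulmx0, subr0, add0r) //.
- rewrite sharpN sharp_l mulNmx -scalemxAl !scalerN opprK scale_l_lb.
  by rewrite addNr scalerDr opprD.
- by rewrite !mulmxN !mulmx_l wv1 wv2 scaler0 oppr0 addr0.
Qed.

(** What makes [tau v w c] an isometry when [v] is isotropic and orthogonal to [w]: [c] is, in the
    Hermitian sense, minus one half of the value of the form at [w]. *)
Definition tau_cond (w : 'cV[P]_N) (c : 'M[P]_1) :=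
  cj c + l *: c + sharp w *m w = 0.

Lemma tauV v w c :
  sharp v *m v = 0 -> sharp v *m w = 0 -> tau_cond w c ->
  tau v w c *m tau v (- w) (lb *: cj c) = 1%:M /\
  tau v (- w) (lb *: cj c) *m tau v w c = 1%:M.
Proof.
move=> vv vw wc; have E : lb *: cj c + c + lb *: (sharp w *m w) = 0.
  by move/(congr1 ( *:%R lb)): wc; rewrite !scalerDr scale_lb_l scaler0.
have vw' : sharp v *m - w = 0 by rewrite mulmxN vw oppr0.
by split; rewrite tauM // ?subrr ?addNr ?sharpN ?mulNmx ?mulmxN scalerN opprK
  ?[c + _]addrC E tau1.
Qed.

Lemma tau_cond_isotropic w : sharp w *m w = 0 -> tau_cond w 0.
Proof. by rewrite /tau_cond conj_mx0 scaler0 !add0r. Qed.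

Lemma tau_cond_long c : cj c = - (l *: c) -> tau_cond 0 c.
Proof. by rewrite /tau_cond mulmx0 addr0 => ->; rewrite addNr. Qed.

Lemma tau_cond_add v w c d : tau_cond v c -> tau_cond w d ->
  tau_cond (v + w) (c + d - lb *: (sharp v *m w)).
Proof.
rewrite /tau_cond => vc wd.
rewrite !(conj_mxD, conj_mxN) conj_mx_lb -(sharp_herm v w) sharpD mulmxDl !mulmxDr.
rewrite !scalerDr scalerN scale_l_lb -[RHS](addr0 0) -{1}vc -wd.
by zmod.
Qed.

(** The adjoint of the transvection for the form is the inverse found in [tauV]. *)
Lemma tau_isometry v w c :
  sharp v *m v = 0 -> sharp v *m w = 0 -> tau_cond w c -> isometry (tau v w c).
Proof.
move=> vv vw wc; rewrite /isometry.
have -> : cj (tau v w c) *m psi = psi *m tau v (- w) (lb *: cj c).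
  rewrite tauE !(conj_mxD, conj_mxN, conj_mx_lb, conj_mxM) conj_mx1.
  rewrite !conj_sharp !(mulmxDl, mulNmx) mul1mx -!scalemxAl scale_l_lb.
  rewrite -!mulmxA -!sharpE tauE sharpN !(mulmxDr, mulNmx, mulmxN) mulmx1.
  rewrite !mulmx_lb -!scalemxAl !mulmx_lb mulmxN scalerN opprK !mulmxA.
  by zmod.
by rewrite -mulmxA (proj2 (tauV vv vw wc)) mulmx1.
Qed.

End Transvections.

Section Transport.

Variables (P : pzRingType) (D : formData P).
Hypothesis HD : invol_form D.
Variables (N : nat) (psi psi' g : 'M[P]_N).

Lemma sharp_transport v : conj_mx D g *m psi' *m g = psi ->
  sharp D psi' (g *m v) *m g = sharp D psi v.
Proof. by move=> gE; rewrite !sharpE conj_mxM // -gE !mulmxA. Qed.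

(** Two forms are allowed because the same identity serves conjugation by an isometry and the change
    of basis from the hyperbolic to the Hermitian form. *)
Lemma tau_transport v w c : conj_mx D g *m psi' *m g = psi ->
  g *m tau D psi v w c = tau D psi' (g *m v) (g *m w) c *m g.
Proof.
move=> gE; rewrite !tauE !(mulmxDr, mulmxDl, mulmxN, mulNmx) mulmx1 mul1mx.
by rewrite mulmx_lb // -scalemxAl -!mulmxA !(sharp_transport _ gE) !mulmxA.
Qed.

End Transport.

Lemma tau_conj (P : pzRingType) (D : formData P) (HD : invol_form D) N
    (psi g : 'M[P]_N) v w c : isometry D psi g ->
  g *m tau D psi v w c = tau D psi (g *m v) (g *m w) c *m g.
Proof. exact: tau_transport. Qed.

(** * Groups of matrices *)

Record mx_group (P : pzRingType) N (G : 'M[P]_N -> Prop) : Prop := MxGroup {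
  mxg1 : G 1%:M;
  mxgM : forall A B, G A -> G B -> G (A *m B);
  mxgV : forall A B, G A -> A *m B = 1%:M -> B *m A = 1%:M -> G B }.

Lemma sgen_group (P : pzRingType) N (B : 'M[P]_N -> Prop) :
  mx_group (subgroup_gen B).
Proof. by split; [exact: sg_one|exact: sg_mul|exact: sg_inv]. Qed.

Lemma sgen_sub (P : pzRingType) N (B G : 'M[P]_N -> Prop) :
  mx_group G -> (forall M, B M -> G M) -> forall M, subgroup_gen B M -> G M.
Proof.
move=> [G1 GM GV] BG M; elim=> {M} [M /BG||M M' _ GMx _ GM'|M M' _ GMx] //.
- exact: GM.
- exact: GV.
Qed.

Lemma is_GL1 (P : pzRingType) N : is_GL (1%:M : 'M[P]_N).
Proof. by exists 1%:M; rewrite mulmx1. Qed.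

Lemma is_GL_group (P : pzRingType) N : mx_group (@is_GL P N).
Proof.
split=> [|A B [A' [AA' A'A]] [B' [BB' B'B]]|A B _ AB BA]; first exact: is_GL1.
- exists (B' *m A'); split; first by rewrite mulmxA -(mulmxA A) BB' mulmx1.
  by rewrite mulmxA -(mulmxA B') A'A mulmx1.
- by exists A.
Qed.

Lemma mx_inv_uniq (P : pzRingType) N (A B B' : 'M[P]_N) :
  B *m A = 1%:M -> A *m B' = 1%:M -> B = B'.
Proof. by move=> BA AB'; rewrite -[B]mulmx1 -AB' mulmxA BA mul1mx. Qed.

(** The hypothesis says that [t] is the commutator x^-1 y x y^-1. *)
Lemma mxg_commutator (P : pzRingType) N (G : 'M[P]_N -> Prop) x y t :
  mx_group G -> is_GL x -> is_GL y -> G x -> G y -> y *m x = x *m t *m y -> G t.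
Proof.
move=> [G1 GM GV] [x' [xx' x'x]] [y' [yy' y'y]] Gx Gy yx.
have -> : t = x' *m (y *m x) *m y'.
  by rewrite yx !mulmxA x'x mul1mx -mulmxA yy' mulmx1.
by apply: (GM _ _ _ (GV _ _ Gy yy' y'y)); apply/(GM _ _ (GV _ _ Gx xx' x'x))/GM.
Qed.

(* The matrices whose conjugate by [g] lies in [G], stated without inverses. *)
Definition conj_in (P : pzRingType) N (g : 'M[P]_N) (G : 'M[P]_N -> Prop) M :=
  exists2 M', G M' & g *m M = M' *m g.

(** Only elements of [G] are inverted, never [g]. *)
Lemma conj_in_group (P : pzRingType) N (g : 'M[P]_N) (G : 'M[P]_N -> Prop) :
  mx_group G -> (forall M, G M -> is_GL M) -> mx_group (conj_in g G).
Proof.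
move=> [G1 GM GV] GL; split=> [|A B [A' GA' gA] [B' GB' gB]|A B [A' GA' gA] AB BA].
- by exists 1%:M; rewrite ?mulmx1 ?mul1mx.
- by exists (A' *m B'); [exact: GM|rewrite mulmxA gA -!mulmxA gB].
- have [A1 [AA1 A1A]] := GL _ GA'; exists A1; first exact: GV GA' AA1 A1A.
  rewrite -[g in RHS]mulmx1 -AB !mulmxA -(mulmxA A1) gA.
  by rewrite !mulmxA A1A mul1mx.
Qed.

(** * Hyperbolic basis and elementary generators *)

Section Frame.

Variables (P : pzRingType) (D : formData P) (n : nat).
Hypothesis HD : invol_form D.

Local Notation bar := (bar D).
Local Notation cj := (conj_mx D).
Local Notation l := (lam D).
Local Notation lb := (bar (lam D)).
Local Notation psi := (psi_q D n).
Local Notation sh := (sharp D psi).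
Local Notation tauq := (tau D psi).

(* The plane [i] is spanned by e_i = [bv i false] and f_i = [bv i true]. *)
Definition ix (i : 'I_n) (b : bool) : 'I_(n + n) :=
  if b then rshift n i else lshift n i.
Definition bv (i : 'I_n) (b : bool) : 'cV[P]_(n + n) := delta_mx (ix i b) 0.
(** The value of the form on the hyperbolic pair [bv i b], [bv i (~~ b)]. *)
Definition eps (b : bool) : P := if b then 1 else l.

Lemma conj_delta p q (i : 'I_p) (j : 'I_q) : cj (delta_mx i j) = delta_mx j i.
Proof.
apply/matrixP => x y; rewrite !mxE andbC.
by case: (_ && _); rewrite ?(bar1 HD) ?(bar0 HD).
Qed.

Lemma psi_q_herm : cj psi = lb *: psi.
Proof.
rewrite /psi_q /conj_mx map_block_mx tr_block_mx scale_block_mx.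
rewrite -!/(conj_mx D _) !(conj_mx0 HD) (conj_mx1 HD) (conj_scalar_mx HD).
by rewrite !scaler0 !scale_scalar_mx (lb_l HD) mulr1.
Qed.

Lemma sharp_bv i b : sh (bv i b) = eps b *: (bv i (~~ b))^T.
Proof.
rewrite sharpE conj_delta -rowE /psi_q /bv /eps trmx_delta.
apply/rowP => j; rewrite -(splitK j); case: (split j) => k; case: b => /=.
- rewrite [LHS]mxE block_mxEdl !mxE eq_lshift mul1r eq_sym.
  by rewrite andTb.
- by rewrite [LHS]mxE block_mxEul !mxE eq_lrshift mulr0.
- by rewrite [LHS]mxE block_mxEdr !mxE eq_rlshift mulr0.
- rewrite [LHS]mxE block_mxEur !mxE eq_rshift andTb.
  by rewrite eq_sym mulr_natr.
Qed.

Lemma sharp_bvE i b j b' : sh (bv i b) *m bv j b' =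
  if (i == j) && (b' == ~~ b) then (eps b)%:M else 0.
Proof.
rewrite sharp_bv -scalemxAl /bv trmx_delta mul_delta_mx_cond.
have -> : (ix i (~~ b) == ix j b') = (i == j) && (b' == ~~ b).
  by rewrite /ix; case: b b' => [] [] /=;
    rewrite ?(eq_lshift, eq_rshift, eq_lrshift, eq_rlshift) ?(andbT, andbF).
case: (_ && _); last by rewrite scaler0.
by apply/matrixP => x y; rewrite !mxE !ord1 mulr1.
Qed.

Lemma sharp_bv_ne i b j b' : i != j -> sh (bv i b) *m bv j b' = 0.
Proof. by move=> ij; rewrite sharp_bvE (negPf ij). Qed.

Lemma sharp_bv_iso i b : sh (bv i b) *m bv i b = 0.
Proof. by rewrite sharp_bvE; case: b; rewrite andbF. Qed.

Lemma bv_basis (v : 'cV[P]_(n + n)) :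
  v = \sum_i (bv i false *m (v (lshift n i) 0)%:M + bv i true *m (v (rshift n i) 0)%:M).
Proof.
have E i a b j : (bv i false *m a%:M + bv i true *m b%:M) j 0 =
    (j == lshift n i)%:R * a + (j == rshift n i)%:R * b.
  by rewrite mxE; congr (_ + _); rewrite mxE big_ord1 !mxE !eqxx andbT mulr1n.
apply/colP => j; rewrite summxE -(splitK j); case: (split j) => k /=.
  rewrite (bigD1 k) //= big1 ?E => [|i ik]; rewrite ?E eq_lshift eq_lrshift mul0r.
    by rewrite eqxx mul1r !addr0.
  by rewrite eq_sym (negPf ik) mul0r addr0.
rewrite (bigD1 k) //= big1 ?E => [|i ik]; rewrite ?E eq_rshift eq_rlshift mul0r.
  by rewrite eqxx mul1r addr0 add0r.
by rewrite eq_sym (negPf ik) mul0r addr0.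
Qed.

Lemma tau_bv_cond p bp q bq a : p != q ->
  [/\ sh (bv p bp) *m bv p bp = 0, sh (bv p bp) *m (bv q bq *m a) = 0
    & tau_cond D psi (bv q bq *m a) 0].
Proof.
move=> pq; split; first exact: sharp_bv_iso.
- exact/orth_mulr/sharp_bv_ne.
- apply/(tau_cond_isotropic HD)/(orth_mull HD)/orth_mulr/sharp_bv_iso.
Qed.

Lemma tau_bv_isometry p bp q bq a : p != q ->
  isometry D psi (tauq (bv p bp) (bv q bq *m a) 0).
Proof. by move=> /(tau_bv_cond bp bq a)[]; apply/tau_isometry/psi_q_herm. Qed.

Lemma tau_bv_GL p bp q bq a : p != q -> is_GL (tauq (bv p bp) (bv q bq *m a) 0).
Proof.
move=> /(tau_bv_cond bp bq a)[pp pq cond].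
by eexists; apply: (tauV HD psi_q_herm pp pq cond).
Qed.

Lemma tau_bv_long_isometry p bp c : cj c = - (l *: c) ->
  isometry D psi (tauq (bv p bp) 0 c).
Proof.
move=> c_long; apply: (tau_isometry HD psi_q_herm); rewrite ?mulmx0 ?sharp_bv_iso //.
exact: tau_cond_long.
Qed.

Lemma tau_bv_long_GL p bp c : cj c = - (l *: c) -> is_GL (tauq (bv p bp) 0 c).
Proof.
move=> c_long; eexists; apply: (tauV HD psi_q_herm); rewrite ?mulmx0 ?sharp_bv_iso //.
exact: tau_cond_long.
Qed.

Section Membership.

Variables (G : 'M[P]_(n + n) -> Prop).
Hypothesis G_grp : mx_group G.

(** The element [y] fixes [bv p bp] and adds [bv q bq *m a2] to [bv r false]. By the Heisenberg law
    along [bv p bp], y x y^-1 is then [x] times the wanted generator, which is a commutator through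
    the plane [r]. *)
Lemma short_mem p bp q bq r (a1 a2 : 'M[P]_1) :
  p != q -> p != r -> q != r ->
  G (tauq (bv p bp) (bv r false *m a1) 0) ->
  G (tauq (bv r true) (bv q bq *m - (l *: a2)) 0) ->
  G (tauq (bv p bp) (bv q bq *m (a2 *m a1)) 0).
Proof.
move=> pq pr qr.
set x := tauq _ _ 0; set y := tauq (bv r true) _ 0 => Gx Gy.
have [G1 GM GV] := G_grp.
have herm := psi_q_herm; have rq : r != q by rewrite eq_sym.
have rp : r != p by rewrite eq_sym.
have y_iso : isometry D psi y by rewrite /y; apply: tau_bv_isometry.
have yp : y *m bv p bp = bv p bp.
  rewrite tau_vec sharpM // -mulmxA !sharp_bv_ne ?(eq_sym q) //.
  by rewrite !mulmx0 scaler0 subr0 !addr0.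
have yr : y *m bv r false = bv r false + bv q bq *m a2.
  rewrite tau_vec sharpM // -mulmxA sharp_bv_ne // sharp_bvE eqxx /=.
  rewrite !(mulmx0, mul0mx) !addr0 mulmx1.
  by rewrite mulmxN mulmx_l // scalerN opprK scale_lb_l.
have yx : y *m x = x *m tauq (bv p bp) (bv q bq *m (a2 *m a1)) 0 *m y.
  have pp := sharp_bv_iso p bp.
  have pr1 : sh (bv p bp) *m (bv r false *m a1) = 0.
    exact/orth_mulr/sharp_bv_ne.
  have pq1 : sh (bv p bp) *m (bv q bq *m (a2 *m a1)) = 0.
    exact/orth_mulr/sharp_bv_ne.
  have rq1 : sh (bv r false *m a1) *m (bv q bq *m (a2 *m a1)) = 0.
    exact/(orth_mull HD)/orth_mulr/sharp_bv_ne.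
  rewrite {1}/x (tau_conj HD _ _ _ y_iso) yp mulmxA yr mulmxDl /x (tauM HD) //.
  by rewrite rq1 scaler0 subr0 addr0 -mulmxA.
by apply: (mxg_commutator G_grp _ _ Gx Gy yx); exact: tau_bv_GL.
Qed.

(** The element [g] sends [bv q false] to [bv q false + bv p bp *m s]. Conjugating the long
    generator [x] by it gives the long transvection along this sum, and [tau_long_add] splits off
    [x], the wanted generator and a short one. *)
Lemma long_mem p bp q (s c : 'M[P]_1) : p != q -> cj c = - (l *: c) ->
  G (tauq (bv p bp) (bv q true *m cj s) 0) ->
  G (tauq (bv q false) 0 c) ->
  G (tauq (bv q false) (bv p bp *m (s *m cj c)) 0) ->
  G (tauq (bv p bp) 0 (s *m c *m cj s)).
Proof.
move=> pq c_long; have [G1 GM GV] := G_grp; have qp : q != p by rewrite eq_sym.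
set g := tauq _ _ _; set x := tauq _ _ _; set y := tauq _ _ _ => Gg Gx Gy.
have g_iso : isometry D psi g by rewrite /g; exact: tau_bv_isometry.
have gq : g *m bv q false = bv q false + bv p bp *m s.
  rewrite tau_vec sharpM // -mulmxA conj_mxK // (sharp_bv_ne _ _ pq) sharp_bvE eqxx /=.
  by rewrite !mulmx0 scaler0 subr0 addr0 mulmx1.
have gx : g *m x = x *m (tauq (bv p bp) 0 (s *m c *m cj s) *m y) *m g.
  rewrite {1}/x (tau_conj HD _ _ _ g_iso) gq mulmx0 tau_long_add //.
  - by rewrite (tau_mulr HD psi (bv p bp)) mul0mx -!mulmxA.
  - exact: psi_q_herm.
  - exact/orth_mulr/sharp_bv_ne.
  - exact: sharp_bv_iso.
  - exact/(orth_mull HD)/orth_mulr/sharp_bv_iso.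
have Gzy : G (tauq (bv p bp) 0 (s *m c *m cj s) *m y).
  apply: (mxg_commutator G_grp _ _ Gx Gg gx); first exact: tau_bv_long_GL.
  exact: tau_bv_GL.
have [y' [yy' y'y]] : is_GL y by exact: tau_bv_GL.
by rewrite -[tauq _ _ _]mulmx1 -yy' mulmxA; exact: GM (GV _ _ Gy yy' y'y).
Qed.

End Membership.
End Frame.

(** One type for all the groups in play: with [SA] everything and [SL] the long arguments it
    generates [EQ], with multiples of [t] and of t^2 it generates E_t. The booleans merge the five
    families of [EQ_gen] into two. *)
Inductive tgen (P : pzRingType) (D : formData P) n (SA SL : P -> Prop) :
    'M[P]_(n + n) -> Prop :=
| tg_short (i j : 'I_n) b b' a : i != j -> SA a ->
    tgen D SA SL (tau D (psi_q D n) (bv P i b) (bv P j b' *m a%:M) 0)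
| tg_long (i : 'I_n) b c : SL c ->
    tgen D SA SL (tau D (psi_q D n) (bv P i b) 0 c%:M).

Lemma form_parameterN (P : pzRingType) (D : formData P) (HD : invol_form D) L :
  form_parameter D L -> forall a, L a -> L (- a).
Proof.
move=> [LB Lm _ _] a La; rewrite -[- a]add0r; apply: LB => //; apply: Lm.
by exists 0; rewrite (bar0 HD) mulr0 subr0.
Qed.

Lemma form_parameterD (P : pzRingType) (D : formData P) (HD : invol_form D) L :
  form_parameter D L -> forall a b, L a -> L b -> L (a + b).
Proof.
move=> HL a b La Lb; rewrite -[b]opprK; case: (HL) => LB _ _ _.
exact/LB/(form_parameterN HD HL).
Qed.

Lemma Lam_max_form (P : pzRingType) (D : formData P) :
  invol_form D -> form_parameter D (Lam_max D).
Proof.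
move=> HD; split=> [a b ea eb|_ [c ->]|//|x a ea]; rewrite /Lam_max.
- by rewrite {1}ea {1}eb (ifD HD) (barN HD) mulrDr mulrN opprD.
- rewrite (ifD HD) (barN HD) (ifM HD) (ifK HD) mulrDr mulrN (mulrA _ c) (ifC HD c).
  by rewrite -mulrA (ifL HD) mulr1 opprD opprK addrC.
- rewrite {1}ea !(ifM HD) (ifK HD) !mulrA mulrN mulNr; congr (- _).
  by rewrite mulrA (ifC HD).
Qed.

(** * The elementary quadratic group in terms of transvections *)

Section EQ.

Variables (P : pzRingType) (D : formData P) (n : nat).
Hypothesis HD : invol_form D.
Hypothesis HL : form_parameter D (Lam D).

Local Notation bar := (bar D).
Local Notation cj := (conj_mx D).
Local Notation l := (lam D).
Local Notation lb := (bar (lam D)).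
Local Notation psi := (psi_q D n).
Local Notation sh := (sharp D psi).
Local Notation tauq := (tau D psi).
Local Notation bv := (bv P).
Local Notation eps := (eps D).

Lemma central_eps b : central (eps b).
Proof.
by case: b => /=; [move=> x; rewrite mulr1 mul1r|exact: ifC HD].
Qed.

Lemma bv_outer (i j : 'I_n) b b' x :
  bv i b *m x%:M *m (bv j b')^T = x *: delta_mx (ix i b) (ix j b').
Proof.
apply/matrixP => y z; rewrite !mxE big_ord1 mxE big_ord1 !mxE !eqxx !andbT mulr1n.
by case: (y == _); case: (z == _); rewrite /= ?(mul0r, mulr0, mul1r, mulr1).
Qed.

Lemma tau_short_delta i b j b' a :
  tauq (bv i b) (bv j b' *m a%:M) 0 =
  1%:M + (bar a * eps b') *: delta_mx (ix i b) (ix j (~~ b'))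
       - (lb * a * eps b) *: delta_mx (ix j b') (ix i (~~ b)).
Proof.
rewrite tauE mulmx0 mul0mx addr0 sharpM // (conj_scalar_mx HD) !sharp_bv //.
rewrite !(scalemx_center _ _ (@central_eps _)) mulmxA !bv_outer !scalerA.
by rewrite central_eps -!mulrA central_eps.
Qed.

Lemma tau_long_delta i b c :
  tauq (bv i b) 0 c%:M = 1%:M + (c * eps b) *: delta_mx (ix i b) (ix i (~~ b)).
Proof.
rewrite tauE sharp0 // mulmx0 mul0mx scaler0 subr0 addr0 sharp_bv //.
by rewrite (scalemx_center _ _ (@central_eps _)) bv_outer scalerA central_eps.
Qed.

Lemma lb_mid a : lb * a * l = a.
Proof. by rewrite -mulrA -(ifC HD) mulrA lb_l // mul1r. Qed.

(** The matrix entry of a long transvection is [c * l] along [bv i false] and [c] along [bv i true].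
    Since [bar c = - (l * c)], membership of [l * c] in [Lam] is the right condition in both
    cases. *)
Definition Lam_long c := Lam D (l * c).

Lemma Lam_long_bar c : Lam_long c -> bar c = - (l * c).
Proof.
have [_ _ Lx _] := HL; move=> /Lx; rewrite /Lam_max (ifM HD).
by move=> e; rewrite [in RHS]e opprK (ifC HD) -mulrA (lb_l HD) mulr1.
Qed.

Lemma tau_eps i j a : tauq (bv i false) (bv j true *m (bar a)%:M) 0 =
  1%:M + a *: delta_mx (lshift n i) (lshift n j)
       - bar a *: delta_mx (rshift n j) (rshift n i).
Proof. by rewrite tau_short_delta /= (ifK HD) mulr1 lb_mid. Qed.

Lemma tau_eps_opp i j a : tauq (bv j true) (bv i false *m (- (l * a))%:M) 0 =
  1%:M + a *: delta_mx (lshift n i) (lshift n j)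
       - bar a *: delta_mx (rshift n j) (rshift n i).
Proof.
rewrite tau_short_delta /= mulr1 barN // (ifM HD) mulNr -mulrA (lb_l HD) mulr1.
by rewrite mulrN mulrA (lb_l HD) mul1r !scaleNr opprK addrAC.
Qed.

Lemma tau_r i j a : tauq (bv i false) (bv j false *m (l * bar a)%:M) 0 =
  1%:M + a *: delta_mx (lshift n i) (rshift n j)
       - (l * bar a) *: delta_mx (lshift n j) (rshift n i).
Proof.
rewrite tau_short_delta /= lb_mid; congr (_ + _ *: _ - _).
by rewrite (ifM HD) (ifK HD) -mulrA (lb_l HD) mulr1.
Qed.

Lemma tau_r_diag i a : tauq (bv i false) 0 (lb * a)%:M =
  1%:M + a *: delta_mx (lshift n i) (rshift n i).
Proof. by rewrite tau_long_delta /= lb_mid. Qed.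

Lemma tau_l i j a : tauq (bv i true) (bv j true *m (bar a)%:M) 0 =
  1%:M + a *: delta_mx (rshift n i) (lshift n j)
       - (lb * bar a) *: delta_mx (rshift n j) (lshift n i).
Proof. by rewrite tau_short_delta /= (ifK HD) !mulr1. Qed.

Lemma tau_l_diag i a : tauq (bv i true) 0 a%:M =
  1%:M + a *: delta_mx (rshift n i) (lshift n i).
Proof. by rewrite tau_long_delta /= mulr1. Qed.

Lemma EQ_gen_tgen (M : 'M_(n + n)) : EQ_gen D M -> tgen D (fun=> True) Lam_long M.
Proof.
case=> {M} [i j a ij|i j a ij|i a La|i j a ij|i a La].
- by rewrite -tau_eps; exact: tg_short.
- by rewrite -tau_r; exact: tg_short.
- by rewrite -tau_r_diag; apply: tg_long; rewrite /Lam_long mulrA (ifL HD) mul1r.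
- by rewrite -tau_l; exact: tg_short.
- have [_ _ Lx _] := HL; rewrite -tau_l_diag; apply: tg_long; rewrite /Lam_long.
  have := Lx _ La; rewrite /Lam_max (ifK HD) => e.
  by rewrite -[l * a]opprK -e; exact: (form_parameterN HD HL).
Qed.

Lemma tgen_EQ_gen (M : 'M_(n + n)) : tgen D (fun=> True) Lam_long M -> EQ_gen D M.
Proof.
case=> {M} [i j b b' a ij _|i b c Lc].
  case: b b' => [] [].
  - by rewrite -[a](ifK HD) tau_l; exact: q_l.
  - have -> : a = - (l * - (lb * a)) by rewrite mulrN opprK mulrA (ifL HD) mul1r.
    by rewrite tau_eps_opp; apply: q_eps; rewrite eq_sym.
  - by rewrite -[a](ifK HD) tau_eps; exact: q_eps.
  - have -> : a = l * bar (bar a * l).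
      by rewrite (ifM HD) (ifK HD) mulrA (ifL HD) mul1r.
    by rewrite tau_r; exact: q_r.
case: b; first by rewrite tau_l_diag; apply: q_l_diag; rewrite Lam_long_bar //;
  exact: (form_parameterN HD HL).
have -> : c = lb * (l * c) by rewrite mulrA (lb_l HD) mul1r.
by rewrite tau_r_diag; exact: q_r_diag.
Qed.

Lemma EQ_tgen (M : 'M_(n + n)) : EQ D M <-> subgroup_gen (tgen D (fun=> True) Lam_long) M.
Proof.
split; apply: sgen_sub M; try exact: sgen_group.
- by move=> M /EQ_gen_tgen; exact: sg_in.
- by move=> M /tgen_EQ_gen; exact: sg_in.
Qed.

End EQ.

(** * Continuity of conjugation *)

Section Conjugation.

Variables (B C : pzRingType) (DB : formData B) (DC : formData C).
Variables (phi : {rmorphism B -> C}) (S : B -> Prop) (n : nat).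
Hypotheses (HB : invol_form DB) (HC : invol_form DC).
Hypothesis HL : form_parameter DB (Lam DB).
Hypothesis phi_bar : forall x, phi (bar DB x) = bar DC (phi x).
Hypothesis phi_lam : phi (lam DB) = lam DC.
Hypothesis S_mul : forall s t, S s -> S t -> S (s * t).
Hypothesis S_central : forall s, S s -> central s.
Hypothesis phiS_central : forall s, S s -> central (phi s).
Hypothesis S_real : forall s, S s -> bar DB s = s.
Hypothesis n3 : (2 < n)%N.

Local Notation barB := (bar DB).
Local Notation bar := (bar DC).
Local Notation cj := (conj_mx DC).
Local Notation l := (lam DC).
Local Notation lb := (bar (lam DC)).
Local Notation psi := (psi_q DC n).
Local Notation sh := (sharp DC psi).
Local Notation tauq := (tau DC psi).
Local Notation bv := (bv C).
Local Notation long := (Lam_long DB).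

Definition short_arg t (a : C) := exists b, a = phi (t * b).
Definition long_arg t (c : C) := exists2 b, long b & c = phi (t * t * b).
Definition Esub t : 'M[C]_(n + n) -> Prop :=
  subgroup_gen (tgen DC (short_arg t) (long_arg t)).

(** Here [w] is a denominator. For a long argument it is its square that clears the fraction, as
    multiplication by w^2 preserves long arguments. *)
Definition integral w (h : C) := exists b, phi w * h = phi b.
Definition long_integral w (c : C) :=
  bar c = - (l * c) /\ exists2 b, long b & phi (w * w) * c = phi b.

Lemma long_conj b c : long c -> long (b * c * barB b).
Proof.
rewrite /Lam_long => Lc; have [_ _ _ Lx] := HL.
by rewrite !mulrA (ifC HB) -[X in X * _ * _ * _](ifK HB) -(mulrA (barB _)); apply: Lx.
Qed.

Lemma long_scale s c : S s -> long c -> long (s * s * c).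
Proof.
move=> Ss /(long_conj s); rewrite S_real // -mulrA -(S_central Ss).
by rewrite !mulrA.
Qed.

Lemma long_arg_bar t c : S t -> long_arg t c -> bar c = - (l * c).
Proof.
move=> St [b Lb ->]; rewrite -phi_bar -phi_lam -rmorphM -rmorphN; congr (phi _).
exact/(Lam_long_bar HB HL)/long_scale.
Qed.

Lemma Esub_group t : mx_group (Esub t).
Proof. exact: sgen_group. Qed.

Lemma long_scalar c : bar c = - (l * c) -> cj c%:M = - (l *: c%:M) :> 'M_1.
Proof.
by move=> e; rewrite (conj_scalar_mx HC) e scale_scalar_mx raddfN.
Qed.

Lemma Esub_GL t M : S t -> Esub t M -> is_GL M.
Proof.
move=> St; apply: sgen_sub; first exact: is_GL_group.
move=> {}M [i j b b' a ij _|i b c Lc]; first exact: tau_bv_GL.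
exact/tau_bv_long_GL/long_scalar/long_arg_bar/Lc.
Qed.

Lemma Esub_short t p bp q bq b : p != q ->
  Esub t (tauq (bv p bp) (bv q bq *m (phi (t * b))%:M) 0).
Proof. by move=> pq; apply/sg_in/tg_short => //; exists b. Qed.

Lemma Esub_long t p bp b : long b -> Esub t (tauq (bv p bp) 0 (phi (t * t * b))%:M).
Proof. by move=> Lb; apply/sg_in/tg_long; exists b. Qed.

Section OneElement.

Variables (w t : B) (g : 'M[C]_(n + n)).
Hypotheses (Sw : S w) (St : S t) (g_iso : isometry DC psi g).

Local Notation K := (conj_in g (Esub t)).

(** The vector [bv p bp] is displaced along a single basis vector. The last clause bounds the long
    factor that [tau_split] then produces. *)
Definition moved (p : 'I_n) bp p' bp' :=
  exists h, [/\ g *m bv p bp = bv p bp + bv p' bp' *m h%:M, integral w h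
    & exists2 d, lb *: (sh (bv p bp) *m (bv p' bp' *m h%:M)) = d%:M
               & long_integral w d].

Lemma conj_Esub_group : mx_group K.
Proof. by apply: conj_in_group; [exact: Esub_group|move=> M; exact: Esub_GL]. Qed.

(* If [g] fixes [bv q bq], the conjugate splits along [g *m bv p bp]. *)
Lemma conj_Esub_short p bp q bq p' bp' b : p != q -> p' != q ->
  g *m bv q bq = bv q bq -> moved p bp p' bp' ->
  K (tauq (bv p bp) (bv q bq *m (phi (t * w * b))%:M) 0).
Proof.
move=> pq p'q gq [h [gp [h' wh] [d dE [d_bar [d' Ld' wd]]]]].
set a := phi _; set v := bv q bq *m a%:M.
have GM := mxgM (Esub_group t).
exists (tauq (bv p bp) v 0 *m tauq (bv p' bp' *m h%:M) v 0 *m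
        tauq v 0 (lb *: (sh (bv p bp) *m (bv p' bp' *m h%:M)))).
- rewrite dE; apply: (GM); first apply: (GM).
  + by rewrite /v /a -mulrA; exact: Esub_short.
  + rewrite tau_mulr // !mulmx0 mul0mx -mulmxA (conj_scalar_mx HC) -scalar_mxM.
    suff -> : a * bar h = phi (t * (b * barB h')) by exact: Esub_short.
    rewrite /a -mulrA (S_central Sw) mulrA !rmorphM -!mulrA phi_bar -wh (ifM HC).
    by rewrite -phi_bar S_real // -(phiS_central Sw).
  + rewrite tau_mulr // mul0mx (conj_scalar_mx HC) -!scalar_mxM.
    suff -> : a * d * bar a = phi (t * t * (b * d' * barB b)).
      exact/Esub_long/long_conj.
    (* The two factors [w], one from [a] and one from [bar a], clear the square denominator of
       [d]. *)
    have -> : a * d * bar a = phi (t * b) * (phi (w * w) * d) * phi (barB b * t).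
      rewrite /a -phi_bar !(ifM HB) (S_real Sw) (S_real St) -(mulrA t).
      rewrite (S_central Sw b) !rmorphM -!mulrA; do 3 congr (_ * _).
      by rewrite (mulrA _ (phi w)) -(phiS_central Sw) !mulrA (phiS_central Sw).
    rewrite wd -!rmorphM; congr (phi _).
    by rewrite -(mulrA t) -[in RHS](mulrA t) (S_central St (b * _ * _)) !mulrA.
- rewrite tau_conj // gp /v mulmxA gq -/v tau_split //; first exact: psi_q_herm.
  + exact/(orth_mull HC)/orth_mulr/sharp_bv_iso.
  + by apply/(orth_mull HC)/sharp_bv_ne; rewrite // eq_sym.
  + by apply/(orth_mull HC)/orth_mulr/sharp_bv_ne; rewrite // eq_sym.
Qed.

(** Reduces to [conj_Esub_short] by exchanging the two vectors with [tau_skew]. *)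
Lemma conj_Esub_short_r p bp q bq q' bq' b : p != q -> q' != p ->
  g *m bv p bp = bv p bp -> moved q bq q' bq' ->
  K (tauq (bv p bp) (bv q bq *m (phi (t * w * b))%:M) 0).
Proof.
move=> pq q'p gp gq; rewrite tau_skew //.
have -> : tauq (bv q bq *m (phi (t * w * b))%:M) (- (l *: bv p bp)) 0 =
    tauq (bv q bq) (bv p bp *m (phi (t * w * - (lam DB * barB b)))%:M) 0.
  rewrite tau_mulr // mulmx0 mul0mx; congr (tau _ _ _ _ 0).
  rewrite (conj_scalar_mx HC) -phi_bar mulrN rmorphN raddfN /= mulmxN mulNmx.
  have -> : barB (t * w * b) = t * w * barB b.
    have Stw := S_mul St Sw.
    by rewrite (ifM HB) (S_real Stw) (S_central Stw).
  have -> : t * w * (lam DB * barB b) = lam DB * (t * w * barB b).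
    by rewrite [in LHS]mulrA -(ifC HB) -!mulrA.
  rewrite (rmorphM phi (lam DB)) phi_lam -scale_scalar_mx.
  by rewrite mulmx_l // -scalemxAl.
by apply: (conj_Esub_short _ _ _ gp gq); rewrite // eq_sym.
Qed.

Definition fixes_plane r := forall b, g *m bv r b = bv r b.
Definition moved_off r p := forall bp, exists p' bp', p' != r /\ moved p bp p' bp'.

(* A commutator through the plane [r]: both factors split since [g] fixes [r]. *)
Lemma conj_Esub_short_comm p bp q bq r b : p != q -> p != r -> q != r ->
  fixes_plane r -> moved_off r p -> moved_off r q ->
  K (tauq (bv p bp) (bv q bq *m (phi (t * w * (t * w) * b))%:M) 0).
Proof.
move=> pq pr qr gr pm qm; have Stw := S_mul St Sw.
have -> : (phi (t * w * (t * w) * b))%:M =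
    (phi (t * w))%:M *m (phi (t * w * b))%:M :> 'M[C]_1.
  by rewrite -scalar_mxM -rmorphM !mulrA.
apply: (short_mem HC conj_Esub_group pq pr qr).
  have [p' [bp' [p'r mp]]] := pm bp.
  exact: (conj_Esub_short _ pr p'r (gr _) mp).
have [q' [bq' [q'r mq]]] := qm bq.
have -> : - (l *: (phi (t * w))%:M) = (phi (t * w * - lam DB))%:M :> 'M[C]_1.
  rewrite scale_scalar_mx -raddfN mulrN rmorphN (rmorphM phi (t * w)) phi_lam.
  by rewrite -(phiS_central Stw).
by apply: (conj_Esub_short_r _ _ q'r (gr _) mq); rewrite eq_sym.
Qed.

(* The generator is produced from a long one in the plane [r] fixed by [g]. *)
Lemma conj_Esub_long p bp r b : long b -> p != r -> fixes_plane r -> moved_off r p ->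
  K (tauq (bv p bp) 0 (phi (t * w * (t * w) * (t * w * (t * w)) * b))%:M).
Proof.
move=> Lb pr gr pm; have Stw := S_mul St Sw.
pose s := t * w; pose c := phi (s * s * b).
have Lc : long (s * s * b) by exact: long_scale.
have cE : cj c%:M = - (l *: c%:M) :> 'M_1.
  apply: long_scalar; rewrite -phi_bar -phi_lam -rmorphM -rmorphN; congr (phi _).
  exact: Lam_long_bar HB HL _ Lc.
have -> : (phi (t * w * (t * w) * (t * w * (t * w)) * b))%:M =
    (phi s)%:M *m c%:M *m cj (phi s)%:M :> 'M_1.
  rewrite (conj_scalar_mx HC) -!scalar_mxM -phi_bar (S_real Stw) -!rmorphM.
  by rewrite -(mulrA s) -(S_central Stw (s * s * b)) !mulrA.
have rp : r != p by rewrite eq_sym.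
have [p' [bp' [p'r mp]]] := pm bp.
apply: (long_mem HC conj_Esub_group pr cE).
- rewrite (conj_scalar_mx HC) -phi_bar (S_real Stw) -[t * w]mulr1.
  exact: (conj_Esub_short _ pr p'r (gr _) mp).
- exists (tauq (bv r false) 0 c%:M); last by rewrite tau_conj // gr mulmx0.
  have -> : c = phi (t * t * (w * w * b)).
    rewrite /c /s; congr (phi _).
    by rewrite -(mulrA t) (mulrA w) (S_central Sw t) !mulrA.
  exact/Esub_long/long_scale.
- rewrite (conj_scalar_mx HC) -scalar_mxM -phi_bar -rmorphM.
  exact: (conj_Esub_short_r _ rp p'r (gr _) mp).
Qed.

(* [g] acts like an elementary generator attached to the planes [i] and [j]. *)
Definition acts_on_planes i j :=
  (forall p, p != i -> p != j -> fixes_plane p) /\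
  (forall p bp, exists p' bp', (p' = i \/ p' = j) /\ moved p bp p' bp').

(** The hypothesis [2 < n] enters here. *)
Lemma third_plane (i j : 'I_n) : exists r, i != r /\ j != r.
Proof.
have /existsP[r /andP[ir jr]] : [exists r : 'I_n, (i != r) && (j != r)].
  apply: contraLR n3 => /existsPn ij; rewrite -leqNgt -[n in (n <= _)%N]card_ord -cardsT.
  have c2 : (#|[set i; j]| <= 2)%N by rewrite cards2; case: (i != j).
  apply: leq_trans c2; apply: subset_leq_card; apply/fintype.subsetP => r _.
  by have := ij r; rewrite !inE negb_and !negbK ![r == _]eq_sym.
by exists r.
Qed.

(** The level (t w)^2 is the price of a commutator, each of whose two members takes a factor t w. If
    [p] or [q] lies outside [i], [j], then [g] fixes the corresponding vector and the conjugate
    splits directly; otherwise the commutator goes through a plane that [g] fixes. *)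
Lemma conj_Esub i j M : acts_on_planes i j ->
  Esub (t * w * (t * w)) M -> K M.
Proof.
move=> [fix_pl mv]; apply: sgen_sub; first exact: conj_Esub_group.
have fixed_moved p bp p' bp' : fixes_plane p -> moved p bp p' bp'.
  move=> gp; exists 0; rewrite gp raddf0 !mulmx0 addr0; split=> //.
    by exists 0; rewrite mulr0 rmorph0.
  exists 0; first by rewrite scaler0 raddf0.
  split; first by rewrite bar0 // mulr0 oppr0.
  exists 0; last by rewrite mulr0 rmorph0.
  have [_ Lm _ _] := HL; apply: Lm; exists 0.
  by rewrite mulr0 bar0 // mulr0 subr0.
have off r p : i != r -> j != r -> moved_off r p.
  by move=> ir jr bp; have [p' [bp' [[] -> mp]]] := mv p bp; [exists i|exists j]; exists bp'.
move=> {}M [p q bp bq a pq [b ->]|p bp c [b Lb ->]]; last first.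
  have [r [ir jr]] := third_plane i j.
  have [pr|pr] := eqVneq p r.
    have gp : g *m bv p bp = bv p bp by apply: fix_pl; rewrite pr eq_sym.
    have Stw := S_mul St Sw.
    exists (tauq (bv p bp) 0 (phi (t * t * (w * w * (t * w * (t * w)) * b)))%:M).
      apply: Esub_long; rewrite -(mulrA (w * w)); apply: long_scale => //.
      exact: long_scale.
    rewrite tau_conj // gp mulmx0; congr (tau _ _ _ _ (phi _)%:M *m _).
    by rewrite -!(mulrA t) !(mulrA _ t) -!(S_central St) -!(mulrA t) !mulrA.
  apply: (conj_Esub_long _ Lb pr); last exact: off.
  by apply: fix_pl; rewrite eq_sym.
have E : t * w * (t * w) * b = t * w * (t * w * b) by rewrite !mulrA.
have [q_in|q_out] := boolP ((q == i) || (q == j)); last first.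
  move: q_out; rewrite negb_or => /andP[qi qj].
  have [p' [bp' [p'ij mp]]] := mv p bp; rewrite E.
  apply: (conj_Esub_short _ pq _ (fix_pl _ qi qj _) mp).
  by case: p'ij => ->; rewrite eq_sym.
have [p_in|p_out] := boolP ((p == i) || (p == j)); last first.
  move: p_out; rewrite negb_or => /andP[pi pj].
  have [q' [bq' [q'ij mq]]] := mv q bq; rewrite E.
  apply: (conj_Esub_short_r _ pq _ (fix_pl _ pi pj _) mq).
  by case: q'ij => ->; rewrite eq_sym.
have [r [pr qr]] := third_plane p q.
(* As [p] and [q] differ and both lie among [i], [j], they exhaust them, so a plane other than [p]
   and [q] avoids both. *)
have [ir jr] : i != r /\ j != r.
  case/orP: p_in pq pr => /eqP->; case/orP: q_in qr => /eqP->; rewrite ?eqxx //.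
apply: (conj_Esub_short_comm _ _ _ pq pr qr); [|exact: off|exact: off].
by apply: fix_pl; rewrite eq_sym.
Qed.

End OneElement.

(** A displacement into another plane is orthogonal to the vector displaced, so the long term of
    [moved] is 0. *)
Lemma moved_orth w g p bp p' bp' h : p' != p ->
  g *m bv p bp = bv p bp + bv p' bp' *m h%:M -> integral w h ->
  moved w g p bp p' bp'.
Proof.
move=> p'p gp wh; exists h; split=> //; exists 0.
  by rewrite orth_mulr ?scaler0 ?raddf0 // sharp_bv_ne // eq_sym.
split; first by rewrite bar0 // mulr0 oppr0.
exists 0; last by rewrite mulr0 rmorph0.
have [_ Lm _ _] := HL; apply: Lm; exists 0.
by rewrite mulr0 bar0 // mulr0 subr0.
Qed.

Lemma integral0 w : integral w 0.
Proof. by exists 0; rewrite mulr0 rmorph0. Qed.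

Lemma integral_eps w h b : integral w h -> integral w (h * eps DC b).
Proof.
move=> [h' wh]; exists (h' * eps DB b); rewrite mulrA wh rmorphM.
by case: b; rewrite /= ?rmorph1 ?phi_lam.
Qed.

Lemma tau_short_acts w i b j b' h : i != j -> S w -> integral w h ->
  acts_on_planes w (tauq (bv i b) (bv j b' *m h%:M) 0) i j.
Proof.
move=> ij Sw wh; set g := tauq _ _ _.
have gE p bp : g *m bv p bp = bv p bp +
    bv i b *m ((bar h)%:M *m (sh (bv j b') *m bv p bp)) -
    lb *: (bv j b' *m (h%:M *m (sh (bv i b) *m bv p bp))).
  by rewrite tau_vec mulmx0 mul0mx addr0 sharpM // (conj_scalar_mx HC) -!mulmxA.
have ji : j != i by rewrite eq_sym.
have fix_pl p : p != i -> p != j -> fixes_plane g p.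
  by move=> pi pj bp; rewrite gE !sharp_bv_ne 1?eq_sym // !mulmx0 scaler0 addr0 subr0.
split=> // p bp; have [->|pi] := eqVneq p i.
  exists j, b'; split; first by right.
  pose h1 := if bp == ~~ b then - (lb * (h * eps DC b)) else 0.
  apply: (@moved_orth _ _ _ _ _ _ h1) => //; last first.
    rewrite /h1; case: ifP => _; last exact: integral0.
    have [h' wh'] := integral_eps b wh.
    exists (- (barB (lam DB) * h')).
    by rewrite mulrN mulrA (phiS_central Sw) -mulrA wh' rmorphN rmorphM phi_bar phi_lam.
  rewrite gE (sharp_bv_ne HC _ _ ji) // !mulmx0 addr0 sharp_bvE // eqxx /= /h1.
  case: ifP => _; last by rewrite !mulmx0 scaler0 subr0 raddf0 mulmx0 addr0.
  by rewrite -scalar_mxM -mulmx_lb // scale_scalar_mx -mulmxN -raddfN.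
have [->|pj] := eqVneq p j.
  exists i, b; split; first by left.
  pose h1 := if bp == ~~ b' then bar h * eps DC b' else 0.
  apply: (@moved_orth _ _ _ _ _ _ h1) => //; last first.
    rewrite /h1; case: ifP => _; last exact: integral0.
    apply: integral_eps; have [h' wh'] := wh; exists (barB h').
    by rewrite phi_bar -wh' (ifM HC) -phi_bar S_real // -(phiS_central Sw).
  rewrite gE (sharp_bv_ne HC _ _ ij) // !mulmx0 scaler0 subr0 sharp_bvE // eqxx /= /h1.
  case: ifP => _; last by rewrite !mulmx0 raddf0 mulmx0.
  by rewrite -scalar_mxM.
exists i, b; split; first by left.
apply: (@moved_orth _ _ _ _ _ _ 0); [by rewrite eq_sym| |exact: integral0].
by rewrite fix_pl // raddf0 mulmx0 addr0.
Qed.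

Lemma tau_long_acts w i b c : integral w c -> long_integral w c ->
  acts_on_planes w (tauq (bv i b) 0 c%:M) i i.
Proof.
move=> wc wL; set g := tauq _ _ _.
have gE p bp : g *m bv p bp = bv p bp +
    bv i b *m (c%:M *m (sh (bv i b) *m bv p bp)).
  by rewrite tau_vec sharp0 // !mul0mx mulmx0 scaler0 subr0 addr0 -!mulmxA.
have fix_pl p : p != i -> fixes_plane g p.
  by move=> pi bp; rewrite gE !sharp_bv_ne 1?eq_sym // !mulmx0 addr0.
split=> [p pi _|p bp]; first exact: fix_pl.
have [->|pi] := eqVneq p i; last first.
  exists i, b; split; first by left.
  apply: (@moved_orth _ _ _ _ _ _ 0); [by rewrite eq_sym| |exact: integral0].
  by rewrite fix_pl // raddf0 mulmx0 addr0.
exists i, b; split; first by left.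
have [->|bpb] := eqVneq bp (~~ b).
  exists (c * eps DC b); split; last 1 first.
  (* The displacement stays in the plane, and the long term of [moved] is [c] itself, since
     [eps DC b * eps DC (~~ b)] is [l]. *)
  - exists c => //; rewrite mulmxA sharp_bvE // negbK !eqxx -scalar_mxM scale_scalar_mx.
    congr (_%:M); rewrite (central_eps HC (~~ b)) -mulrA mulrA.
    have -> : eps DC b * eps DC (~~ b) = l by case: (b); rewrite /= ?mul1r ?mulr1.
    exact: lb_mid.
  - by rewrite gE sharp_bvE // !eqxx /= -scalar_mxM.
  - exact: integral_eps.
exists 0; split; last 1 first.
- exists 0; first by rewrite raddf0 !mulmx0 scaler0.
  split; first by rewrite bar0 // mulr0 oppr0.
  exists 0; last by rewrite mulr0 rmorph0.
  have [_ Lm _ _] := HL; apply: Lm; exists 0.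
  by rewrite mulr0 bar0 // mulr0 subr0.
- by rewrite gE sharp_bvE // eqxx (negPf bpb) !mulmx0 raddf0 mulmx0.
- exact: integral0.
Qed.

(** [tau_long_acts] wants one denominator in both senses; the square of the given one works. *)
Lemma long_integral_square v c : S v -> long_integral v c ->
  integral (v * v) c /\ long_integral (v * v) c.
Proof.
move=> Sv [c_bar [c' Lc' vc]]; split; first by exists c'.
split=> //; exists (v * v * c'); first exact: long_scale.
by rewrite rmorphM -mulrA vc -rmorphM.
Qed.

End Conjugation.

(** * Morphisms and translation of the variable *)

(** [Lam] is left out: the inclusion of form parameters is asked for separately, so that one map can
    be used with several of them. *)
Record form_morph (P Q : pzRingType) (D : formData P) (E : formData Q)
    (f : P -> Q) : Prop := FormMorph {
  fm_bar : forall x, f (bar D x) = bar E (f x);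
  fm_lam : f (lam D) = lam E }.

Section FormMorph.

Variables (P Q : pzRingType) (D : formData P) (E : formData Q).
Variables (f : {rmorphism P -> Q}) (fE : form_morph D E f).

Lemma form_morph_long : (forall c, Lam D c -> Lam E (f c)) ->
  forall c, Lam_long D c -> Lam_long E (f c).
Proof. by move=> fL c /fL; rewrite /Lam_long rmorphM /= (fm_lam fE). Qed.

Lemma map_conj_mx p q (M : 'M[P]_(p, q)) :
  map_mx f (conj_mx D M) = conj_mx E (map_mx f M).
Proof. by apply/matrixP => i j; rewrite !mxE (fm_bar fE). Qed.

Lemma map_tau N (psi : 'M[P]_N) v w c :
  map_mx f (tau D psi v w c) =
  tau E (map_mx f psi) (map_mx f v) (map_mx f w) (map_mx f c).
Proof.
rewrite !tauE !sharpE !(map_mxD, map_mxN, map_mxM, map_mxZ, map_conj_mx, map_mx1) /=.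
by rewrite (fm_bar fE) (fm_lam fE).
Qed.

Lemma map_psi_q n : map_mx f (psi_q D n) = psi_q E n.
Proof.
by rewrite /psi_q map_block_mx !(map_mx0, map_mx1, map_scalar_mx) /= (fm_lam fE).
Qed.

Lemma map_bv n i b : map_mx f (bv P i b) = bv Q i b :> 'cV_(n + n).
Proof. exact: map_delta_mx. Qed.

Lemma map_tau_short n (i j : 'I_n) b b' a :
  map_mx f (tau D (psi_q D n) (bv P i b) (bv P j b' *m a%:M) 0) =
  tau E (psi_q E n) (bv Q i b) (bv Q j b' *m (f a)%:M) 0.
Proof. by rewrite map_tau map_psi_q map_mxM !map_bv map_scalar_mx map_mx0. Qed.

Lemma map_tau_long n (i : 'I_n) b c :
  map_mx f (tau D (psi_q D n) (bv P i b) 0 c%:M) =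
  tau E (psi_q E n) (bv Q i b) 0 (f c)%:M.
Proof. by rewrite map_tau map_psi_q map_bv map_scalar_mx map_mx0. Qed.

Lemma map_subgroup N (A : 'M[P]_N -> Prop) (G : 'M[Q]_N -> Prop) :
  mx_group G -> (forall M, A M -> G (map_mx f M)) ->
  forall M, subgroup_gen A M -> G (map_mx f M).
Proof.
move=> GG AG; apply: sgen_sub => //; split.
- by rewrite map_mx1; exact: mxg1 GG.
- by move=> X Y GX GY; rewrite map_mxM; exact: mxgM GG _ _ GX GY.
- move=> X Y GX XY YX; apply: (mxgV GG GX).
    by rewrite -map_mxM XY map_mx1.
  by rewrite -map_mxM YX map_mx1.
Qed.

Lemma map_TE n (SA SL : P -> Prop) (SA' SL' : Q -> Prop) :
  (forall a, SA a -> SA' (f a)) -> (forall c, SL c -> SL' (f c)) ->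
  forall M : 'M_(n + n), subgroup_gen (tgen D SA SL) M ->
  subgroup_gen (tgen E SA' SL') (map_mx f M).
Proof.
move=> fA fL; apply: map_subgroup; first exact: sgen_group.
move=> _ [i j b b' a ij Aa|i b c Lc].
  by rewrite map_tau_short; apply/sg_in/tg_short/fA.
by rewrite map_tau_long; apply/sg_in/tg_long/fL.
Qed.

End FormMorph.

(** * Continuity of elementary matrices and expansion of words *)

Section Expansion.

Variables (B C C0 : pzRingType).
Variables (DB : formData B) (DC : formData C) (D0 : formData C0).
Variables (phi : {rmorphism B -> C}) (S : B -> Prop) (n : nat).
Hypotheses (HB : invol_form DB) (HC : invol_form DC).
Hypothesis HL : form_parameter DB (Lam DB).
Hypothesis phi_form : form_morph DB DC phi.
Hypothesis S_mul : forall s t, S s -> S t -> S (s * t).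
Hypothesis S_central : forall s, S s -> central s.
Hypothesis phiS_central : forall s, S s -> central (phi s).
Hypothesis S_real : forall s, S s -> bar DB s = s.
Hypothesis n3 : (2 < n)%N.

Local Notation E := (@Esub B C DB DC phi n).

(** Continuity at 1 of conjugation by [g], for the topology in which the groups E_t with [t] in [S]
    form a basis of neighbourhoods of 1. *)
Definition continuous (g : 'M[C]_(n + n)) := forall t, S t ->
  exists2 u, S u & forall M, E u M -> conj_in g (E t) M.

Definition S_short (h : C) := exists2 v, S v & integral phi v h.
Definition S_long (c : C) := exists2 v, S v & long_integral DB DC phi v c.

Lemma continuous_acts w i j g : S w -> isometry DC (psi_q DC n) g ->
  acts_on_planes DB DC phi w g i j -> continuous g.
Proof.
move=> Sw gi gij t St; exists (t * w * (t * w)).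
  exact/(S_mul (S_mul St Sw))/S_mul.
move=> M; apply: (conj_Esub HB HC HL (fm_bar phi_form) (fm_lam phi_form)
  S_mul S_central phiS_central S_real n3 Sw St gi gij).
Qed.

Lemma S_long_opp c : S_long c -> S_long (- c).
Proof.
move=> [v Sv [c_bar [b Lb vc]]]; exists v => //; split.
  by rewrite (barN HC) c_bar mulrN.
exists (- b); last by rewrite mulrN vc rmorphN.
by rewrite /Lam_long mulrN; exact: (form_parameterN HB HL).
Qed.

Lemma S_short_opp h : S_short h -> S_short (- h).
Proof. by move=> [v Sv [b vh]]; exists v => //; exists (- b); rewrite mulrN vh rmorphN. Qed.

Lemma continuous_gen (g : 'M_(n + n)) : tgen DC S_short S_long g -> continuous g.
Proof.
move=> [i j b b' h ij [v Sv vh]|i b c [v Sv vc]].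
  apply: (continuous_acts Sv); first exact: tau_bv_isometry.
  exact: (tau_short_acts HB HC HL (fm_bar phi_form) (fm_lam phi_form) phiS_central
    S_real).
have Svv := S_mul Sv Sv; have [v2 v2L] :=
  long_integral_square HB HL S_central S_real Sv vc.
apply: (continuous_acts Svv).
  by apply: tau_bv_long_isometry => //; apply: long_scalar => //; case: vc.
exact: (tau_long_acts HB HC HL (fm_lam phi_form)).
Qed.

Lemma tgen_inv (g : 'M_(n + n)) : tgen DC S_short S_long g ->
  exists g', [/\ tgen DC S_short S_long g', g *m g' = 1%:M & g' *m g = 1%:M].
Proof.
have herm := psi_q_herm n HC.
move=> [i j b b' h ij Sh|i b c Sc].
  have [ii ij0 cond] := tau_bv_cond HC b b' h%:M ij.
  have := tauV HC herm ii ij0 cond; rewrite (conj_mx0 HC) scaler0 -mulmxN -raddfN.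
  move=> [gg' g'g]; eexists; split; [|exact: gg'|exact: g'g].
  exact/tg_short/S_short_opp.
have cE : conj_mx DC c%:M = - (lam DC *: c%:M) :> 'M_1.
  by apply: long_scalar => //; case: Sc => v _ [].
have ii := sharp_bv_iso HC i b.
have := tauV HC herm ii (mulmx0 _ _) (tau_cond_long (psi_q DC n) cE).
rewrite oppr0 cE scalerN scale_lb_l // -raddfN => -[gg' g'g].
by eexists; split; [|exact: gg'|exact: g'g]; apply/tg_long/S_long_opp.
Qed.

(** Continuity is not visibly inherited by the inverse matrix, so the induction carries it for [g]
    and for its inverse together; the inverse of a generator is a generator by [tgen_inv]. *)
Lemma continuousP (g : 'M_(n + n)) : subgroup_gen (tgen DC S_short S_long) g -> continuous g.
Proof.
pose Q g := exists g', [/\ g *m g' = 1%:M, g' *m g = 1%:M, continuous g & continuous g'].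
suff : subgroup_gen (tgen DC S_short S_long) g -> Q g by move=> H /H[g' []].
apply: sgen_sub => [|{}g gG]; last first.
  have [g' [g'G gg' g'g]] := tgen_inv gG.
  by exists g'; split=> //; exact: continuous_gen.
have cM g1 g2 : continuous g1 -> continuous g2 -> continuous (g1 *m g2).
  move=> c1 c2 t /c1[u1 Su1 h1]; have [u Su h2] := c2 _ Su1.
  exists u => // M /h2[M2 /h1[M1 EM1 e1] e2]; exists M1 => //.
  by rewrite -mulmxA e2 !mulmxA e1.
split.
- have c1 : continuous 1%:M.
    by move=> t St; exists t => // M EM; exists M; rewrite ?mul1mx ?mulmx1.
  by exists 1%:M; rewrite mulmx1.
- move=> g1 g2 [h1 [gh1 hg1 cg1 ch1]] [h2 [gh2 hg2 cg2 ch2]].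
  exists (h2 *m h1); split; try exact: cM.
    by rewrite mulmxA -(mulmxA g1) gh2 mulmx1.
  by rewrite mulmxA -(mulmxA h2) hg1 mulmx1.
- move=> g1 h [h1 [gh1 hg1 cg1 ch1]] gh hg; exists g1.
  by have <- := mx_inv_uniq hg1 gh.
Qed.

Variables (K : comPzRingType) (T : K -> Prop).
Hypotheses (T1 : T 1) (T_mul : forall s t, T s -> T t -> T (s * t)).
Variables (iota : {rmorphism C0 -> C}) (F : K -> {rmorphism C0 -> C}).
Hypothesis iota_form : form_morph D0 DC iota.
Hypothesis F_form : forall s, form_morph D0 DC (F s).
Hypothesis iota_short : forall h, S_short (iota h).
Hypothesis iota_long : forall c, Lam_long D0 c -> S_long (iota c).
Hypothesis F_short : forall h t, S t -> exists2 s, T s &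
  forall v, T v -> short_arg phi t (F (s * v) h - iota h).
Hypothesis F_long : forall c t, Lam_long D0 c -> S t -> exists2 s, T s &
  forall v, T v -> long_arg DB phi t (F (s * v) c - iota c).

(** Write e(M) for F(M) iota(M)^-1. Then e(M M') is e(M) times the conjugate of e(M') by iota(M),
    and e(M^-1) is the conjugate of e(M)^-1 by iota(M)^-1. By continuity it is enough to expand the
    conjugated factor at a finer level [u]. Uniformity in [v] lets the parameters of two factors be
    multiplied together. *)
Lemma expansion (M : 'M_(n + n)) t :
  subgroup_gen (tgen D0 (fun=> True) (Lam_long D0)) M -> S t ->
  exists2 s, T s & forall v, T v -> exists2 e, E t e &
    map_mx (F (s * v)) M = e *m map_mx iota M.
Proof.
have EG := Esub_group DB DC phi n.
have iota_cont X : subgroup_gen (tgen D0 (fun=> True) (Lam_long D0)) X ->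
    continuous (map_mx iota X).
  by move=> XG; apply: continuousP; apply: map_TE XG.
have herm := psi_q_herm n HC.
move=> MG; elim: MG t => {M}.
move=> _ [i j b b' h ij _|i b c Lc] t St.
- have [s Ss hs] := F_short h St; exists s => // v Sv.
  exists (tau DC (psi_q DC n) (bv C i b) (bv C j b' *m (F (s * v) h - iota h)%:M) 0).
    exact/sg_in/tg_short/hs.
  have [ii ij0 _] := tau_bv_cond HC b b' (F (s * v) h - iota h)%:M ij.
  have [_ ij1 _] := tau_bv_cond HC b b' (iota h)%:M ij.
  rewrite (map_tau_short (F_form (s * v))) (map_tau_short iota_form) tauM //.
  rewrite orth_mull ?orth_mulr ?sharp_bv_iso // scaler0 subr0 addr0.
  by rewrite -mulmxDr -raddfD subrK.
- have [s Ss hs] := F_long Lc St; exists s => // v Sv.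
  exists (tau DC (psi_q DC n) (bv C i b) 0 (F (s * v) c - iota c)%:M).
    exact/sg_in/tg_long/hs.
  rewrite (map_tau_long (F_form (s * v))) (map_tau_long iota_form) tauM //.
  - by rewrite mulmx0 scaler0 subr0 addr0 -raddfD subrK.
  - exact: sharp_bv_iso.
  - exact: mulmx0.
  - exact: mulmx0.
- move=> t St; exists 1 => // v _; exists 1%:M; first exact: (mxg1 (EG t)).
  by rewrite !map_mx1 mulmx1.
- move=> M M' MG IH M'G IH' t St.
  have [u Su hu] := iota_cont _ MG _ St.
  have [s Ss hs] := IH _ St; have [s' Ss' hs'] := IH' _ Su.
  exists (s * s') => [|v Sv]; first exact: T_mul.
  have [e Ee eE] := hs _ (T_mul Ss' Sv).
  have [e' Ee' e'E] := hs' _ (T_mul Ss Sv).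
  have [e1 Ee1 e1E] := hu _ Ee'.
  exists (e *m e1); first exact: (mxgM (EG t)).
  rewrite !map_mxM -(mulrA s) eE (mulrA s) (mulrC s) -(mulrA s') e'E.
  by rewrite -!mulmxA; congr (_ *m _); rewrite !mulmxA e1E.
- move=> M M' MG IH MM' M'M t St.
  have [u Su hu] := iota_cont _ (sg_inv MG MM' M'M) _ St.
  have [s Ss hs] := IH _ Su; exists s => // v Sv.
  have [e Ee eE] := hs _ Sv.
  have [e' [ee' e'e]] := Esub_GL HB HC HL (fm_bar phi_form) (fm_lam phi_form)
    S_central S_real Su Ee.
  have [e1 Ee1 e1E] := hu _ (mxgV (EG u) Ee ee' e'e).
  exists e1 => //; rewrite -e1E; apply: (@mx_inv_uniq _ _ (map_mx (F (s * v)) M)).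
    by rewrite -map_mxM M'M map_mx1.
  rewrite eE !mulmxA -(mulmxA e) -map_mxM MM' map_mx1 mulmx1.
  by rewrite ee'.
Qed.
End Expansion.

(** * Polynomial rings and localizations *)

(** [poly_form] with the form parameter left free. *)
Definition polyD (P : nzRingType) (D : formData P) (L : {poly P} -> Prop) :
    formData {poly P} :=
  FormData (map_poly (bar D)) (lam D)%:P L.

Section PolyForm.

Variables (P : nzRingType) (D : formData P) (L : {poly P} -> Prop).
Hypothesis HD : invol_form D.

Lemma coef_bar (p : {poly P}) i : (map_poly (bar D) p)`_i = bar D p`_i.
Proof. by rewrite coef_map_id0 // bar0. Qed.

Lemma polyC_central (z : P) : central z -> central z%:P.
Proof. by move=> z_c p; apply/polyP => i; rewrite coefCM coefMC z_c. Qed.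

Lemma polyX_central : central ('X : {poly P}).
Proof. by move=> p; rewrite commr_polyX. Qed.

Lemma bar_polyC a : map_poly (bar D) a%:P = (bar D a)%:P.
Proof. by apply/polyP => i; rewrite coef_bar !coefC; case: ifP; rewrite ?bar0. Qed.

Lemma bar_polyX : map_poly (bar D) 'X = 'X.
Proof.
apply/polyP => i; rewrite coef_bar coefX.
by case: (i == 1)%N; rewrite ?(bar1 HD) ?(bar0 HD).
Qed.

Lemma poly_invol : invol_form (polyD D L).
Proof.
split=> /= [p q|p q|p||].
- by apply/polyP => i; rewrite !(coefD, coef_bar) (ifD HD).
- apply/polyP => i; rewrite coef_bar coefM coefMr (bar_sum HD).
  by apply: eq_bigr => j _; rewrite !coef_bar (ifM HD).
- by apply/polyP => i; rewrite !coef_bar (ifK HD).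
- exact/polyC_central/(ifC HD).
- by rewrite bar_polyC -polyCM (ifL HD).
Qed.

Lemma polyC_form_morph : form_morph D (polyD D L) (@polyC P).
Proof. by split=> //= x; rewrite bar_polyC. Qed.

End PolyForm.

Lemma central_comm (P Q : nzRingType) (f : {rmorphism P -> Q}) u :
  central u -> commr_rmorph f u.
Proof. by move=> u_c x; exact: u_c. Qed.

Lemma poly_morph_ext (P : nzRingType) (Q : pzRingType) (f g : {rmorphism {poly P} -> Q}) :
  (forall a, f a%:P = g a%:P) -> f 'X = g 'X -> f =1 g.
Proof.
move=> fgC fgX; elim/poly_ind => [|p a IH]; first by rewrite !rmorph0.
by rewrite !rmorphD !rmorphM IH fgC fgX.
Qed.

Lemma horner_form_morph (P Q : nzRingType) (D : formData P) (E : formData Q) L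
    (f : {rmorphism P -> Q}) u (u_c : central u) :
  invol_form D -> invol_form E -> form_morph D E f -> bar E u = u ->
  form_morph (polyD D L) E (horner_morph (central_comm f u_c)).
Proof.
move=> HD HE fE u_real; split; last by rewrite /= horner_morphC (fm_lam fE).
elim/poly_ind => [|p a IH] /=; first by rewrite rmorph0 map_poly0 // rmorph0 bar0.
have HP := poly_invol L HD.
have := ifD HP (p * 'X) a%:P; have := ifM HP p 'X => /= -> ->.
rewrite bar_polyX // bar_polyC // !rmorphD !rmorphM /= IH horner_morphX !horner_morphC.
by rewrite (ifD HE) (ifM HE) u_real (fm_bar fE).
Qed.

Lemma map_poly_form_morph (P Q : nzRingType) (D : formData P) (E : formData Q) L L'
    (f : {rmorphism P -> Q}) : invol_form D -> invol_form E ->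
  form_morph D E f -> form_morph (polyD D L) (polyD E L') (map_poly f).
Proof.
move=> HD HE fE; split=> [p|] /=; last by rewrite map_polyC /= (fm_lam fE).
by apply/polyP => i; rewrite (coef_bar HE) !coef_map (coef_bar HD); exact: fm_bar fE _.
Qed.

(** The features of a localization that pass to polynomials coefficient by coefficient:
    denominators, torsion kernel, and cancellation of denominators in place of their
    invertibility. *)
Record is_loc (A A' : pzRingType) (S : A -> Prop) (f : A -> A') : Prop := IsLoc {
  loc_num : forall c, exists2 s, S s & exists b, f s * c = f b;
  loc_ker : forall b, f b = 0 -> exists2 s, S s & s * b = 0;
  loc_can : forall s c, S s -> f s * c = 0 -> c = 0 }.

Record central_mul (A : pzRingType) (S : A -> Prop) : Prop := CentralMul {
  cm1 : S 1;
  cmM : forall s t, S s -> S t -> S (s * t);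
  cmC : forall s, S s -> central s }.

Definition poly_const (A : nzRingType) (S : A -> Prop) (p : {poly A}) :=
  exists2 s, S s & p = s%:P.

Section PolyLoc.

Variables (A A' : nzRingType) (S : A -> Prop) (f : {rmorphism A -> A'}).
Hypotheses (SC : central_mul S) (fC : forall s, S s -> central (f s)).
Hypothesis fL : is_loc S f.

Lemma poly_central_mul : central_mul (poly_const S).
Proof.
split=> [|_ _ [s Ss ->] [t St ->]|_ [s Ss ->]].
- by exists 1; [exact: cm1 SC|].
- by exists (s * t); [exact: cmM SC _ _ Ss St|rewrite polyCM].
- exact/polyC_central/(cmC SC).
Qed.

Lemma poly_map_central s : poly_const S s -> central (map_poly f s).
Proof. by move=> [{}s Ss ->]; rewrite map_polyC; exact/polyC_central/fC. Qed.

Lemma poly_is_loc : is_loc (poly_const S) (map_poly f).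
Proof.
split=> [||_ c [s Ss ->]].
- elim/poly_ind => [|p a [_ [s Ss ->] [b sb]]].
    by exists 1; [exists 1; first exact: cm1 SC|exists 0; rewrite mulr0 rmorph0].
  have [t St [c tc]] := loc_num fL a.
  exists (t * s)%:P; first by exists (t * s); first exact: cmM SC _ _ St Ss.
  exists (t%:P * b * 'X + (s * c)%:P).
  rewrite [RHS]rmorphD !rmorphM /= -sb !map_polyC /= map_polyX -tc.
  rewrite mulrDr polyCM !mulrA; congr (_ + _ * _).
  by rewrite -!polyCM (fC St).
- elim/poly_ind => [_|p a IH]; first by exists 1; [exact: cm1 poly_central_mul|rewrite mulr0].
  move=> /polyP e.
  have [_ [s Ss ->] sp] : exists2 s, poly_const S s & s * p = 0.
    apply: IH; apply/polyP => i; have := e i.+1.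
    by rewrite rmorphD rmorphM /= map_polyX map_polyC coefD coefMX coefC /= addr0 !coef0.
  have [t St ta] : exists2 s, S s & s * a = 0.
    apply: (loc_ker fL); have := e 0%N.
    by rewrite rmorphD rmorphM /= map_polyX map_polyC coefD coefMX coefC /= add0r coef0.
  exists (t * s)%:P; first by exists (t * s); first exact: cmM SC _ _ St Ss.
  have -> : (t * s)%:P * (p * 'X + a%:P) =
      t%:P * (s%:P * p) * 'X + (s * (t * a))%:P.
    by rewrite mulrDr -polyCM !polyCM !mulrA -!polyCM (cmC SC St s).
  by rewrite sp ta !mulr0 mul0r addr0.
- rewrite map_polyC => /polyP e; apply/polyP => i.
  rewrite coef0; apply: (loc_can fL Ss).
  by have := e i; rewrite coefCM coef0.
Qed.

End PolyLoc.

Section Localized.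

Local Open Scope quotient_scope.

Variables (k : comNzRingType) (R : algType k) (S : mulrClosed k).
Variable nz : (1 : loc R S) != 0.

Local Notation Rm := (nzloc nz).
Local Notation pi x := (\pi_(loc R S) x : Rm).

Definition nzloc_map (a : R) : Rm := loc_map S a.

Lemma loc_addE x y : pi x + pi y = pi (lfrac_add x y).
Proof. exact: loc_add_pi. Qed.

Lemma loc_mulE x y : pi x * pi y = pi (lfrac_mul x y).
Proof. exact: loc_mul_pi. Qed.

Lemma loc_oppE x : - pi x = pi (lfrac_opp x).
Proof. exact: loc_opp_pi. Qed.

Lemma loc_eqE (a b : R) s t : sval t *: a = sval s *: b -> pi (a, s) = pi (b, t).
Proof. by move=> e; apply/eqP/loc_eqP; exists 1; rewrite ?rpred1 //= e. Qed.

Lemma locP (x : Rm) : exists a s, x = pi (a, s).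
Proof. by elim/quotW: x => -[a s]; exists a, s. Qed.

Fact nzloc_map_is_zmod_morphism : zmod_morphism nzloc_map.
Proof.
move=> a b; rewrite /nzloc_map /loc_map loc_oppE loc_addE.
by apply: loc_eqE; rewrite /= !scale1r !mul1r scale1r.
Qed.

Fact nzloc_map_is_monoid_morphism : monoid_morphism nzloc_map.
Proof.
split=> [//|a b]; rewrite /nzloc_map /loc_map loc_mulE.
by apply: loc_eqE; rewrite /= mul1r.
Qed.

HB.instance Definition _ :=
  GRing.isZmodMorphism.Build R Rm nzloc_map nzloc_map_is_zmod_morphism.
HB.instance Definition _ :=
  GRing.isMonoidMorphism.Build R Rm nzloc_map nzloc_map_is_monoid_morphism.

Definition scalars (x : R) := exists2 s, s \in S & x = s%:A.

Lemma scalars_central_mul : central_mul scalars.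
Proof.
split=> [|_ _ [s Ss ->] [t St ->]|_ [s Ss ->] x].
- by exists 1; rewrite ?rpred1 ?scale1r.
- by exists (s * t); rewrite ?rpredM // -scalerAl mul1r scalerA.
- by rewrite -scalerAl -scalerAr mul1r mulr1.
Qed.

Lemma nzloc_scaleE (s : k) a t : nzloc_map s%:A * pi (a, t) = pi (s *: a, t).
Proof.
rewrite /nzloc_map /loc_map loc_mulE; apply: loc_eqE => /=.
by rewrite mul1r -scalerAl mul1r.
Qed.

Lemma nzloc_map_scalar s : central (nzloc_map s%:A).
Proof.
move=> y; have [a [t ->]] := locP y; rewrite nzloc_scaleE.
rewrite /nzloc_map /loc_map loc_mulE; apply: loc_eqE => /=.
by rewrite mulr1 -scalerAr mulr1.
Qed.

Lemma nzloc_map_central x : scalars x -> central (nzloc_map x).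
Proof. by move=> [s _ ->]; exact: nzloc_map_scalar. Qed.

Lemma pi_eq0 a t : pi (a, t) = 0 -> exists2 u, u \in S & u *: a = 0.
Proof.
by move=> /eqP/loc_eqP[u Su /=]; rewrite scale1r !scaler0 => e; exists u.
Qed.

Lemma pi_eq0_scale a t u : u \in S -> u *: a = 0 -> pi (a, t) = 0.
Proof.
by move=> Su e; apply/eqP/loc_eqP; exists u; rewrite //= scale1r !scaler0.
Qed.

Lemma nzloc_is_loc : is_loc scalars nzloc_map.
Proof.
split=> [c|b /pi_eq0[u Su ub]|_ c [s Ss ->]].
- have [a [[s Ss] ->]] := locP c; exists s%:A; first by exists s.
  exists a; rewrite nzloc_scaleE /nzloc_map; apply: loc_eqE => /=.
  by rewrite scale1r.
- by exists u%:A; [exists u|rewrite -scalerAl mul1r].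
- have [a [t ->]] := locP c; rewrite nzloc_scaleE => /pi_eq0[u Su].
  by rewrite scalerA; apply: pi_eq0_scale; exact: rpredM.
Qed.

Variable D : formData R.
Hypothesis HD : invol_form D.
Hypothesis bar_linear : forall c x, bar D (c *: x) = c *: bar D x.

Lemma loc_invol L : invol_form (FormData (bar (loc_form nz D)) (lam (loc_form nz D)) L).
Proof.
have barE x : bar (loc_form nz D) (pi x) = pi (bar D x.1, x.2).
  exact: loc_bar_pi.
split=> [x y|x y|x|x|] /=; rewrite -?[loc_bar _ _]/(bar (loc_form nz D) _).
- have [a [s ->]] := locP x; have [b [t ->]] := locP y.
  by rewrite loc_addE !barE loc_addE /lfrac_add /= (ifD HD) !bar_linear.
- have [a [s ->]] := locP x; have [b [t ->]] := locP y.
  rewrite loc_mulE !barE loc_mulE /lfrac_mul /= (ifM HD); apply: loc_eqE => /=.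
  by rewrite mulrC.
- by have [a [s ->]] := locP x; rewrite !barE /= (ifK HD).
- have [a [s ->]] := locP x; rewrite /loc_map !loc_mulE /lfrac_mul /= (ifC HD).
  by apply: loc_eqE; rewrite /= mul1r mulr1.
- by rewrite /loc_map barE loc_mulE /lfrac_mul /= (ifL HD); apply: loc_eqE; rewrite /= mul1r.
Qed.

Lemma nzloc_form_morph : form_morph D (loc_form nz D) nzloc_map.
Proof. by split=> // x; rewrite /nzloc_map /loc_map /= loc_bar_pi. Qed.

End Localized.

Lemma centralD (P : pzRingType) (x y : P) : central x -> central y -> central (x + y).
Proof. by move=> xc yc z; rewrite mulrDl mulrDr xc yc. Qed.

Lemma centralM (P : pzRingType) (x y : P) : central x -> central y -> central (x * y).
Proof. by move=> xc yc z; rewrite -mulrA yc mulrA xc mulrA. Qed.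

Lemma central0 (P : pzRingType) : central (0 : P).
Proof. by move=> z; rewrite mulr0 mul0r. Qed.

Lemma form_morph_max (P Q : pzRingType) (D : formData P) (E : formData Q)
    (f : {rmorphism P -> Q}) : form_morph D E f ->
  forall a, Lam_max D a -> Lam_max E (f a).
Proof.
move=> fE a ea; rewrite /Lam_max {1}ea rmorphN rmorphM /=.
by rewrite (fm_bar fE) (fm_lam fE).
Qed.

(** * Polynomials in two variables *)

Section TwoVariables.

Variables (k : comNzRingType) (R : algType k) (D : formData R).
Hypothesis HD : invol_form D.
Hypothesis bar_linear : forall c x, bar D (c *: x) = c *: bar D x.

Local Notation A := {poly R}.
Local Notation B := {poly {poly R}}.

Variable L1 : A -> Prop.
Local Notation DA := (polyD D L1).
Hypothesis L1_form : form_parameter DA L1.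

Local Notation D2 L := (polyD DA L).

(* The largest form parameter on R[X][T] all of whose specializations to R[X]
   lie in [L1]. *)
Definition Lam_XT (b : B) := Lam_max (D2 (fun=> True)) b /\
  forall g : {rmorphism B -> A}, form_morph (D2 (fun=> True)) DA g ->
    (forall a, g a%:P%:P = a%:P) -> L1 (g b).

Local Notation DB := (polyD DA Lam_XT).

Lemma DA_invol : invol_form DA. Proof. exact: poly_invol. Qed.
Lemma DB_invol L : invol_form (D2 L). Proof. exact/poly_invol/DA_invol. Qed.

Lemma Lam_XT_form : form_parameter DB Lam_XT.
Proof.
have [mB mm _ mx] := Lam_max_form (DB_invol (fun=> True)); have [LB Lm _ Lx] := L1_form.
split=> [a b [ma ga] [mb gb]|a ma|a []//|x a [ma ga]].
- split; first exact: mB ma mb.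
  by move=> g gf gc; rewrite rmorphB; apply: LB; [exact: ga|exact: gb].
- split; first exact: mm.
  move=> g gf gc; apply: Lm; have [c ->] := ma; exists (g c).
  rewrite rmorphB rmorphM; congr (_ - _ * _); [exact: fm_lam gf|exact: fm_bar gf _].
- split; first exact: (mx x _ ma).
  move=> g gf gc; have := Lx (g x) _ (ga g gf gc).
  by rewrite -(fm_bar gf) !rmorphM.
Qed.

(** A specialization composed with [h] is again a specialization; this is what the quantification
    over all of them in [Lam_XT] is for. *)
Lemma Lam_XT_endo (h : {rmorphism B -> B}) :
  form_morph DB DB h -> (forall a, h a%:P%:P = a%:P%:P) -> forall b, Lam_XT b -> Lam_XT (h b).
Proof.
move=> hf hc b [mb gb]; split; first exact: (form_morph_max hf mb).
move=> g gf gc; apply: (gb (g \o h)) => [|a]; last by rewrite /= hc.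
by split=> [x|] /=; rewrite ?(fm_bar hf) ?(fm_lam hf) /= ?(fm_bar gf) ?(fm_lam gf).
Qed.

Hypothesis L1_stable : forall g : {rmorphism A -> A}, form_morph DA DA g ->
  (forall a, g a%:P = a%:P) -> forall c, L1 c -> L1 (g c).

Lemma polyC_form : form_morph DA DB (@polyC A).
Proof. exact/polyC_form_morph/DA_invol. Qed.

(** A specialization restricted to R[X] is a substitution of R[X], hence the appeal to
    [L1_stable]. *)
Lemma Lam_XT_polyC c : L1 c -> Lam_XT c%:P.
Proof.
move=> Lc; split.
  by apply: (form_morph_max polyC_form); have [_ _ Lx _] := L1_form; exact: Lx.
move=> g gf gc; apply: (L1_stable (g := g \o polyC)) => //.
split=> [x|]; last exact: fm_lam gf.
by have := fm_bar gf x%:P; rewrite /= (bar_polyC DA_invol).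
Qed.

Definition scal (s : k) : B := s%:A%:P%:P.

Lemma scalar_central (s : k) : central (s%:A : R).
Proof. by move=> x; rewrite -scalerAl -scalerAr mul1r mulr1. Qed.

Lemma scal_central s : central (scal s).
Proof. exact/polyC_central/polyC_central/scalar_central. Qed.

Lemma scalM s t : scal (s * t) = scal s * scal t.
Proof. by rewrite /scal -!polyCM -scalerAl mul1r scalerA. Qed.

Lemma scalD s t : scal (s + t) = scal s + scal t.
Proof. by rewrite /scal -!polyCD scalerDl. Qed.

Lemma scal1 : scal 1 = 1. Proof. by rewrite /scal scale1r. Qed.
Lemma scal0 : scal 0 = 0. Proof. by rewrite /scal scale0r. Qed.

Lemma scal_real s : bar DB (scal s) = scal s.
Proof.
have HA := DA_invol.
by rewrite /scal /= (bar_polyC HA) /= (bar_polyC HD) bar_linear (bar1 HD).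
Qed.

Definition polyCC : {rmorphism R -> B} := (@polyC A) \o (@polyC R).

Lemma polyCC_form : form_morph D DB polyCC.
Proof.
split=> // a; rewrite /polyCC /= (bar_polyC DA_invol) /=; congr (_%:P).
by rewrite (bar_polyC HD).
Qed.

(** The inner variable ['X%:P] is X and the outer variable ['X] is T. *)
Definition X_plus s : B := 'X%:P + scal s * 'X.

Lemma X_plus_central s : central (X_plus s).
Proof.
apply: centralD; first exact/polyC_central/polyX_central.
by apply: centralM; [exact: scal_central|exact: polyX_central].
Qed.

Lemma X_plus_real s : bar DB (X_plus s) = X_plus s.
Proof.
have HB := DB_invol Lam_XT; have HA := DA_invol; rewrite /X_plus (ifD HB) (ifM HB) scal_real.
rewrite /= (bar_polyX HA) (bar_polyC HA) /= (bar_polyX HD).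
by rewrite -(scal_central s 'X).
Qed.

Definition shift s : {rmorphism A -> B} :=
  horner_morph (central_comm polyCC (X_plus_central s)).

Lemma shiftC s a : shift s a%:P = a%:P%:P. Proof. exact: horner_morphC. Qed.
Lemma shiftX s : shift s 'X = X_plus s. Proof. exact: horner_morphX. Qed.

Lemma shift_form s : form_morph DA DB (shift s).
Proof. by apply: horner_form_morph;
  [exact: HD|exact: DB_invol|exact: polyCC_form|exact: X_plus_real]. Qed.

Lemma shift0 : shift 0 =1 polyC.
Proof.
by apply: poly_morph_ext => [a|]; rewrite ?shiftC ?shiftX // /X_plus scal0 mul0r addr0.
Qed.

Lemma shift_taylor s x : exists y, shift s x = x%:P + scal s * y.
Proof.
elim/poly_ind: x => [|p a [y IH]]; first by exists 0; rewrite rmorph0 mulr0 addr0.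
exists (p%:P * 'X + y * X_plus s).
rewrite rmorphD rmorphM /= IH shiftX shiftC polyCD polyCM mulrDl.
rewrite {1}/X_plus !mulrDr !mulrA (scal_central s p%:P); zmod.
Qed.

(* X |-> u, T |-> v *)
Definition subst2 u v (uc : central u) (vc : central v) : {rmorphism B -> B} :=
  horner_morph (central_comm (horner_morph (central_comm polyCC uc)) vc).

Section Subst2.
Variables (u v : B) (uc : central u) (vc : central v).
Hypotheses (ur : bar DB u = u) (vr : bar DB v = v).
Local Notation g := (subst2 uc vc).

Lemma subst2C a : g a%:P%:P = a%:P%:P.
Proof. by rewrite [LHS]horner_morphC [LHS]horner_morphC. Qed.
Lemma subst2X : g 'X%:P = u.
Proof. by rewrite [LHS]horner_morphC [LHS]horner_morphX. Qed.
Lemma subst2T : g 'X = v.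
Proof. exact: horner_morphX. Qed.

Lemma subst2_form : form_morph DB DB g.
Proof.
apply: (horner_form_morph Lam_XT vc DA_invol (DB_invol Lam_XT) _ vr).
by apply: horner_form_morph; [exact: HD|exact: DB_invol|exact: polyCC_form|exact: ur].
Qed.

End Subst2.

Local Notation EQB n := (subgroup_gen (@tgen _ DB n (fun=> True) (Lam_long DB))).

Lemma EQB_subst2 n u v (uc : central u) (vc : central v) (M : 'M_(n + n)) :
  bar DB u = u -> bar DB v = v -> EQB n M -> EQB n (map_mx (subst2 uc vc) M).
Proof.
move=> ur vr; have gf := subst2_form uc vc ur vr.
apply: (map_TE gf) => //; apply: (form_morph_long gf).
exact: (Lam_XT_endo gf (subst2C uc vc)).
Qed.

Lemma scalX_central c : central (scal c * 'X).
Proof. exact/centralM/polyX_central/scal_central. Qed.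

Lemma scalX_real c : bar DB (scal c * 'X) = scal c * 'X.
Proof.
have HB := DB_invol Lam_XT; rewrite (ifM HB) scal_real /= (bar_polyX DA_invol).
by rewrite -(scal_central c 'X).
Qed.

(* X |-> X + r T, T |-> c T *)
Definition rescale r c := subst2 (X_plus_central r) (scalX_central c).

Lemma rescale_polyC r c x : rescale r c x%:P = shift r x.
Proof.
apply: (@poly_morph_ext _ _ (rescale r c \o polyC)) => [a|]; rewrite [LHS]/=.
  by rewrite shiftC subst2C.
by rewrite shiftX subst2X.
Qed.

Lemma rescale_shift r c s x : rescale r c (shift s x) = shift (r + s * c) x.
Proof.
apply: (@poly_morph_ext _ _ (rescale r c \o shift s)) => [a|]; rewrite [LHS]/=.
  by rewrite !shiftC subst2C.
rewrite !shiftX {2}/X_plus rmorphD rmorphM subst2X subst2T subst2C.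
by rewrite /X_plus scalD scalM mulrDl !mulrA addrA.
Qed.

Section Descent.

Variables (n : nat) (alpha alpha' : 'M[A]_(n + n)).
Hypotheses (aa' : alpha *m alpha' = 1%:M) (a'a : alpha' *m alpha = 1%:M).

Definition shift_elementary s := EQB n (map_mx (shift s) alpha *m map_mx polyC alpha').

Lemma map_rescale_shift r c s (M : 'M[A]_(n + n)) :
  map_mx (rescale r c) (map_mx (shift s) M) = map_mx (shift (r + s * c)) M.
Proof. by rewrite -map_mx_comp; apply: eq_map_mx => x; exact: rescale_shift. Qed.

Lemma map_rescale_polyC r c (M : 'M[A]_(n + n)) :
  map_mx (rescale r c) (map_mx polyC M) = map_mx (shift r) M.
Proof. by rewrite -map_mx_comp; apply: eq_map_mx => x; exact: rescale_polyC. Qed.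

Lemma shift_elementary0 : shift_elementary 0.
Proof.
rewrite /shift_elementary (eq_map_mx _ shift0) -map_mxM aa' map_mx1; exact: sg_one.
Qed.

(** Both ideal operations come from this one substitution: [r = 0] gives multiples, and [r = s],
    [c = 1] gives sums by telescoping. *)
Lemma shift_elementary_rescale r c s : shift_elementary s ->
  EQB n (map_mx (shift (r + s * c)) alpha *m map_mx (shift r) alpha').
Proof.
move=> /(EQB_subst2 (X_plus_central r) (scalX_central c) (X_plus_real r) (scalX_real c)).
by rewrite map_mxM /= map_rescale_shift map_rescale_polyC.
Qed.

Lemma shift_elementaryM s c : shift_elementary s -> shift_elementary (s * c).
Proof. by move=> /(shift_elementary_rescale 0 c); rewrite add0r (eq_map_mx _ shift0). Qed.

Lemma shift_elementaryD s t : shift_elementary s -> shift_elementary t ->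
  shift_elementary (s + t).
Proof.
move=> gs /(shift_elementary_rescale s 1); rewrite mulr1 => gt; have := sg_mul gt gs.
by rewrite -mulmxA (mulmxA (map_mx (shift s) alpha')) -map_mxM a'a map_mx1 mul1mx.
Qed.

(** X := 0 and T := X, which turns alpha(X + T) alpha(X)^-1 into alpha(X) alpha(0)^-1. *)
Definition specialize : {rmorphism B -> A} := horner_morph (central_comm
  (horner_morph (central_comm (@polyC R) (@central0 A))) (@polyX_central R)).

Lemma specializeC a : specialize a%:P%:P = a%:P.
Proof. by rewrite [LHS]horner_morphC [LHS]horner_morphC. Qed.

Lemma specializeX : specialize 'X%:P = 0.
Proof. by rewrite [LHS]horner_morphC [LHS]horner_morphX. Qed.

Lemma specializeT : specialize 'X = 'X.
Proof. exact: horner_morphX. Qed.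

Lemma specialize_form L : form_morph (D2 L) DA specialize.
Proof.
apply: (horner_form_morph L _ DA_invol DA_invol _ (bar_polyX HD)).
by apply: horner_form_morph; [exact: HD|exact: DA_invol|exact: polyC_form_morph|exact:
  bar0 DA_invol].
Qed.

Lemma specialize_shift x : specialize (shift 1 x) = x.
Proof.
apply: (@poly_morph_ext _ _ (specialize \o shift 1) idfun) => [a|]; rewrite [LHS]/=.
  by rewrite shiftC specializeC.
by rewrite shiftX /X_plus scal1 mul1r rmorphD specializeX specializeT add0r.
Qed.

Lemma specialize_polyC x : specialize x%:P = (x.[0])%:P.
Proof.
elim/poly_ind: x => [|p a IH]; first by rewrite !rmorph0 horner0.
rewrite polyCD polyCM rmorphD rmorphM specializeX specializeC hornerMXaddC.
by rewrite !mulr0 !add0r.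
Qed.

Lemma descent : map_mx (fun p : A => p.[0]) alpha = 1%:M -> shift_elementary 1 ->
  subgroup_gen (tgen DA (fun=> True) (Lam_long DA)) alpha.
Proof.
move=> alpha0 /(map_TE (specialize_form Lam_XT)) H.
have {}H : subgroup_gen (tgen DA (fun=> True) (Lam_long DA))
    (map_mx specialize (map_mx (shift 1) alpha *m map_mx polyC alpha')).
  apply: H => //; apply: (form_morph_long (specialize_form Lam_XT)).
  move=> b [_ Lb]; exact: (Lb _ (specialize_form _) specializeC).
move: H; rewrite map_mxM -!map_mx_comp.
rewrite (eq_map_mx _ specialize_shift) (eq_map_mx _ specialize_polyC).
have -> : map_mx id alpha = alpha by apply/matrixP => i j; rewrite mxE.
suff -> : map_mx (fun x : A => x.[0]%:P) alpha' = 1%:M by rewrite mulmx1.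
have E : forall M : 'M[A]_(n + n), map_mx (fun x : A => x.[0]%:P) M =
    map_mx (specialize \o polyC) M.
  by move=> M; apply: eq_map_mx => x; rewrite /= specialize_polyC.
have a0 : map_mx (specialize \o polyC) alpha = 1%:M.
  have := congr1 (map_mx (@polyC R)) alpha0; rewrite map_mx1 -map_mx_comp => <-.
  by rewrite -E; apply/matrixP => i j; rewrite !mxE.
rewrite E; have := congr1 (map_mx (specialize \o polyC)) a'a.
by rewrite map_mxM a0 mulmx1 map_mx1.
Qed.

End Descent.

End TwoVariables.

(** * From one localization back to R[X][T] *)

Section LocalStep.

Variables (k : comNzRingType) (R : algType k) (D : formData R).
Hypothesis HD : invol_form D.
Hypothesis bar_linear : forall c x, bar D (c *: x) = c *: bar D x.

Local Notation A := {poly R}.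
Local Notation B := {poly {poly R}}.

Variable L1 : A -> Prop.
Local Notation DA := (polyD D L1).
Hypothesis L1_form : form_parameter DA L1.
Hypothesis L1_stable : forall g : {rmorphism A -> A}, form_morph DA DA g ->
  (forall a, g a%:P = a%:P) -> forall c, L1 c -> L1 (g c).
Hypothesis L1_taylor : forall s c, L1 c -> exists2 d, Lam_XT D L1 d &
  shift R (s * s) c = c%:P + scal R (s * s) * d.

Local Notation DB := (polyD DA (Lam_XT D L1)).

Variables (S : mulrClosed k) (nz : (1 : loc R S) != 0).
Local Notation Rm := (nzloc nz).
Local Notation Dm := (loc_form nz D).

Variable L0 : {poly Rm} -> Prop.
Local Notation D0 := (polyD Dm L0).
Local Notation C := {poly {poly Rm}}.
Local Notation DC := (polyD D0 (fun=> True)).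
Hypothesis L0_form : form_parameter D0 L0.
Hypothesis L0_loc : forall c, L0 c -> exists2 s, s \in S &
  exists2 c', L1 c' & map_poly (nzloc_map nz) (s * s)%:A%:P * c =
    map_poly (nzloc_map nz) c'.

Local Notation phi0 := (map_poly (nzloc_map nz)).
Local Notation phi := (map_poly (map_poly (nzloc_map nz))).
Local Notation SB := (poly_const (poly_const (scalars (R := R) S))).

Let HDm : invol_form Dm. Proof. exact: loc_invol. Qed.
Let HD0 : invol_form D0. Proof. exact: poly_invol. Qed.
Let HDC : invol_form DC. Proof. exact: poly_invol. Qed.
Let HDA : invol_form DA. Proof. exact: poly_invol. Qed.
Let HDB : invol_form DB. Proof. exact: poly_invol. Qed.

Let phi0_form : form_morph DA D0 phi0.
Proof. exact/(map_poly_form_morph L1 L0 HD HDm)/nzloc_form_morph. Qed.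

Let phi_form : form_morph DB DC phi.
Proof. exact: map_poly_form_morph. Qed.

Let S0 := scalars_central_mul R S.
Let S1 := poly_central_mul S0.
Let S2 := poly_central_mul S1.

Let phi_loc : is_loc SB phi.
Proof.
apply: (poly_is_loc S1); first exact/poly_map_central/nzloc_map_central.
by apply: (poly_is_loc S0); [exact: nzloc_map_central|exact: nzloc_is_loc].
Qed.

Let phiS_central b : SB b -> central (phi b).
Proof. exact/poly_map_central/poly_map_central/nzloc_map_central. Qed.

Lemma SB_scal b : SB b <-> exists2 s, s \in S & b = scal R s.
Proof.
split=> [[_ [_ [s Ss ->] ->] ->]|[s Ss ->]]; first by exists s.
by exists s%:A%:P => //; exists s%:A => //; exists s.
Qed.

Let SB_real b : SB b -> bar DB b = b.
Proof. by move=> /SB_scal[s _ ->]; exact: scal_real. Qed.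

Let phi_scal_central s : central (phi (scal R s)).
Proof.
rewrite /scal map_polyC /=; apply: polyC_central; rewrite map_polyC /=.
exact/polyC_central/nzloc_map_scalar.
Qed.

Let phi_polyC x : phi x%:P = (phi0 x)%:P.
Proof. by rewrite map_polyC. Qed.

(** The translation is by v^2 T, the form of increment that [L1_taylor] controls. *)
Let uXm v : C := 'X%:P + phi (scal R (v * v)) * 'X.

Let uXmE v : uXm v = phi (X_plus R (v * v)).
Proof.
by rewrite /uXm /X_plus rmorphD rmorphM /= (phi_polyC 'X) !map_polyX.
Qed.

Let uXm_central v : central (uXm v).
Proof.
apply: centralD; first exact/polyC_central/polyX_central.
by apply: centralM; [exact: phi_scal_central|exact: polyX_central].
Qed.

Let ccm : {rmorphism Rm -> C} := (@polyC {poly Rm}) \o (@polyC Rm).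
Let F v : {rmorphism {poly Rm} -> C} := horner_morph (central_comm ccm (uXm_central v)).

Let F_form v : form_morph D0 DC (F v).
Proof.
apply: horner_form_morph => //.
  split=> // x; rewrite /ccm /= (bar_polyC HD0) /=; congr (_%:P).
  by rewrite (bar_polyC HDm).
by rewrite uXmE -(fm_bar phi_form) X_plus_real.
Qed.

Let F_phi0 v x : F v (phi0 x) = phi (shift R (v * v) x).
Proof.
apply: (@poly_morph_ext _ _ (F v \o phi0) (phi \o shift R (v * v))) => [a|] /=.
  by rewrite shiftC !map_polyC /= [LHS]horner_morphC map_polyC.
by rewrite shiftX map_polyX [LHS]horner_morphX uXmE.
Qed.

Let all_short (h : C) : S_short phi SB h.
Proof. by have [s Ss [b e]] := loc_num phi_loc h; exists s => //; exists b. Qed.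

Let phi0_num (h : {poly Rm}) : exists2 w, w \in S &
  exists h', phi0 w%:A%:P * h = phi0 h'.
Proof.
have := poly_is_loc S0 (@nzloc_map_central _ _ _ nz) (nzloc_is_loc nz).
by move=> /loc_num/(_ h)[_ [_ [s Ss ->] ->] [b e]]; exists s => //; exists b.
Qed.

Let F_short h t : SB t -> exists2 s, s \in S &
  forall v, v \in S -> short_arg phi t (F (s * v) h - h%:P).
Proof.
move=> /SB_scal[t0 St ->]; have [w Sw [h' wh]] := phi0_num h.
(* With u = t0 w v, the translation by u^2 T changes the numerator w h by a multiple of u^2.
   Division by the denominator [w] still leaves the required factor [t0]. *)
exists (t0 * w) => [|v Sv]; first exact: rpredM.
have [y yE] := shift_taylor (t0 * w * v * (t0 * w * v)) h'.
exists (scal R (w * v * (t0 * v)) * y).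
have Sbw : SB (scal R w) by apply/SB_scal; exists w.
apply/eqP; rewrite -subr_eq0; apply/eqP; apply: (loc_can phi_loc Sbw).
apply/eqP; rewrite mulrBr subr_eq0; apply/eqP.
have -> : phi (scal R w) * (F (t0 * w * v) h - h%:P) =
    F (t0 * w * v) (phi0 w%:A%:P * h) - (phi0 w%:A%:P * h)%:P.
  rewrite mulrBr rmorphM F_phi0 shiftC polyCM; congr (_ * _ - _ * _).
  by rewrite phi_polyC.
rewrite wh F_phi0 -phi_polyC -rmorphB yE addrC addKr -rmorphM; congr (phi _).
rewrite !mulrA -!scalM; congr (scal R _ * _).
by ring.
Qed.

Let L0_loc_long c : Lam_long D0 c -> exists2 w, w \in S &
  exists2 c', Lam_long DA c' & phi0 (w * w)%:A%:P * c = phi0 c'.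
Proof.
move=> /L0_loc[w Sw [c' Lc' e]]; exists w => //; exists (bar DA (lam DA) * c').
  by rewrite /Lam_long mulrA (ifL HDA) mul1r.
have -> : phi0 (bar DA (lam DA) * c') = bar D0 (lam D0) * phi0 c'.
  by rewrite rmorphM -(fm_lam phi0_form) -(fm_bar phi0_form).
rewrite -e (mulrA (bar D0 _)) (central_lb HD0) -mulrA.
by rewrite (mulrA (bar D0 _)) (lb_l HD0) mul1r.
Qed.

Let taylor_long c u : Lam_long DA c -> exists2 d, Lam_long DB d &
  shift R (u * u) c = c%:P + scal R (u * u) * d.
Proof.
move=> /(L1_taylor u)[d Ld e]; exists (bar DB (lam DB) * d).
  by rewrite /Lam_long mulrA (ifL HDB) mul1r.
have sf := shift_form HD bar_linear L1 (u * u).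
have lE : lam DB * shift R (u * u) c = lam DB * c%:P + scal R (u * u) * d.
  by rewrite -polyCM -e rmorphM; congr (_ * _); rewrite -(fm_lam sf).
have := congr1 ( *%R (bar DB (lam DB))) lE; rewrite mulrDr !(mulrA (bar DB _)).
by rewrite (lb_l HDB) !mul1r => ->; rewrite -(scal_central _ (bar _ _)) -mulrA.
Qed.

Let F_long c t : Lam_long D0 c -> SB t -> exists2 s, s \in S &
  forall v, v \in S -> long_arg DB phi t (F (s * v) c - c%:P).
Proof.
move=> Lc /SB_scal[t0 St ->]; have [w Sw [c' Lc' wc]] := L0_loc_long Lc.
(* The denominator is now w^2, and u^2 / w^2 is t0^2 v^2: the factor t0^2 is the one wanted in a
   long argument, and v^2 keeps [d] long. *)
exists (t0 * w) => [|v Sv]; first exact: rpredM.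
have [d Ld dE] := taylor_long (t0 * w * v) Lc'.
have Lform := Lam_XT_form HD L1_form.
exists (scal R v * scal R v * d).
  apply: (long_scale HDB Lform (S := SB)) => //; last by apply/SB_scal; exists v.
  by move=> s /(cmC S2).
have Sbw : SB (scal R (w * w)) by apply/SB_scal; exists (w * w); rewrite ?rpredM.
apply/eqP; rewrite -subr_eq0; apply/eqP; apply: (loc_can phi_loc Sbw).
apply/eqP; rewrite mulrBr subr_eq0; apply/eqP.
have -> : phi (scal R (w * w)) * (F (t0 * w * v) c - c%:P) =
    F (t0 * w * v) (phi0 (w * w)%:A%:P * c) - (phi0 (w * w)%:A%:P * c)%:P.
  rewrite mulrBr rmorphM F_phi0 shiftC polyCM; congr (_ * _ - _ * _).
  by rewrite phi_polyC.
rewrite wc F_phi0 -phi_polyC -rmorphB dE addrC addKr -rmorphM; congr (phi _).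
rewrite !mulrA -!scalM; congr (scal R _ * _).
by ring.
Qed.

Let iota_long c : Lam_long D0 c -> S_long DB DC phi SB c%:P.
Proof.
move=> Lc; have [w Sw [c' Lc' wc]] := L0_loc_long Lc.
exists (scal R w); first by apply/SB_scal; exists w.
split; first by rewrite /= (bar_polyC HD0) (Lam_long_bar HD0 L0_form Lc) polyCN polyCM.
exists c'%:P; last by rewrite -scalM /scal /= !phi_polyC -wc polyCM.
by rewrite /Lam_long /= -polyCM; exact: (Lam_XT_polyC HD L1_form L1_stable).
Qed.

Variables (n : nat) (alpha alpha' : 'M[A]_(n + n)).
Hypotheses (n3 : (2 < n)%N) (aa' : alpha *m alpha' = 1%:M).

Local Notation EQB := (subgroup_gen (@tgen _ DB n (fun=> True) (Lam_long DB))).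

Let EQB_GL e : EQB e -> is_GL e.
Proof.
apply: sgen_sub; first exact: is_GL_group.
move=> {}e [i j b b' a ij _|i b c Lc]; first exact: tau_bv_GL.
apply: tau_bv_long_GL => //; apply: long_scalar => //.
exact: (Lam_long_bar HDB (Lam_XT_form HD L1_form)).
Qed.

(** The arguments of the generators of E_1 are images of elements of B, so that words lift letter by
    letter. *)
Let Esub1_lift e : Esub DB DC phi (n := n) 1 e -> exists2 e0, EQB e0 & e = map_mx phi e0.
Proof.
apply: (sgen_sub (G := fun e => exists2 e0, EQB e0 & e = map_mx phi e0))
  => [|{}e [i j b b' _ ij [a ->]|i b _ [c Lc ->]]].
- split; first by exists 1%:M; [exact: sg_one|rewrite map_mx1].
    move=> _ _ [e1 E1 ->] [e2 E2 ->]; exists (e1 *m e2); first exact: sg_mul.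
    by rewrite map_mxM.
  move=> _ e' [e1 E1 ->] ee' e'e; have [e2 [e12 e21]] := EQB_GL E1.
  exists e2; first exact: sg_inv E1 e12 e21.
  by apply: (mx_inv_uniq e'e); rewrite -map_mxM e12 map_mx1.
- exists (tau DB (psi_q DB n) (bv B i b) (bv B j b' *m a%:M) 0).
    exact/sg_in/tg_short.
  by rewrite (map_tau_short phi_form) mul1r.
- exists (tau DB (psi_q DB n) (bv B i b) 0 c%:M); first exact/sg_in/tg_long.
  by rewrite (map_tau_long phi_form) !mul1r.
Qed.

Let expanded : subgroup_gen (tgen D0 (fun=> True) (Lam_long D0)) (map_mx phi0 alpha) ->
  exists2 s, s \in S & exists2 e, EQB e &
    map_mx phi (map_mx (shift R s) alpha *m map_mx polyC alpha') = map_mx phi e.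
Proof.
move=> alpha0.
have SB1 : SB 1 := cm1 S2.
have S_mul' (s t : k) : s \in S -> t \in S -> s * t \in S by exact: rpredM.
have [s Ss /(_ 1 (rpred1 _)) [e Ee eE]] := expansion HDB HDC (Lam_XT_form HD L1_form)
  phi_form (cmM S2) (cmC S2) phiS_central SB_real n3 (T := fun s => s \in S)
  (rpred1 S) S_mul' (polyC_form_morph _ HD0) F_form (fun h => all_short h%:P)
  iota_long F_short F_long alpha0 SB1.
exists (s * 1 * (s * 1)); first by rewrite !rpredM ?rpred1.
have [e0 EQe0 e0E] := Esub1_lift Ee; exists e0 => //.
rewrite -e0E map_mxM -!map_mx_comp.
have -> : map_mx (phi \o shift R (s * 1 * (s * 1))) alpha =
  map_mx (F (s * 1)) (map_mx phi0 alpha).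
  by rewrite -map_mx_comp; apply: eq_map_mx => x; rewrite /= -F_phi0.
rewrite eE -mulmxA -map_mx_comp.
have -> : map_mx (polyC \o phi0) alpha = map_mx (phi \o polyC) alpha.
  by apply: eq_map_mx => x; rewrite /= phi_polyC.
by rewrite -(map_mxM (phi \o polyC)) aa' map_mx1 mulmx1.
Qed.

Let T0 : {rmorphism B -> B} := polyC \o coefp 0.

Let T0_form : form_morph DB DB T0.
Proof.
split=> [x|]; rewrite /T0 /=; last by rewrite coefC.
by rewrite (coef_bar HDA) (bar_polyC HDA).
Qed.

Let T0_phi x : phi (T0 x) = ((phi x)`_0)%:P.
Proof. by rewrite /T0 /= phi_polyC coef_map. Qed.

Let coef_theta v x i : (rescale R 0 v x)`_i = (v ^+ i)%:A%:P * x`_i.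
Proof.
elim/poly_ind: x i => [|p a IH] i; first by rewrite rmorph0 !coef0 mulr0.
rewrite rmorphD rmorphM rescale_polyC [rescale _ _ _ 'X]subst2T shift0.
rewrite mulrA coefD coefMX coefC coefD coefMX coefC.
case: i => [|i] /=; first by rewrite !add0r scale1r mul1r.
rewrite !addr0 /scal -[_ * _]scal_central coefCM IH mulrA -polyCM.
by rewrite -scalerAl mul1r scalerA exprS.
Qed.

(* T |-> v T kills the S-torsion polynomials without constant term. *)
Let theta_kill (I : finType) (x : I -> B) :
  (forall i, phi (x i) = 0) -> (forall i, (x i)`_0 = 0) ->
  exists2 v, v \in S & forall i, rescale R 0 v (x i) = 0.
Proof.
move=> phi_x x0.
have /fin_all_exists[f fP] i : exists v, v \in S /\ scal R v * x i = 0.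
  have [_ /SB_scal[v Sv ->] vx] := loc_ker phi_loc (phi_x i).
  by exists v.
(* One [v] for all entries: every coefficient of positive degree acquires at least one factor [v],
   hence each [f i]. *)
exists (\prod_i f i); first by rewrite rpred_prod // => i _; case: (fP i).
move=> i; apply/polyP => -[|j]; rewrite coef_theta coef0 ?x0 ?mulr0 //.
have AM (a b : k) : (a * b)%:A%:P = a%:A%:P * b%:A%:P :> A.
  by rewrite -polyCM -scalerAl mul1r scalerA.
have [_ /polyP/(_ j.+1)] := fP i; rewrite coefCM coef0 => e.
have Pe : \prod_i f i = \prod_(i' | i' != i) f i' * f i.
  by rewrite (bigD1 i) //= mulrC.
by rewrite exprSr {2}Pe mulrA AM -mulrA e mulr0.
Qed.

Let T0_shift s x : T0 (shift R s x) = x%:P.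
Proof.
apply: (@poly_morph_ext _ _ (T0 \o shift R s) polyC) => [a|]; rewrite [LHS]/=.
  by rewrite shiftC /T0 /= coefC.
by rewrite shiftX /X_plus /T0 /= coefD coefMX !coefC /= addr0.
Qed.

Let T0_polyC x : T0 x%:P = x%:P.
Proof. by rewrite /T0 /= coefC. Qed.

Lemma local_shift_elementary :
  subgroup_gen (tgen D0 (fun=> True) (Lam_long D0)) (map_mx phi0 alpha) ->
  exists2 s, s \in S & shift_elementary D L1 alpha alpha' s.
Proof.
move=> /expanded[s Ss [e Ee eE]].
set beta := map_mx (shift R s) alpha *m _ in eE.
have [e' [ee' e'e]] := EQB_GL Ee.
have EQT0 M : EQB M -> EQB (map_mx T0 M).
  apply: (map_TE T0_form) => //; apply: (form_morph_long T0_form).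
  apply: (Lam_XT_endo T0_form) => a; by rewrite /T0 /= coefC.
have T0beta : map_mx T0 beta = 1%:M.
  rewrite map_mxM -!map_mx_comp (eq_map_mx _ (T0_shift s)) (eq_map_mx _ T0_polyC).
  by rewrite -map_mxM aa' map_mx1.
(* The lift is made 1 at T = 0, as [beta] is. Over C the correcting factor is trivial because [e]
   has the same image as [beta]. So [beta] and [e1] differ by torsion without constant term, as
   [theta_kill] demands. *)
pose e1 := e *m map_mx T0 e'.
have EQe1 : EQB e1 by apply: sg_mul => //; apply/EQT0/(sg_inv Ee).
have phiT0 (M : 'M[B]_(n + n)) : map_mx (phi \o T0) M =
  map_mx (polyC \o coefp 0) (map_mx phi M).
  by rewrite -map_mx_comp; apply: eq_map_mx => y; exact: T0_phi.
have phi_e1 : map_mx phi beta = map_mx phi e1.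
  rewrite [RHS]map_mxM -eE -map_mx_comp.
  have T0e : map_mx (phi \o T0) e = 1%:M.
    by rewrite phiT0 -eE -phiT0 map_mx_comp T0beta map_mx1.
  have := map_mxM (phi \o T0) e e'; rewrite T0e ee' map_mx1 mul1mx => <-.
  by rewrite mulmx1.
have T0e1 : map_mx T0 e1 = 1%:M.
  rewrite map_mxM -(map_mx_comp T0 T0) (eq_map_mx T0) => [|y]; last exact: T0_polyC.
  by rewrite -map_mxM ee' map_mx1.
pose x (ij : 'I_(n + n) * 'I_(n + n)) := beta ij.1 ij.2 - e1 ij.1 ij.2.
have [v Sv vx] : exists2 v, v \in S & forall ij, rescale R 0 v (x ij) = 0.
  apply: theta_kill => -[i j] /=.
    rewrite rmorphB; apply/eqP; rewrite subr_eq0; apply/eqP.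
    by have /matrixP/(_ i j) := phi_e1; rewrite !mxE.
  have T0_coef (M M' : 'M[B]_(n + n)) :
      map_mx T0 M = map_mx T0 M' -> (M i j)`_0 = (M' i j)`_0.
    by move=> /matrixP/(_ i j); rewrite !mxE => /polyC_inj.
  by rewrite coefB (T0_coef _ _ (etrans T0beta (esym T0e1))) subrr.
exists (s * v); first exact: rpredM.
have E : map_mx (rescale R 0 v) beta = map_mx (rescale R 0 v) e1.
  apply/matrixP => i j; rewrite [LHS]mxE [RHS]mxE.
  apply/eqP; rewrite -subr_eq0 -rmorphB; exact/eqP/(vx (i, j)).
rewrite /shift_elementary -(eq_map_mx _ (@shift0 _ R)) -[s * v]add0r.
rewrite -(map_rescale_shift 0 v s) -(map_rescale_polyC 0 v) -map_mxM -/beta E.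
exact: (EQB_subst2 HD (X_plus_central 0) (scalX_central v) (X_plus_real HD bar_linear L1 0)
  (scalX_real HD bar_linear L1 v)).
Qed.

End LocalStep.

(** * The local-global principle *)

Lemma ideal_in_maximal (k : comNzRingType) (I : k -> Prop) :
  I 0 -> ~ I 1 -> (forall a u v, I u -> I v -> I (a * u + v)) ->
  exists m : maxideal k, forall x, I x -> x \in maxideal_pred m.
Proof.
move=> I0 I1 IM.
pose ideal (J : set k) := [/\ (forall x, I x -> J x), ~ J 1
  & forall a u v, J u -> J v -> J (a * u + v)].
have [|M [MP Mmax]] := @Zorn_bigcup k (fun J : set k => J = set0 \/ ideal J).
  move=> F FP Ftot.
  have [[J0 [FJ0 J0i]]|noJ] := pselect (exists J, F J /\ ideal J); last first.
    left; apply/seteqP; split=> x //= [J FJ Jx]; have [J0|Ji] := FP _ FJ.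
      by move: Jx; rewrite J0.
    by case: noJ; exists J.
  right; split=> [x Ix|[J FJ J1]|a u v [J FJ Ju] [J' FJ' Jv]].
  - by exists J0 => //; case: J0i => + _ _; apply.
  - by have [J0'|[_ + _]] := FP _ FJ; [move: J1; rewrite J0'|apply].
  - have mem (X : set k) : F X -> X u -> X v -> (\bigcup_(Y in F) Y)%classic (a * u + v).
      move=> FX Xu Xv; exists X => //; have [X0|[_ _]] := FP _ FX; last by apply.
      by move: Xu; rewrite X0.
    have [JJ'|J'J] := Ftot _ _ FJ FJ'; first by apply: (mem J') => //; exact: JJ'.
    by apply: (mem J) => //; exact: J'J.
have Mi : ideal M.
  case: MP => // M0; case: (Mmax I); last by right.
  by rewrite M0; split=> // /(_ 0 I0).
have [IsubM M1 MM] := Mi.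
pose m : {pred k} := [pred x | `[< M x >]].
have mE x : (x \in m) = `[< M x >] by [].
have m_ideal : idealr_closed m.
  split; first by rewrite mE; apply/asboolP/IsubM.
    by rewrite mE; apply/asboolP.
  by move=> a u v; rewrite !mE => /asboolP Mu /asboolP Mv; apply/asboolP/MM.
have m_max : maximal_ideal m.
  split=> // J [J0 J1 JM] mJ x Jx; rewrite mE; apply/asboolP.
  apply: contrapT => Mx; case: (Mmax (fun x : k => x \in J)); last first.
    right; split=> [y Iy||a u v] /=.
    - by apply: mJ; rewrite mE; apply/asboolP/IsubM.
    - exact/negP.
    - exact: JM.
  split=> [y My|JM']; last exact/Mx/JM'.
  by apply: mJ; rewrite mE; apply/asboolP.
by exists (MaxIdeal m_max) => x Ix; rewrite /= mE; apply/asboolP/IsubM.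
Qed.

Section LocalGlobal.

Variables (k : comNzRingType) (R : algType k) (D : formData R).
Hypothesis HD : invol_form D.
Hypothesis bar_linear : forall c x, bar D (c *: x) = c *: bar D x.

Local Notation A := {poly R}.

Variable L1 : A -> Prop.
Local Notation DA := (polyD D L1).
Hypothesis L1_form : form_parameter DA L1.
Hypothesis L1_stable : forall g : {rmorphism A -> A}, form_morph DA DA g ->
  (forall a, g a%:P = a%:P) -> forall c, L1 c -> L1 (g c).
Hypothesis L1_taylor : forall s c, L1 c -> exists2 d, Lam_XT D L1 d &
  shift R (s * s) c = c%:P + scal R (s * s) * d.

Variable L0 : forall (m : maxideal k) (nz : (1 : loc_at R m) != 0), {poly nzloc nz} -> Prop.
Arguments L0 {m}.
Local Notation D0 nz := (polyD (loc_form nz D) (L0 nz)).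
Hypothesis L0_form : forall m (nz : (1 : loc_at R m) != 0), form_parameter (D0 nz) (L0 nz).
Hypothesis L0_loc : forall m (nz : (1 : loc_at R m) != 0) c, L0 nz c ->
  exists2 s, s \in compl_maxideal m &
  exists2 c', L1 c' & map_poly (nzloc_map nz) (s * s)%:A%:P * c =
    map_poly (nzloc_map nz) c'.

Theorem local_global n (alpha : 'M[A]_(n + n)) : (2 < n)%N -> is_GL alpha ->
  map_mx (fun p : A => p.[0]) alpha = 1%:M ->
  (forall m (nz : (1 : loc_at R m) != 0), EQ (D0 nz) (map_mx (poly_loc nz) alpha)) ->
  EQ DA alpha.
Proof.
move=> n3 [alpha' [aa' a'a]] alpha0 alpha_loc.
have HDA : invol_form DA by exact: poly_invol.
apply/(EQ_tgen HDA L1_form); apply: (descent HD a'a alpha0).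
apply: contrapT => not1; pose I := shift_elementary D L1 alpha alpha'.
have IM a u v : I u -> I v -> I (a * u + v).
  by move=> gu gv; rewrite mulrC; apply: (shift_elementaryD HD bar_linear a'a) => //;
    exact: shift_elementaryM.
have [m Im] := ideal_in_maximal (shift_elementary0 D L1 aa') not1 IM.
suff [s sm gs] : exists2 s, s \in compl_maxideal m & I s.
  by move: sm; rewrite inE /= (Im s gs).
have [loc0|nz] := eqVneq (1 : loc_at R m) 0; last first.
  have HDm : invol_form (D0 nz) by exact/poly_invol/loc_invol.
  apply: (local_shift_elementary HD bar_linear L1_form L1_stable L1_taylor (L0_form nz)
    (@L0_loc _ nz) n3 aa').
  exact/(EQ_tgen HDm (L0_form nz))/alpha_loc.
(* If R_m is zero, some [u] outside [m] kills R, and translation by u T is no translation. *)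
have /eqP/loc_eqP[u Su /= e] := loc0; exists u => //.
suff -> : I u = I 0 by exact: shift_elementary0.
rewrite /I /shift_elementary; congr (subgroup_gen _ (_ *m _)); apply: eq_map_mx.
apply: poly_morph_ext => [a|]; first by rewrite !shiftC.
have u0 : u%:A = 0 :> R by rewrite -[1]scale1r e !scaler0.
by rewrite !shiftX /X_plus scal0 /scal u0 !polyC0.
Qed.

End LocalGlobal.

Lemma form_ring_invol (P : pzRingType) (D : formData P) : form_ring D -> invol_form D.
Proof. by move=> [[bD bM bK] lC lL _]. Qed.

Section Generated.

Variables (P : pzRingType) (D : formData P) (X : P -> Prop).
Hypothesis HD : invol_form D.
Hypothesis X_max : forall x, X x -> Lam_max D x.

Lemma form_parameter_gen_form : form_parameter D (form_parameter_gen D X).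
Proof.
split=> [a b ga gb L LF XL|a ma L [_ Lm _ _] XL|a ga|x a ga L LF XL].
- by case: (LF) => LB _ _ _; exact: LB (ga L LF XL) (gb L LF XL).
- exact: Lm.
- exact: (ga _ (Lam_max_form HD) X_max).
- by case: (LF) => _ _ _ Lx; exact: Lx (ga L LF XL).
Qed.

Lemma form_parameter_gen_in x : X x -> form_parameter_gen D X x.
Proof. by move=> Xx L _; apply. Qed.

End Generated.

(** The preimage is cut down to [Lam_max D], which [f] need not reflect. Used to send a generated
    parameter into [L] by looking at its generators only. *)
Lemma form_parameter_preim (P Q : pzRingType) (D : formData P) (E : formData Q)
    (f : {rmorphism P -> Q}) L : invol_form D -> form_morph D E f -> form_parameter E L ->
  form_parameter D (fun x => Lam_max D x /\ L (f x)).
Proof.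
move=> HD fE [LB Lm _ Lx]; have [MB Mm _ Mx] := Lam_max_form HD.
split=> [a b [ma La] [mb Lb]|a ma|a []//|x a [ma La]].
- by split; [exact: MB|rewrite rmorphB; exact: LB].
- split; first exact: Mm.
  apply: Lm; have [c ->] := ma; exists (f c).
  by rewrite rmorphB rmorphM (fm_bar fE) (fm_lam fE).
- by split; [exact: Mx|rewrite !rmorphM /= (fm_bar fE); exact: Lx].
Qed.

(** * The largest and the generated form parameter on R[X] *)

Section Instances.

Variables (k : comNzRingType) (R : algType k) (D : formData R).
Hypothesis HD : invol_form D.
Hypothesis bar_linear : forall c x, bar D (c *: x) = c *: bar D x.

Local Notation A := {poly R}.
Local Notation B := {poly {poly R}}.

Section MaxInstance.

Definition Lam_max_poly (P : nzRingType) (E : formData P) : {poly P} -> Prop :=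
  Lam_max (polyD E (fun=> True)).

Local Notation DA := (polyD D (Lam_max_poly D)).

Lemma Lam_max_poly_form (P : nzRingType) (E : formData P) : invol_form E ->
  form_parameter (polyD E (Lam_max_poly E)) (Lam_max_poly E).
Proof. by move=> HE; exact/Lam_max_form/poly_invol. Qed.

Lemma Lam_max_poly_stable (g : {rmorphism A -> A}) : form_morph DA DA g ->
  (forall a, g a%:P = a%:P) -> forall c, Lam_max_poly D c -> Lam_max_poly D (g c).
Proof. by move=> gf _ c; exact: (form_morph_max gf). Qed.

Lemma Lam_max_poly_coef (P : nzRingType) (E : formData P) p : invol_form E ->
  Lam_max_poly E p <-> forall i, Lam_max E p`_i.
Proof.
move=> HE; split=> [mp i|mp].
  by rewrite /Lam_max {1}mp /= coefN coefCM coef_bar.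
by apply/polyP => i; rewrite /= coefN coefCM coef_bar // -mp.
Qed.

Lemma Lam_max_central (P : pzRingType) (E : formData P) z c : invol_form E ->
  central z -> bar E z = z -> Lam_max E c -> Lam_max E (c * z).
Proof.
by move=> HE zc zr mc; rewrite /Lam_max {1}mc (ifM HE) zr mulNr zc mulrA.
Qed.

(** Form morphisms preserve [Lam_max], so the condition on specializations in [Lam_XT] is automatic.
    The quotient stays in [Lam_max] because X + s^2 T and T are central and fixed by the
    involution. *)
Lemma Lam_max_poly_taylor s c : Lam_max_poly D c -> exists2 d, Lam_XT D (Lam_max_poly D) d &
  shift R (s * s) c = c%:P + scal R (s * s) * d.
Proof.
have HDA : invol_form DA by exact: poly_invol.
have HDB L : invol_form (polyD DA L) by exact: poly_invol.
move=> mc; suff [d md ->] : exists2 d, Lam_max (polyD DA (fun=> True)) d &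
    shift R (s * s) c = c%:P + scal R (s * s) * d.
  by exists d => //; split=> // g gf _; exact: (form_morph_max gf).
elim/poly_ind: c mc => [|p a IH] /Lam_max_poly_coef mc.
  exists 0; first by rewrite /Lam_max (bar0 (HDB _)) mulr0 oppr0.
  by rewrite rmorph0 mulr0 addr0.
have {}mc := mc HD.
have mp : Lam_max_poly D p.
  apply/Lam_max_poly_coef => // i; have := mc i.+1.
  by rewrite coefD coefMX coefC /= addr0.
have [d md e] := IH mp.
exists (d * X_plus R (s * s) + p%:P * 'X); last first.
  rewrite rmorphD rmorphM /= e shiftX shiftC polyCD polyCM mulrDl {1}/X_plus.
  by rewrite !mulrDr !mulrA (scal_central (s * s) p%:P); zmod.
apply: (form_parameterD (HDB _) (Lam_max_form (HDB _))).
  apply: Lam_max_central => //;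
    [exact: X_plus_central|exact: (X_plus_real HD bar_linear (fun=> True))].
apply: Lam_max_central => //; [exact: polyX_central|exact: (bar_polyX HDA)|].
exact: (form_morph_max (polyC_form_morph _ HDA)).
Qed.

Lemma Lam_max_poly_loc (S : mulrClosed k) (nz : (1 : loc R S) != 0) c :
  Lam_max_poly (loc_form nz D) c -> exists2 s, s \in S &
  exists2 c', Lam_max_poly D c' & map_poly (nzloc_map nz) (s * s)%:A%:P * c =
    map_poly (nzloc_map nz) c'.
Proof.
pose phi : {rmorphism A -> {poly nzloc nz}} := map_poly (nzloc_map nz).
move=> mc; change (exists2 s, s \in S & exists2 c', Lam_max_poly D c' & phi (s * s)%:A%:P
  * c = phi c').
have HDA : invol_form DA by exact: poly_invol.
have HDm : invol_form (loc_form nz D) by exact: loc_invol.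
have phi_form : form_morph DA (polyD (loc_form nz D) (Lam_max_poly (loc_form nz D))) phi.
  exact/(map_poly_form_morph _ _ HD HDm)/nzloc_form_morph.
have S1 := poly_central_mul (scalars_central_mul R S).
have phi_loc := poly_is_loc (scalars_central_mul R S) (@nzloc_map_central _ _ _ nz)
  (nzloc_is_loc nz).
have [_ [_ [s Ss ->] ->] [b sb]] := loc_num phi_loc c.
have realS (u : k) : bar DA u%:A%:P = u%:A%:P.
  by rewrite /= (bar_polyC HD) bar_linear (bar1 HD).
have cenS (u : k) : central (u%:A%:P : A) by exact/polyC_central/scalar_central.
have HD0 := poly_invol (Lam_max_poly (loc_form nz D)) HDm.
pose sc (u : k) : A := u%:A%:P.
have scM u v : sc (u * v) = sc u * sc v by rewrite /sc -polyCM -scalerAl mul1r scalerA.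
have phi_sc : central (phi (sc s)).
  by rewrite /phi /= map_polyC; exact/polyC_central/nzloc_map_scalar.
(* The numerator [b] satisfies the equation of [Lam_max] only up to torsion, which a further factor
   [v] kills. *)
have mb : phi (b + lam DA * bar DA b) = 0.
  rewrite rmorphD rmorphM (fm_lam phi_form) (fm_bar phi_form).
  have -> : phi b = phi (sc s) * c by [].
  rewrite (ifM HD0) -(fm_bar phi_form) realS -phi_sc mulrA.
  by rewrite (ifC HD0) -mulrA -mulrDr {1}mc addNr mulr0.
have [_ [_ [v Sv ->] ->] vb] := loc_ker phi_loc mb.
exists (s * v); first exact: rpredM.
(* One [v] kills the torsion; the second makes the total denominator the square of [s * v]. *)
exists (sc (s * v * v) * b); last first.
  have bE : phi b = phi (sc s) * c by [].
  rewrite [RHS]rmorphM bE [RHS]mulrA -rmorphM -scM.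
  by rewrite -/(sc _); congr (phi (sc _) * c); ring.
apply/eqP; rewrite -addr_eq0; apply/eqP;
  rewrite -/(bar DA _) (ifM HDA) realS -(cenS _ (bar DA b)).
rewrite mulrA -(cenS _ (lam DA)) -[_ * lam DA * _]mulrA -mulrDr.
by rewrite -/(sc _) scM -(mulrA (sc _)) vb mulr0.
Qed.

Theorem EQ_local_global_max n (alpha : 'M[A]_(n + n)) : (2 < n)%N -> is_GL alpha ->
  map_mx (fun p : A => p.[0]) alpha = 1%:M ->
  (forall (m : maxideal k) (nz : (1 : loc_at R m) != 0),
    EQ (polyD (loc_form nz D) (Lam_max_poly (loc_form nz D))) (map_mx (poly_loc nz) alpha)) ->
  EQ DA alpha.
Proof.
apply: (local_global HD bar_linear (Lam_max_poly_form HD) Lam_max_poly_stable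
  Lam_max_poly_taylor).
- by move=> m nz; apply/Lam_max_poly_form/loc_invol.
- by move=> m nz c; exact: Lam_max_poly_loc.
Qed.

End MaxInstance.

Section GeneratedInstance.

Hypothesis HL : form_parameter D (Lam D).

Lemma poly_form_parameter (P : nzRingType) (E : formData P) : invol_form E ->
  form_parameter E (Lam E) -> form_parameter (poly_form E) (Lam (poly_form E)).
Proof.
move=> HE [_ _ Lx _]; apply: (form_parameter_gen_form (poly_invol (fun=> True) HE)) =>
  _ [a /Lx ma ->].
exact: (form_morph_max (polyC_form_morph (fun=> True) HE)).
Qed.

Lemma loc_form_parameter (S : mulrClosed k) (nz : (1 : loc R S) != 0) :
  form_parameter (loc_form nz D) (Lam (loc_form nz D)).
Proof.
have HDm : invol_form (loc_form nz D) by exact: loc_invol.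
have [_ _ Lx _] := HL; apply: (form_parameter_gen_form HDm) => _ [a /Lx ma ->].
exact: (form_morph_max (nzloc_form_morph nz bar_linear)).
Qed.

Local Notation L1 := (Lam (poly_form D)).
Local Notation DA := (polyD D L1).
Local Notation DB := (polyD DA (Lam_XT D L1)).

Lemma gen_stable (g : {rmorphism A -> A}) : form_morph DA DA g ->
  (forall a, g a%:P = a%:P) -> forall c, L1 c -> L1 (g c).
Proof.
move=> gf gc c Lc; have HDA := poly_invol L1 HD.
have L1_form := poly_form_parameter HD HL.
suff [] : Lam_max DA c /\ L1 (g c) by [].
apply: (Lc _ (form_parameter_preim HDA gf L1_form)) => _ [a La ->].
have L1a : L1 a%:P by apply: form_parameter_gen_in; exists a.
by split; [case: L1_form => _ _ Lx _; exact: Lx|rewrite gc].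
Qed.

(** By minimality of the generated parameter: the elements of [L1] that satisfy the formula make up
    a form parameter that contains the constants from [Lam D]. *)
Lemma gen_taylor s c : L1 c -> exists2 d, Lam_XT D L1 d &
  shift R (s * s) c = c%:P + scal R (s * s) * d.
Proof.
have HDA := poly_invol L1 HD; have L1_form := poly_form_parameter HD HL.
have L2F := Lam_XT_form HD L1_form; have HDB := poly_invol (Lam_XT D L1) HDA.
pose Q c := L1 c /\ exists2 d, Lam_XT D L1 d & shift R (s * s) c = c%:P + scal R (s * s) * d.
have [L2B L2m L2x L2c] := L2F; have [L1B L1m L1x L1c] := L1_form.
have L2P := Lam_XT_polyC HD L1_form gen_stable.
have sf := shift_form HD bar_linear L1 (s * s).
have bar_polyCB x : (bar DA x)%:P = bar DB x%:P by rewrite /= (bar_polyC HDA).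
suff QF : form_parameter DA Q.
  move=> Lc; case: (Lc _ QF) => // _ [a La ->]; split.
    by apply: form_parameter_gen_in; exists a.
  exists 0; last by rewrite shiftC mulr0 addr0.
  by apply: L2m; exists 0; rewrite (bar0 HDB) mulr0 subr0.
split=> [a b [La [d Ld ad]] [Lb [e Le be]]|_ [x ->]|a [La _]|x a [La [d Ld ad]]].
- split; first exact: L1B.
  exists (d - e); first exact: L2B.
  by rewrite rmorphB ad be polyCB mulrBr; zmod.
- split; first by apply: L1m; exists x.
  have [y yE] := shift_taylor (s * s) x.
  exists (y - lam DB * bar DB y); first by apply: L2m; exists y.
  rewrite rmorphB rmorphM (fm_lam sf) (fm_bar sf) yE (ifD HDB) (ifM HDB) scal_real //.
  rewrite -(scal_central _ (bar DB y)) polyCB polyCM (bar_polyCB x).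
  rewrite !mulrDr mulrN !mulrA -(scal_central _ (lam DB)); zmod.
- exact: L1x.
- split; first exact: L1c.
  have [y yE] := shift_taylor (s * s) x.
  pose z := shift R (s * s) x; pose X := x%:P : B; pose c0 := a%:P : B.
  have L2c0 : Lam_XT D L1 c0 by exact: L2P.
  (* Expansion of bar z (a + s^2 d) z with z = x + s^2 y. The cross terms make up an element c -
     lambda bar c, and the term in s^4, divided by s^2, is the conjugate of [a] by s y: here the
     increment has to be a square. *)
  exists (bar DB z * d * z + (bar DB y * c0 * X + bar DB X * c0 * y)
      + bar DB (scal R s * y) * c0 * (scal R s * y)).
    apply: (form_parameterD HDB L2F); last exact: L2c.
    apply: (form_parameterD HDB L2F); first exact: L2c.
    suff -> : bar DB X * c0 * y = - (lam DB * bar DB (bar DB y * c0 * X)).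
      by apply: L2m; exists (bar DB y * c0 * X).
    have {1}-> : c0 = - (lam DB * bar DB c0) by exact: L2x.
    by rewrite !(ifM HDB) (ifK HDB) mulrN mulNr !mulrA (ifC HDB).
  pose r := scal R (s * s); have rC u v : u * (r * v) = r * (u * v).
    by rewrite !mulrA (scal_central (s * s) u).
  have zE : bar DB z = bar DB X + r * bar DB y.
    by rewrite /z yE (ifD HDB) (ifM HDB) scal_real // (scal_central (s * s)).
  have -> : shift R (s * s) (bar DA x * a * x) = bar DB z * (c0 + r * d) * z.
    by rewrite !rmorphM (fm_bar sf) ad.
  have -> : (bar DA x * a * x)%:P = bar DB X * c0 * X.
    by rewrite !polyCM (bar_polyCB x).
  have -> : bar DB (scal R s * y) * c0 * (scal R s * y) = r * (bar DB y * c0 * y).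
    have sC u v : u * (scal R s * v) = scal R s * (u * v).
      by rewrite !mulrA (scal_central s u).
    by rewrite (ifM HDB) scal_real // /r scalM -!mulrA (sC c0) !(sC (bar DB y)).
  rewrite mulrDr mulrDl !mulrDr -(mulrA (bar DB z) (r * d)) -!(mulrA r) (rC (bar DB z)).
  rewrite !(mulrA (bar DB z)) {1}zE {1}/z yE -/X -/r.
  rewrite !mulrDl !mulrDr -!mulrA !(rC c0) !(rC (bar DB X)) !(rC (bar DB y)).
  by zmod.
Qed.

(** Minimality is used twice: on R_m[X] for the set [Q] of elements with a square denominator, and
    on R_m for the preimage of [Q] under [polyC]. *)
Lemma gen_loc (S : mulrClosed k) (nz : (1 : loc R S) != 0) c :
  Lam (poly_form (loc_form nz D)) c -> exists2 s, s \in S &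
  exists2 c', L1 c' & map_poly (nzloc_map nz) (s * s)%:A%:P * c =
    map_poly (nzloc_map nz) c'.
Proof.
have HDA := poly_invol L1 HD; have L1F := poly_form_parameter HD HL.
have HDm : invol_form (loc_form nz D) by exact: loc_invol.
pose L0 := Lam (poly_form (loc_form nz D)); pose D0 := polyD (loc_form nz D) L0.
have HD0 : invol_form D0 by exact: poly_invol.
pose phi : {rmorphism A -> {poly nzloc nz}} := map_poly (nzloc_map nz).
have phi_form : form_morph DA D0 phi.
  exact/(map_poly_form_morph _ _ HD HDm)/nzloc_form_morph.
have S1 := poly_central_mul (scalars_central_mul R S).
have phi_loc := poly_is_loc (scalars_central_mul R S) (@nzloc_map_central _ _ _ nz)
  (nzloc_is_loc nz).
pose sc (u : k) : A := u%:A%:P.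
have scM u v : sc (u * v) = sc u * sc v by rewrite /sc -polyCM -scalerAl mul1r scalerA.
have phiM u v : phi (sc u) * phi (sc v) = phi (sc (u * v)) by rewrite scM rmorphM.
have phi_sc u : central (phi (sc u)).
  by rewrite /phi /= map_polyC; exact/polyC_central/nzloc_map_scalar.
have sc_c u : central (sc u) by exact/polyC_central/scalar_central.
have realS (u : k) : bar DA (sc u) = sc u.
  by rewrite /= (bar_polyC HD) bar_linear (bar1 HD).
have [L1B L1m L1x L1c] := L1F; have [MB Mm Mx Mc] := Lam_max_form HD0.
pose Q x := Lam_max D0 x /\ exists2 s, s \in S & exists2 c', L1 c' & phi (sc (s * s)) * x
  = phi c'.
have L1s u x : L1 x -> L1 (sc (u * u) * x).
  by move=> /(L1c (sc u)); rewrite realS -mulrA -(sc_c u x) mulrA -scM.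
have QF : form_parameter D0 Q.
  split=> [a b [ma [s Ss [a' La' ea]]] [mb [t St [b' Lb' eb]]]|a ma|a []//|x a [ma [s Ss
    [a' La' ea]]]].
  - split; first exact: MB.
    exists (s * t); first exact: rpredM.
    exists (sc (t * t) * a' - sc (s * s) * b'); first by apply: L1B; exact: L1s.
    rewrite rmorphB !rmorphM -ea -eb mulrBr !mulrA !phiM.
    by congr (phi (sc _) * _ - phi (sc _) * _); ring.
  - split; first exact: Mm.
    have [x ->] := ma; have [_ [_ [s Ss ->] ->] [b sb]] := loc_num phi_loc x.
    have bE : phi b = phi (sc s) * x by [].
    exists s => //; exists (sc s * (b - lam DA * bar DA b)).
      rewrite mulrBr mulrA (sc_c s (lam DA)) -mulrA; apply: L1m.
      by exists (sc s * b); rewrite (ifM HDA) realS -(sc_c s (bar DA b)).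
    rewrite rmorphM rmorphB rmorphM (fm_lam phi_form) (fm_bar phi_form) bE (ifM HD0).
    rewrite -(fm_bar phi_form) realS -(phi_sc s (bar D0 x)) mulrA -(phi_sc s (lam D0)).
    by rewrite -mulrA -mulrBr mulrA phiM.
  - split; first exact: Mc.
    have [_ [_ [t St ->] ->] [y ty]] := loc_num phi_loc x.
    have yE : phi y = phi (sc t) * x by [].
    exists (s * t); first exact: rpredM.
    exists (bar DA y * a' * y); first exact: L1c.
    rewrite !rmorphM -ea (fm_bar phi_form) yE (ifM HD0) -(fm_bar phi_form) realS.
    have pC u v w : v * (phi (sc u) * w) = phi (sc u) * (v * w).
      by rewrite !mulrA (phi_sc u).
    rewrite -!mulrA (pC _ a) !(pC _ (bar D0 x)).
    move: (bar D0 x * (a * x)) => u; rewrite !mulrA !phiM.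
    by congr (phi (sc _) * _); ring.
suff constQ x : Lam (loc_form nz D) x -> Q x%:P.
  by move=> /(_ Q QF)[_ [x /constQ Qx ->]//|_].
move=> Lx.
have pf := polyC_form_morph L0 HDm.
suff [] : Lam_max (loc_form nz D) x /\ Q x%:P by [].
apply: (Lx _ (form_parameter_preim HDm pf QF)) => _ [a La ->].
have [_ _ Dx _] := HL.
have La' : Lam_max (loc_form nz D) (nzloc_map nz a).
  exact: (form_morph_max (nzloc_form_morph nz bar_linear) (Dx _ La)).
split=> //; split; first exact: (form_morph_max pf).
exists 1; first exact: rpred1.
exists a%:P; first by apply: form_parameter_gen_in; exists a.
by rewrite mulr1 /sc scale1r rmorph1 mul1r /phi /= map_polyC.
Qed.

Theorem EQ_local_global n (alpha : 'M[A]_(n + n)) : (2 < n)%N -> is_GL alpha ->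
  map_mx (fun p : A => p.[0]) alpha = 1%:M ->
  (forall (m : maxideal k) (nz : (1 : loc_at R m) != 0),
    EQ (poly_form (loc_form nz D)) (map_mx (poly_loc nz) alpha)) ->
  EQ (poly_form D) alpha.
Proof.
apply: (local_global HD bar_linear (poly_form_parameter HD HL) gen_stable gen_taylor
  (L0 := fun m nz => Lam (poly_form (loc_form nz D)))).
- by move=> m nz; apply: poly_form_parameter; [exact: loc_invol|exact: loc_form_parameter].
- by move=> m nz c; exact: gen_loc.
Qed.

End GeneratedInstance.

End Instances.

(** * The Hermitian case *)

Section PlaneGeneration.

Variables (P : pzRingType) (D : formData P) (n : nat).
Hypothesis HD : invol_form D.
Variables (G : 'M[P]_(n + n) -> Prop) (SL : P -> Prop) (k0 : 'I_n).
Hypothesis G_grp : mx_group G.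
Hypothesis SL_bar : forall c, SL c -> bar D c = - (lam D * c).

Local Notation tauq := (tau D (psi_q D n)).
Local Notation bv := (bv P).

Hypothesis G_short : forall b j b' a, k0 != j ->
  G (tauq (bv k0 b) (bv j b' *m a%:M) 0).
Hypothesis G_long : forall b c, SL c -> G (tauq (bv k0 b) 0 c%:M).

(** Generators away from [k0] arise through that plane, by [short_mem] and [long_mem]. In the
    Hermitian case [k0] is a plane beyond [r], which the change of basis fixes. *)
Lemma plane_generation M : tgen D (fun=> True) SL M -> G M.
Proof.
have G_short' b j b' (a : 'M_1) : k0 != j -> G (tauq (bv k0 b) (bv j b' *m a) 0).
  by rewrite (mx11_scalar a); exact: G_short.
have lE q b : - (lam D *: bv q b) = bv q b *m - (lam D *: 1%:M) :> 'cV_(n + n).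
  by rewrite mulmxN mulmx_l // mulmx1.
have G_skew p bp b (a : 'M_1) : k0 != p -> G (tauq (bv p bp) (bv k0 b *m a) 0).
  move=> kp; rewrite tau_skew // tau_mulr // mulmx0 mul0mx lE -mulmxA.
  exact: G_short'.
move=> [p q bp bq a pq _|p bp c Lc].
  have [pk|pk] := eqVneq k0 p; first by rewrite -pk in pq *; exact: G_short.
  have [qk|qk] := eqVneq k0 q; first by rewrite -qk; exact: G_skew.
  rewrite -[a%:M]mulmx1; apply: (short_mem HD G_grp (r := k0) pq).
  - by rewrite eq_sym.
  - by rewrite eq_sym.
  - exact: G_skew.
  - exact: G_short'.
have [pk|pk] := eqVneq k0 p; first by rewrite -pk; exact: G_long.
have pk' : p != k0 by rewrite eq_sym.
have cE : conj_mx D c%:M = - (lam D *: c%:M) :> 'M_1.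
  by rewrite (conj_scalar_mx HD) SL_bar // scale_scalar_mx raddfN.
have -> : c%:M = 1%:M *m c%:M *m conj_mx D 1%:M :> 'M_1.
  by rewrite (conj_mx1 HD) mul1mx mulmx1.
apply: (long_mem HD G_grp pk' cE); first exact: G_skew.
- exact: G_long.
- exact: G_short'.
Qed.

End PlaneGeneration.

Section WideTransvections.

Variables (P : pzRingType) (D : formData P) (N : nat) (psi : 'M[P]_N).
Hypothesis HD : invol_form D.
Hypothesis psi_herm : conj_mx D psi = bar D (lam D) *: psi.
Variables (G : 'M[P]_N -> Prop) (v : 'cV[P]_N).
Hypotheses (G_grp : mx_group G) (vv : sharp D psi v *m v = 0).

(* Some, hence (given the long ones) every, transvection along [v] with middle
   term [w] lies in [G]; this is additive in [w]. *)
Definition wide w := sharp D psi v *m w = 0 /\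
  exists c, tau_cond D psi w c /\ G (tau D psi v w c).

Lemma wide0 : wide 0.
Proof.
split; first exact: mulmx0.
exists 0; split; first by apply: (tau_cond_isotropic HD); rewrite mulmx0.
by rewrite (tau1 HD); exact: mxg1 G_grp.
Qed.

Lemma wideD w1 w2 : wide w1 -> wide w2 -> wide (w1 + w2).
Proof.
move=> [v1 [c1 [k1 G1]]] [v2 [c2 [k2 G2]]]; split; first by rewrite mulmxDr v1 v2 addr0.
exists (c1 + c2 - bar D (lam D) *: (sharp D psi w1 *m w2)); split.
  exact: tau_cond_add.
by rewrite -tauM //; exact: mxgM G_grp _ _ G1 G2.
Qed.

Hypothesis G_long : forall c, conj_mx D c = - (lam D *: c) -> G (tau D psi v 0 c).

(** Two last terms admissible for the same [w] differ by a long argument. *)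
Lemma wide_fill w c : wide w -> tau_cond D psi w c -> G (tau D psi v w c).
Proof.
move=> [vw [c0 [k0 G0]]] kc.
have -> : tau D psi v w c = tau D psi v w c0 *m tau D psi v 0 (c - c0).
  rewrite tauM ?mulmx0 // scaler0 addr0 subr0; congr (tau _ _ _ _ _).
  by rewrite addrC subrK.
apply: (mxgM G_grp G0); apply: G_long.
rewrite (conj_mxD HD) (conj_mxN HD) scalerDr scalerN.
move: k0 kc => /eqP; rewrite addr_eq0 => /eqP e0 /eqP; rewrite addr_eq0 -e0 => /eqP e.
apply/eqP; rewrite -addr_eq0; apply/eqP.
have -> : conj_mx D c - conj_mx D c0 + (lam D *: c - lam D *: c0) =
    (conj_mx D c + lam D *: c) - (conj_mx D c0 + lam D *: c0) by zmod.
by rewrite e subrr.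
Qed.

End WideTransvections.

Section Hermitian.

Variables (P : pzRingType) (D : formData P) (r m : nat).
Hypothesis HD : invol_form D.
Variables (a_ c_ : 'rV[P]_r).
Hypothesis a_trace : forall i, a_ 0 i = c_ 0 i + lam D * bar D (c_ 0 i).
Local Notation n := (r + m)%N.
Local Notation l := (lam D).
Local Notation lb := (bar D (lam D)).
Local Notation cj := (conj_mx D).
Local Notation E := (FormData (bar D) (lam D) (Lam_max D)).
Local Notation psih := (psi_h D m a_).
Local Notation psi := (psi_q D n).
Local Notation shq := (sharp D psi).
Local Notation shh := (sharp D psih).
Local Notation A1 := (diag_mx a_).
Local Notation C1 := (diag_mx c_).

Lemma conj_A1 : cj A1 = lb *: A1.
Proof.
apply/matrixP => i j; rewrite !mxE eq_sym; case: eqP => [->|_].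
  rewrite !mulr1n a_trace (ifD HD) (ifM HD) (ifK HD) mulrDr mulrA (lb_l HD) mul1r.
  by rewrite (central_lb HD) addrC.
by rewrite !mulr0n (bar0 HD) mulr0.
Qed.

Lemma A1E : A1 = C1 + l *: cj C1.
Proof.
apply/matrixP => i j; rewrite !mxE eq_sym; case: eqP => [->|_].
  by rewrite !mulr1n a_trace.
by rewrite !mulr0n (bar0 HD) mulr0 addr0.
Qed.

Definition straighten : 'M[P]_(n + n) :=
  block_mx 1%:M 0 (block_mx (- cj C1) 0 0 0) 1%:M.
Definition straighten_inv : 'M[P]_(n + n) :=
  block_mx 1%:M 0 (block_mx (cj C1) 0 0 0) 1%:M.

Local Notation g := straighten.
Local Notation gi := straighten_inv.

Lemma conj_block p1 p2 q1 q2 (A : 'M[P]_(p1, q1)) (B : 'M_(p1, q2))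
    (C : 'M_(p2, q1)) (F : 'M_(p2, q2)) :
  cj (block_mx A B C F) = block_mx (cj A) (cj C) (cj B) (cj F).
Proof. by rewrite /conj_mx map_block_mx tr_block_mx. Qed.

Lemma straightenK : g *m gi = 1%:M /\ gi *m g = 1%:M.
Proof.
rewrite /g /gi !mulmx_block !(mulmx0, mul0mx, mulmx1, mul1mx, addr0, add0r) !add_block_mx.
by rewrite addrN addNr !addr0 !block_mx0 -!scalar_mx_block.
Qed.

Lemma straighten_form : cj g *m psih *m g = psi.
Proof.
rewrite /straighten /psi_h conj_block !conj_block !(conj_mx0 HD, conj_mx1 HD).
rewrite (conj_mxN HD) (conj_mxK HD).
rewrite !mulmx_block !(mulmx0, mul0mx, mulmx1, mul1mx, addr0, add0r).
rewrite mul_scalar_mx scale_block_mx !scaler0 !add_block_mx !addr0 scalerN A1E.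
have -> : C1 + l *: cj C1 - C1 - l *: cj C1 = 0 by zmod.
by rewrite block_mx0.
Qed.

Lemma straighten_inv_form : cj gi *m psi *m gi = psih.
Proof.
have [ggi gig] := straightenK; rewrite -straighten_form.
rewrite !mulmxA -conj_mxM // ggi conj_mx1 // mul1mx -mulmxA ggi.
by rewrite mulmx1.
Qed.

Lemma bvF i : bv P i false = col_mx (delta_mx i 0) 0 :> 'cV_(n + n).
Proof. exact: delta_mx_ushift. Qed.

Lemma bvT i : bv P i true = col_mx 0 (delta_mx i 0) :> 'cV_(n + n).
Proof. exact: delta_mx_dshift. Qed.

(** Transvections built from fixed vectors commute with [straighten], hence are left unchanged by
    the change of basis. All f_i are fixed, and so are the e_i with i > r. *)
Definition fixed v := g *m v = v /\ shq v *m g = shq v.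

Lemma fixedM v (a : 'M_1) : fixed v -> fixed (v *m a).
Proof. by move=> [gv vg]; split; [rewrite mulmxA gv|rewrite sharpM // -mulmxA vg]. Qed.

Lemma fixed0 : fixed 0.
Proof. by split; rewrite ?mulmx0 // sharp0 // mul0mx. Qed.

Lemma fixed_tau v w c : fixed v -> fixed w -> g *m tau D psi v w c = tau D psi v w c *m g.
Proof.
move=> [gv vg] [gw wg]; rewrite !tauE !(mulmxDr, mulmxDl, mulmxN, mulNmx).
rewrite mulmx1 mul1mx (mulmx_lb HD) -scalemxAl -!mulmxA vg wg !(mulmxA g) gv gw.
by rewrite !mulmxA.
Qed.

Lemma fixed_bvT i : fixed (bv P i true).
Proof.
split; first by rewrite bvT /straighten mul_block_col !mul0mx !mulmx0 mul1mx !add0r.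
rewrite sharp_bv // scale1r bvF tr_col_mx trmx0 /straighten mul_row_block.
by rewrite !mulmx0 !mul0mx !addr0 mulmx1.
Qed.

Lemma fixed_bvU i : fixed (bv P (rshift r i) false).
Proof.
rewrite /fixed bvF -[X in col_mx X _]/(delta_mx (rshift r i) 0) delta_mx_dshift; split.
  rewrite /straighten mul_block_col !mulmx0 !addr0 mul1mx.
  by rewrite mul_block_col !mulmx0 !mul0mx !addr0 col_mx0.
rewrite -delta_mx_dshift -bvF sharp_bv // -scalemxAl; congr (_ *: _).
rewrite bvT tr_col_mx trmx0 delta_mx_dshift tr_col_mx trmx0 /straighten mul_row_block.
by rewrite !mul0mx !add0r mulmx1 mul_row_block !mulmx0 !mul0mx !addr0 row_mx0.
Qed.

(** The lower part cancels the contribution of [A1], making the vector orthogonal to every e_j. It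
    is the middle term that presents [hm_mx] and [hr_mx] as transvections. *)
Definition hvec (zeta : 'cV[P]_r) : 'cV[P]_(n + n) :=
  col_mx (col_mx zeta 0) (col_mx (- (cj A1 *m zeta)) 0).

Lemma conj_col_mx p1 p2 q (X : 'M[P]_(p1, q)) (Y : 'M_(p2, q)) :
  cj (col_mx X Y) = row_mx (cj X) (cj Y).
Proof. by rewrite /conj_mx map_col_mx tr_col_mx. Qed.

Lemma sharp_hvec zeta : shh (hvec zeta) = l *: row_mx 0 (row_mx (cj zeta) 0).
Proof.
rewrite sharpE /hvec !conj_col_mx !(conj_mx0 HD) (conj_mxN HD) conj_mxM // conj_mxK //.
rewrite /psi_h mul_row_block mul_row_block !(mulmx0, mul0mx) !mulmx1 !addr0.
rewrite add_row_mx addr0 subrr row_mx0 scale_row_mx scaler0; congr (row_mx _ _).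
by rewrite -[l%:M]scalemx1 mulmx_l // mulmx1.
Qed.

Lemma sharp_hvec_self zeta : shh (hvec zeta) *m hvec zeta =
  - (\sum_(i < r) bar D (zeta i 0) * a_ 0 i * zeta i 0)%:M.
Proof.
rewrite sharp_hvec -scalemxAl /hvec !mul_row_col !mul0mx add0r addr0 mulmxN scalerN.
congr (- _); rewrite conj_A1 -scalemxAl (mulmx_lb HD) scale_l_lb //.
apply/matrixP => x y; rewrite !ord1 !mxE mulr1n; apply: eq_bigr => i _.
rewrite !mxE (bigD1 i) //= big1 ?addr0 => [|j ji].
  by rewrite !mxE eqxx mulr1n mulrA.
by rewrite !mxE eq_sym (negPf ji) mulr0n mul0r.
Qed.

(** By [sharp_hvec_self], [half_value] is the isometry condition [tau_cond] for this middle term;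
    the two forms are those of [hr_mx] and [hm_mx]. *)
Lemma hvec_cond zeta zeta_f : half_value D a_ zeta zeta_f ->
  tau_cond D psih (- hvec zeta) (bar D zeta_f)%:M /\
  tau_cond D psih (- (l *: hvec zeta)) (bar D zeta_f)%:M.
Proof.
rewrite /half_value => hz.
have E : cj (bar D zeta_f)%:M + l *: (bar D zeta_f)%:M + shh (hvec zeta) *m hvec zeta = 0.
  rewrite sharp_hvec_self (conj_scalar_mx HD) (ifK HD) scale_scalar_mx -raddfD.
  by rewrite hz subrr.
split; rewrite /tau_cond sharpN // mulNmx mulmxN opprK //.
by rewrite sharp_l // -scalemxAl mulmx_l // scale_lb_l.
Qed.

Lemma sharp_bvT i : shh (bv P i true) = row_mx (delta_mx 0 i) 0.
Proof.
rewrite bvT sharpE conj_col_mx (conj_mx0 HD) conj_delta // /psi_h mul_row_block.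
by rewrite !(mulmx0, mul0mx) !add0r mulmx1.
Qed.

Lemma sharp_bvU i :
  shh (bv P (rshift r i) false) = l *: row_mx 0 (row_mx 0 (delta_mx 0 i)).
Proof.
rewrite bvF delta_mx_dshift sharpE !conj_col_mx !(conj_mx0 HD) conj_delta // /psi_h.
rewrite mul_row_block mul_row_block !(mulmx0, mul0mx) !addr0 row_mx0.
by rewrite -[l%:M]scalemx1 mulmx_l // mulmx1 [in RHS]scale_row_mx scaler0.
Qed.

Lemma delta_outer (i : 'I_m) (x : P) :
  delta_mx i 0 *m (x%:M : 'M_1) *m (delta_mx 0 i : 'rV_m) = x *: delta_mx i i.
Proof.
apply/matrixP => y z; rewrite !mxE big_ord1 mxE big_ord1 !mxE !eqxx !andbT mulr1n.
by case: (y == _); case: (z == _); rewrite /= ?(mul0r, mulr0, mul1r, mulr1).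
Qed.

Lemma hr_mx_tau i zeta zeta_f : hr_mx D a_ i zeta zeta_f =
  tau D psih (bv P (rshift r i) false) (- hvec zeta) (bar D zeta_f)%:M.
Proof.
rewrite tauE sharpN // sharp_hvec sharp_bvU mulmxN mulNmx !(mulmx_l HD).
rewrite scalerN scale_lb_l // opprK.
rewrite bvF delta_mx_dshift /hvec !mul_col_row !(mulmx0, mul0mx).
have -> (x : P) : col_mx (col_mx 0 (delta_mx i 0)) 0 *m (x%:M : 'M_1) =
    col_mx (col_mx 0 (delta_mx i 0 *m x%:M)) 0 :> 'cV_(n + n).
  by rewrite !mul_col_mx !mul0mx.
rewrite !mul_col_row !(mulmx0, mul0mx) delta_outer.
rewrite !scale_block_mx !scaler0 scalar_mx_block !opp_block_mx !add_block_mx.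
rewrite !(addr0, subr0, add0r, oppr0) (scalar_mx_block r m) !add_block_mx.
rewrite !(addr0, subr0, add0r, sub0r) mulNmx scalerA /hr_mx /at_col conj_mxM // conj_delta //.
by rewrite -(scalar_mx_block r m) mulmxA.
Qed.

Lemma hm_mx_tau i zeta zeta_f : hm_mx D a_ i zeta zeta_f =
  tau D psih (bv P (rshift r i) true) (- (l *: hvec zeta)) (bar D zeta_f)%:M.
Proof.
rewrite tauE sharpN // sharp_l // sharp_hvec scale_lb_l // sharp_bvT mulmxN mulNmx.
rewrite -scalemxAl scalerN scale_lb_l // opprK delta_mx_rshift bvT delta_mx_dshift.
have -> (x : P) : col_mx 0 (col_mx 0 (delta_mx i 0)) *m (x%:M : 'M_1) =
    col_mx 0 (col_mx 0 (delta_mx i 0 *m x%:M)) :> 'cV_(n + n).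
  by rewrite !mul_col_mx !mul0mx.
rewrite /hvec !mul_col_row !(mulmx0, mul0mx) delta_outer.
rewrite !(scalar_mx_block n n) !opp_block_mx !add_block_mx.
rewrite !(addr0, subr0, add0r, sub0r, oppr0) !(scalar_mx_block r m) !add_block_mx.
rewrite !(addr0, subr0, add0r, sub0r) mulNmx /hm_mx /at_col conj_mxM // conj_delta //.
by rewrite mulmxA.
Qed.

Lemma half_value_exists zeta : exists zeta_f, half_value D a_ zeta zeta_f.
Proof.
exists (\sum_i bar D (zeta i 0) * c_ 0 i * zeta i 0).
rewrite /half_value (bar_sum HD) mulr_sumr -big_split; apply: eq_bigr => i _ /=.
rewrite a_trace !(ifM HD) (ifK HD) mulrDr mulrDl; congr (_ + _).
by rewrite !mulrA (ifC HD).
Qed.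

Lemma straighten_inv_hvec zeta : gi *m hvec zeta =
  col_mx (col_mx zeta 0) (col_mx ((cj C1 - cj A1) *m zeta) 0).
Proof.
rewrite /straighten_inv /hvec mul_block_col mul0mx addr0 !mul1mx mul_block_col.
by rewrite !(mul0mx, mulmx0) !addr0 add_col_mx addr0 mulmxBl.
Qed.

Lemma straighten_inv_hvec_coef zeta (i : 'I_m) :
  (gi *m hvec zeta) (lshift n (rshift r i)) 0 = 0 /\
  (gi *m hvec zeta) (rshift n (rshift r i)) 0 = 0.
Proof.
by rewrite straighten_inv_hvec col_mxEu !col_mxEd !mxE.
Qed.

Lemma mx_group_conj (G : 'M[P]_(n + n) -> Prop) (h h' : 'M_(n + n)) :
  h *m h' = 1%:M -> h' *m h = 1%:M -> mx_group G -> mx_group (fun M => G (h *m M *m h')).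
Proof.
move=> hh' h'h [G1 GM GV]; split.
- by rewrite mulmx1 hh'.
- move=> A B GA GB; have := GM _ _ GA GB.
  by rewrite !mulmxA -(mulmxA _ h' h) h'h mulmx1.
- move=> A B GA AB BA; apply: (GV _ _ GA); rewrite !mulmxA.
    by rewrite -(mulmxA _ h' h) h'h mulmx1 -(mulmxA h) AB mulmx1.
  by rewrite -(mulmxA _ h' h) h'h mulmx1 -(mulmxA h) BA mulmx1.
Qed.

Lemma fixed_conj M : g *m M = M *m g -> gi *m M *m g = M /\ g *m M *m gi = M.
Proof.
have [ggi gig] := straightenK => gM; split.
  by rewrite -mulmxA -gM mulmxA gig mul1mx.
by rewrite gM -mulmxA ggi mulmx1.
Qed.

Lemma tau_straighten v w c : gi *m tau D psih v w c *m g = tau D psi (gi *m v) (gi *m w) c.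
Proof.
have [ggi gig] := straightenK.
by rewrite (tau_transport HD _ _ _ straighten_inv_form) -mulmxA gig mulmx1.
Qed.

Lemma tau_unstraighten v w c : g *m tau D psi v w c *m gi = tau D psih (g *m v) (g *m w) c.
Proof.
have [ggi gig] := straightenK.
by rewrite (tau_transport HD _ _ _ straighten_form) -mulmxA ggi mulmx1.
Qed.

Lemma straighten_inv_fixed v : fixed v -> gi *m v = v.
Proof.
have [ggi gig] := straightenK => -[gv _].
by rewrite -{1}gv mulmxA gig mul1mx.
Qed.

Lemma tau_cond_straighten w c : tau_cond D psih w c -> tau_cond D psi (gi *m w) c.
Proof.
by rewrite /tau_cond mulmxA (sharp_transport HD _ straighten_inv_form).
Qed.

Let HE : invol_form E.
Proof. by case: HD => *; split. Qed.
Let E_form : form_parameter E (Lam E). Proof. exact: Lam_max_form. Qed.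

(** For the largest form parameter every long isometry along a basis vector is a generator, as
    [wide_fill] requires. *)
Lemma long_mx (c : 'M[P]_1) : cj c = - (l *: c) ->
  exists2 x, Lam_long E x & c = x%:M.
Proof.
rewrite [c]mx11_scalar; move: (c 0 0) => x e; exists x => //.
have {}e : bar D x = - (l * x).
  by have /matrixP/(_ 0 0) := e; rewrite !mxE !mulr1n.
rewrite /Lam_long /= /Lam_max (ifM HD) e mulNr mulrN opprK.
by rewrite (ifC HD x) -mulrA (ifL HD) mulr1 (ifC HD).
Qed.

Local Notation EQE := (@EQ P E n).

Lemma EQ_wide (i : 'I_n) b (w : 'cV_(n + n)) : w (lshift n i) 0 = 0 -> w (rshift n i) 0 = 0 ->
  wide D psi EQE (bv P i b) w.
Proof.
have EQg : mx_group EQE by exact: sgen_group.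
move=> wF wT; rewrite (bv_basis w).
have W0 : wide D psi EQE (bv P i b) 0 by exact: wide0.
have WD w1 w2 : wide D psi EQE (bv P i b) w1 -> wide D psi EQE (bv P i b) w2 ->
    wide D psi EQE (bv P i b) (w1 + w2).
  by apply: wideD => //; [exact: psi_q_herm|exact: sharp_bv_iso].
have W1 j b' a : i != j -> wide D psi EQE (bv P i b) (bv P j b' *m a%:M).
  move=> ij; split; first exact/orth_mulr/sharp_bv_ne.
  exists 0; split; first by have [] := tau_bv_cond HD b b' a%:M ij.
  exact/(EQ_tgen HE E_form)/sg_in/tg_short.
elim/big_ind: _ => [||j _] //; have [<-|ij] := eqVneq i j; last by apply: WD; exact: W1.
by rewrite wF wT !raddf0 addr0.
Qed.

(** The first five families are built from fixed vectors. In the last two the middle term has, after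
    the change of basis, no component in the plane of the first vector, so that [EQ_wide]
    applies. *)
Lemma EH_straighten M : EH D a_ M -> EQE (gi *m M *m g).
Proof.
have [ggi gig] := straightenK.
have EQg : mx_group EQE by exact: sgen_group.
apply: (sgen_sub (mx_group_conj gig ggi EQg)).
have EQfill i b w c : tau_cond D psi w c -> w (lshift n i) 0 = 0 ->
    w (rshift n i) 0 = 0 -> EQE (tau D psi (bv P i b) w c).
  move=> wc wF wT; apply: (wide_fill HD (psi_q_herm n HD) EQg (sharp_bv_iso HD i b)) wc.
    move=> d /long_mx[x Lx ->].
    exact/(EQ_tgen HE E_form)/sg_in/tg_long.
  exact: EQ_wide.
move=> {}M [i j a ij|i j a ij|i a La|i j a ij|i a La|i z zf hz|i z zf hz].
- rewrite -(tau_eps HD) (proj1 (fixed_conj _)).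
    rewrite tau_eps //; exact/sg_in/q_eps.
  by apply: fixed_tau; [exact: fixed_bvU|exact/fixedM/fixed_bvT].
- rewrite -(tau_r HD) (proj1 (fixed_conj _)).
    by rewrite tau_r //; apply/sg_in/q_r; rewrite (inj_eq (@rshift_inj _ _)).
  by apply: fixed_tau; [exact: fixed_bvU|exact/fixedM/fixed_bvU].
- rewrite -(tau_r_diag HD) (proj1 (fixed_conj _)).
    rewrite tau_r_diag //; exact/sg_in/q_r_diag.
  by apply: fixed_tau; [exact: fixed_bvU|exact: fixed0].
- rewrite -(tau_l HD) (proj1 (fixed_conj _)).
    rewrite tau_l //; exact/sg_in/q_l.
  by apply: fixed_tau; [exact: fixed_bvT|exact/fixedM/fixed_bvT].
- rewrite -(tau_l_diag HD) (proj1 (fixed_conj _)).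
    rewrite tau_l_diag //; exact/sg_in/q_l_diag.
  by apply: fixed_tau; [exact: fixed_bvT|exact: fixed0].
- have [_ cond] := hvec_cond hz; rewrite hm_mx_tau tau_straighten.
  rewrite (straighten_inv_fixed (fixed_bvT _)).
  have [cF cT] := straighten_inv_hvec_coef z i.
  apply: EQfill; first exact: tau_cond_straighten.
    by rewrite mulmxN (mulmx_l HD) mxE mxE cF mulr0 oppr0.
  by rewrite mulmxN (mulmx_l HD) mxE mxE cT mulr0 oppr0.
- have [cond _] := hvec_cond hz; rewrite hr_mx_tau tau_straighten.
  rewrite (straighten_inv_fixed (fixed_bvU _)).
  have [cF cT] := straighten_inv_hvec_coef z i.
  apply: EQfill; first exact: tau_cond_straighten.
    by rewrite mulmxN mxE cF oppr0.
  by rewrite mulmxN mxE cT oppr0.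
Qed.

(** By [plane_generation] only one plane beyond [r] matters, and only its pairing with an e-vector
    of index at most [r] involves a vector that is not fixed. There [hm_mx] or [hr_mx] gives the
    right middle term up to a multiple of the f-vector of the same index, which a short generator
    removes; [wide] takes care of the last terms. *)
Lemma EQ_unstraighten (i0 : 'I_m) M : EQE M -> EH D a_ (g *m M *m gi).
Proof.
have [ggi gig] := straightenK.
pose G X := EH D a_ (g *m X *m gi).
have G_grp : mx_group G by apply: mx_group_conj => //; exact: sgen_group.
have Gfix X : g *m X = X *m g -> EH_gen D a_ X -> G X.
  by move=> /fixed_conj[_ e] hX; rewrite /G e; exact: sg_in.
pose k0 := rshift r i0.
move=> /(EQ_tgen HE E_form); apply: (sgen_sub G_grp).
have G_long b c : Lam_long E c -> G (tau D psi (bv P k0 b) 0 c%:M).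
  move=> Lc; have cb := Lam_long_bar HE E_form Lc; apply: Gfix.
    by apply: fixed_tau; [case: b; [exact: fixed_bvT|exact: fixed_bvU]|exact: fixed0].
  case: b.
    rewrite tau_l_diag //; apply: h_l_diag; rewrite [bar D c]cb.
    by case: E_form => _ _ _ _; exact: (form_parameterN HE E_form).
  have -> : c = lb * (l * c) by rewrite mulrA (lb_l HD) mul1r.
  by rewrite tau_r_diag //; exact: h_r_diag.
apply: (plane_generation HE (k0 := k0) G_grp) => // [c Lc|b j b' a kj].
  exact: (Lam_long_bar HE E_form Lc).
have kU (l0 : 'I_r) : k0 != lshift m l0 by rewrite /k0 eq_rlshift.
have fixed_k b0 : fixed (bv P k0 b0) by case: b0; [exact: fixed_bvT|exact: fixed_bvU].
have G_good b0 j0 b1 x : k0 != j0 -> (b1 || [exists j1, j0 == rshift r j1]) ->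
    G (tau D psi (bv P k0 b0) (bv P j0 b1 *m x%:M) 0).
  move=> kj0 good_j; apply: Gfix.
    apply: (fixed_tau _ (fixed_k _)); apply: fixedM; case: b1 good_j =>
      [_|/= /existsP[j1 /eqP->]].
      exact: fixed_bvT.
    exact: fixed_bvU.
  case: b1 good_j => [_|/= /existsP[j1 /eqP j0E]]; case: b0.
  - by rewrite -[x](ifK HD) tau_l //; exact: h_l.
  - by rewrite -[x](ifK HD) tau_eps //; exact: h_eps.
  - have -> : x = - (l * - (lb * x)) by rewrite mulrN opprK mulrA (ifL HD) mul1r.
    by rewrite j0E tau_eps_opp //; apply: h_eps; rewrite -j0E eq_sym.
  - have -> : x = l * bar D (bar D x * l).
      by rewrite (ifM HD) (ifK HD) mulrA (ifL HD) mul1r.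
    by rewrite j0E tau_r //; apply: h_r; move: kj0; rewrite j0E (inj_eq (@rshift_inj _ _)).
have [good_j|] := boolP (b' || [exists j1, j == rshift r j1]); first exact: G_good.
rewrite negb_or => /andP[/negPf-> bad_j].
have [l0 ->] : exists l0, j = lshift m l0.
  case: (split_ordP j) bad_j => [l0 ->|j1 ->]; first by exists l0.
  by case/existsP; exists j1.
have psiH := psi_q_herm n HD; have kk := sharp_bv_iso HD k0 b.
have G_fill d : cj d = - (l *: d) -> G (tau D psi (bv P k0 b) 0 d).
  by move=> /long_mx[x Lx ->]; exact: G_long.
apply: (wide_fill HD psiH G_grp kk G_fill); last by have [] :=
  tau_bv_cond HD b false a%:M (kU l0).
have uE z : gi *m hvec (delta_mx l0 0 *m z%:M) =
    bv P (lshift m l0) false *m z%:M +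
    bv P (lshift m l0) true *m ((bar D (c_ 0 l0) - bar D (a_ 0 l0)) * z)%:M.
  rewrite straighten_inv_hvec bvF bvT !delta_mx_ushift !mul_col_mx !mul0mx add_col_mx.
  rewrite addr0 add0r mulmxA; congr (col_mx _ (col_mx _ _)).
  have -> : (cj C1 - cj A1) *m delta_mx l0 0 =
      delta_mx l0 0 *m (bar D (c_ 0 l0) - bar D (a_ 0 l0))%:M :> 'cV_r.
    rewrite -colE; apply/colP => x; rewrite !mxE big_ord1 !mxE eqxx andbT mulr1n.
    have [_|_] := eqVneq x l0; first by rewrite mul1r !mulr1n.
    by rewrite mul0r !mulr0n bar0 // subrr.
  by rewrite -mulmxA -scalar_mxM.
have wide_true x : wide D psi G (bv P k0 b) (bv P (lshift m l0) true *m x%:M).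
  have [kk' kx cond] := tau_bv_cond HD b true x%:M (kU l0).
  by split=> //; exists 0; split=> //; exact: G_good.
have [y w_xy] : exists y, wide D psi G (bv P k0 b)
    (bv P (lshift m l0) false *m a%:M + bv P (lshift m l0) true *m y%:M).
  (* Chosen so that the e-component of [gi *m w] is [a]; the f-component is then whatever it is, and
     becomes [y]. *)
  pose z := if b then - (lb * a) else - a.
  pose zeta : 'cV_r := delta_mx l0 0 *m z%:M; have [zf hz] := half_value_exists zeta.
  pose w := if b then - (l *: hvec zeta) else - hvec zeta.
  exists (if b then - (l * ((bar D (c_ 0 l0) - bar D (a_ 0 l0)) * z))
          else - ((bar D (c_ 0 l0) - bar D (a_ 0 l0)) * z)).
  have -> : bv P (lshift m l0) false *m a%:M + bv P (lshift m l0) true *m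
      (if b then - (l * ((bar D (c_ 0 l0) - bar D (a_ 0 l0)) * z))
          else - ((bar D (c_ 0 l0) - bar D (a_ 0 l0)) * z))%:M = gi *m w.
    have lE (u : 'cV[P]_(n + n)) x : - (l *: (u *m x%:M)) = u *m (- (l * x))%:M.
      by rewrite -(mulmx_l HD) scale_scalar_mx -mulmxN -raddfN.
    have NE (u : 'cV[P]_(n + n)) x : - (u *m x%:M) = u *m (- x)%:M.
      by rewrite -mulmxN -raddfN.
    rewrite /w /zeta /z; case: (b); rewrite mulmxN ?(mulmx_l HD) uE ?scalerDr opprD.
      by rewrite !lE; congr (_ *m _%:M + _); rewrite mulrN opprK mulrA (ifL HD) mul1r.
    by rewrite !NE opprK.
  have [cond_r cond_m] := hvec_cond hz.
  split.
    have kw b0 : sharp D psi (bv P k0 b0) *m (gi *m hvec zeta) = 0.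
      rewrite uE mulmxDr !mulmxA !sharp_bv_ne ?mul0mx ?addr0 //; exact: kU.
    by rewrite /w; case: (b); rewrite !(mulmxN, mulmx_l HD) kw ?scaler0 oppr0.
  exists (bar D zf)%:M; split.
    by apply: tau_cond_straighten; rewrite /w; case: (b).
  rewrite /G tau_unstraighten; have [-> _] := fixed_k b.
  rewrite mulmxA ggi mul1mx /w; case: (b).
    by rewrite -hm_mx_tau; exact/sg_in/h_m.
  by rewrite -hr_mx_tau; exact/sg_in/h_rv.
have := wideD HD psiH G_grp kk w_xy (wide_true (- y)).
by rewrite -addrA -mulmxDr -raddfD subrr !raddf0 addr0.
Qed.

End Hermitian.

Lemma map_straighten (P Q : pzRingType) (D : formData P) (E : formData Q) (f :
  {rmorphism P -> Q})
    r m (c : 'rV[P]_r) : form_morph D E f ->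
  map_mx f (straighten D m c) = straighten E m (map_mx f c) /\
  map_mx f (straighten_inv D m c) = straighten_inv E m (map_mx f c).
Proof.
move=> fE; rewrite /straighten /straighten_inv !map_block_mx !map_mxN !map_mx0 !map_mx1.
by rewrite !(map_conj_mx fE) !map_diag_mx.
Qed.

Theorem theorem1 (k : comNzRingType) (R : algType k) (D : formData R)
    (R_fg : fin_gen_module R)
    (D_form : form_ring D)
    (bar_linear : forall (c : k) (x : R), bar D (c *: x) = c *: bar D x) :
  (forall (n : nat) (alpha : 'M[{poly R}]_(n + n)),
     (6 <= 2 * n)%N ->
     GQ (poly_form D) alpha ->
     map_mx (fun p : {poly R} => p.[0]) alpha = 1%:M ->
     (forall (m : maxideal k) (nz : (1 : loc_at R m) != 0),
        EQ (poly_form (loc_form nz D)) (map_mx (poly_loc nz) alpha)) ->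
     EQ (poly_form D) alpha)
  /\
  (forall (r s : nat) (a : 'rV[R]_r) (alpha : 'M[{poly R}]_((r + s) + (r + s))),
     (1 <= r)%N ->
     (0 < s)%N ->
     (6 <= 2 * (r + s))%N ->
     (forall i : 'I_r, trace_elt D (a 0 i)) ->
     (forall i : 'I_r, val i = 0%N -> a 0 i = 0) ->
     GH (poly_form D) (map_mx polyC a) alpha ->
     map_mx (fun p : {poly R} => p.[0]) alpha = 1%:M ->
     (forall (m : maxideal k) (nz : (1 : loc_at R m) != 0),
        EH (poly_form (loc_form nz D))
           (map_mx (fun x : R => (loc_map (compl_maxideal m) x : nzloc nz)%:P) a)
           (map_mx (poly_loc nz) alpha)) ->
     EH (poly_form D) (map_mx polyC a) alpha).
Proof.
have HD := form_ring_invol D_form; have [_ _ _ HL] := D_form.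
split=> [n alpha n6 [alpha_GL _ _ _] alpha0 alpha_loc|].
  by apply: (EQ_local_global HD bar_linear HL) => //; rewrite -(leq_pmul2l (m := 2)).
move=> r s a alpha _ s0 n6 a_trace _ [[alpha' [aa' a'a]] _] alpha0 alpha_loc.
have /fin_all_exists[c0 c0E] i := a_trace i.
pose c : 'rV[R]_r := \row_i c0 i.
have HA : invol_form (poly_form D) by exact: (poly_invol (Lam (poly_form D)) HD).
have aC i : (map_mx (@polyC R) a) 0 i = (map_mx (@polyC R) c) 0 i +
    lam (poly_form D) * bar (poly_form D) ((map_mx (@polyC R) c) 0 i).
  by rewrite !mxE /= (bar_polyC HD) -polyCM -polyCD c0E.
pose g := straighten (poly_form D) s (map_mx (@polyC R) c).
pose gi := straighten_inv (poly_form D) s (map_mx (@polyC R) c).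
have [ggi gig] : g *m gi = 1%:M /\ gi *m g = 1%:M by exact: straightenK.
have alphaE : alpha = g *m (gi *m alpha *m g) *m gi.
  by rewrite !mulmxA ggi mul1mx -mulmxA ggi mulmx1.
rewrite alphaE; apply: (EQ_unstraighten HA aC (Ordinal s0)).
(* [EH] admits all of [Lam_max] over R[X] and over R_m[X], so the parameter here is the largest one
   and not [Lam (poly_form D)]. *)
apply: (EQ_local_global_max HD bar_linear).
- by rewrite -(leq_pmul2l (m := 2)).
- have [_ GLM _] := is_GL_group {poly R} ((r + s) + (r + s)).
  by apply: (GLM); [apply: (GLM); [exists g|exists alpha']|exists gi].
(* As [coefp 0], evaluation at 0 is a ring morphism and goes through matrix products. *)
- have coef0E (M : 'M[{poly R}]_((r + s) + (r + s))) :
      map_mx (fun p : {poly R} => p.[0]) M = map_mx (coefp 0) M.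
    by apply: eq_map_mx => p; rewrite horner_coef0.
  rewrite coef0E in alpha0; rewrite coef0E !map_mxM alpha0 mulmx1.
  by rewrite -map_mxM gig map_mx1.
- move=> m nz.
  have HDm : invol_form (loc_form nz D) by exact: loc_invol.
  have HAm : invol_form (poly_form (loc_form nz D)).
    exact: (poly_invol (Lam (poly_form (loc_form nz D))) HDm).
  pose phi : {rmorphism {poly R} -> {poly nzloc nz}} := map_poly (nzloc_map nz).
  have phi_form : form_morph (poly_form D) (poly_form (loc_form nz D)) phi.
    exact/(map_poly_form_morph _ _ HD HDm)/nzloc_form_morph.
  have [mg mgi] := map_straighten s (map_mx (@polyC R) c) phi_form.
  have -> : map_mx (poly_loc nz) (gi *m alpha *m g) =
      map_mx phi gi *m map_mx (poly_loc nz) alpha *m map_mx phi g.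
    by rewrite -[poly_loc nz]/(phi : {poly R} -> {poly nzloc nz}) !map_mxM.
  rewrite mg mgi; apply: (EH_straighten HAm _ (alpha_loc m nz)) => i.
  rewrite !mxE; transitivity (phi (a 0 i)%:P); first by rewrite /phi /= map_polyC.
  rewrite c0E -(fm_bar phi_form) -(fm_lam phi_form) -rmorphM -rmorphD; congr (phi _).
  by rewrite /= (bar_polyC HD) -polyCM -polyCD.
Qed.
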